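(* Let $V$ be a sublinear operator mapping two-parameter dyadic martingales to measurable functions on $[0,1)^2$. Assume the following two conditions. 1) The operator $V$ is bounded between $L^2$ and $L^2$. 2) Whenever $u$ is a simple martingale with $u_{0,0}=0$ and $\{e_n\}_{n\in\mathbb{Z}_+^2\setminus\{(0,0)\}}$ are sets such that for every $n\in\mathbb{Z}_+^2\setminus\{(0,0)\}$ $$\Delta_n u=\mathbf{1}_{e_n}\Delta_n u,\qquad\text{where } e_n\in\mathcal{F}_m\text{ for some } m\in\mathbb{Z}_+^2\text{ with } m\le n,\ m\ne n,$$ we have $$\{|Vu|>0\}\subseteq\bigcup_{n\in\mathbb{Z}_+^2\setminus\{(0,0)\}}e_n .$$ Then $V$ is bounded between $H^p$ and $L^p$ for every $0<p\le 1$.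
   Context: $\mathbb{Z}_+=\{0,1,2,\dots\}$. For $n=(n_1,n_2)$, $m=(m_1,m_2)$ in $\mathbb{Z}_+^2$, $n\le m$ means $n_1\le m_1$ and $n_2\le m_2$. For $n\in\mathbb{Z}_+^2$, $\mathcal{F}_n=\mathcal{F}_{n_1,n_2}$ is the $\sigma$-algebra on $[0,1)^2$ generated by the dyadic rectangles $\left[\frac{k_1}{2^{n_1}},\frac{k_1+1}{2^{n_1}}\right)\times\left[\frac{k_2}{2^{n_2}},\frac{k_2+1}{2^{n_2}}\right)$, $0\le k_i<2^{n_i}$, and $\mathbb{E}_n$ is the conditional expectation with respect to $\mathcal{F}_n$ (for Lebesgue measure). $L^p=L^p([0,1)^2)$. A (two-parameter dyadic) martingale is a family $u=\{u_n\}_{n\in\mathbb{Z}_+^2}$ of integrable functions such that each $u_n$ is $\mathcal{F}_n$-measurable and $\mathbb{E}_n u_m=u_n$ whenever $n\le m$. For $0<p\le\infty$ it belongs to $L^p$ if $u_n\in L^p$ for all $n$ and $\|u\|_{L^p}:=\sup_n\|u_n\|_{L^p}<\infty$; for $1<p<\infty$ a martingale $u\in L^p$ is identified with the function $g\in L^p$ such that $u_n=\mathbb{E}_n g$ for all $n$ (and then $\|u\|_{L^p}=\|g\|_{L^p}$). A martingale $u$ is simple if there exists $m\in\mathbb{Z}_+^2$ such that $u_n=\mathbb{E}_m u_n$ for all $n\in\mathbb{Z}_+^2$. Martingale differences: $\Delta_{n_1,n_2}u=u_{n_1,n_2}-u_{n_1-1,n_2}-u_{n_1,n_2-1}+u_{n_1-1,n_2-1}$,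 where any term with an index equal to $-1$ is taken to be $0$. Square function: $S(u)=\big(\sum_{n\in\mathbb{Z}_+^2}|\Delta_n u|^2\big)^{1/2}$. For $0<p<\infty$ the Hardy space $H^p$ consists of the martingales $u$ with $\|u\|_{H^p}:=\|S(u)\|_{L^p}<\infty$. Sublinear means $|V(u+v)|\le|Vu|+|Vv|$ and $|V(cu)|=|c|\,|Vu|$ for scalars $c$. Measurable functions are identified when equal a.e., and inclusions between sets are understood up to null sets. Bounded between $L^2$ and $L^2$ means that there is a constant $C$ with $\|Vu\|_{L^2}\le C\|u\|_{L^2}$ for all martingales $u\in L^2$. Bounded between $H^p$ and $L^p$ means that there is a constant $C$ with $\|Vu\|_{L^p}\le C\|u\|_{H^p}$ for all $u\in H^p$.
   Formalization: As stated, V may be arbitrary on H^p outside L^2 and the claim fails; what is proved is that some sublinear operator W with measurable (extended-real) values, equal to V on L^2, is bounded between H^p and L^p for every 0<p≤1, so V is bounded on H^p∩L^2. *)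

(* Defs.v *)
From HB Require Import structures.
From mathcomp Require Import all_boot all_order all_algebra.
From mathcomp Require Import all_classical all_reals all_analysis.
From mathcomp Require Import measurable_realfun.
Set Implicit Arguments.
Unset Strict Implicit.
Unset Printing Implicit Defensive.
Import Order.TTheory GRing.Theory Num.Theory.
Import numFieldNormedType.Exports.
Local Open Scope classical_set_scope.
Local Open Scope ring_scope.

(* [measurableTypeR R] is R with its Borel sigma-algebra. *)
Definition plane (R : realType) : measurableType _ :=
  (measurableTypeR R * measurableTypeR R)%type.

Definition unit_square (R : realType) : set (plane R) :=
  `[0, 1[%classic `*` `[0, 1[%classic.
Arguments unit_square : clear implicits.

Lemma measurable_unit_square (R : realType) :
  measurable (unit_square R : set (plane R)).
Proof. by apply: measurableX; exact: measurable_itv. Qed.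
Arguments measurable_unit_square : clear implicits.

(* Lebesgue measure on [0,1)^2, as a measure on the plane that does not charge
   the complement of the square. *)
Definition leb2 (R : realType)
  : {measure set (plane R) -> \bar R} :=
  mrestr (@lebesgue_measure R \x @lebesgue_measure R)%E
         (measurable_unit_square R).
Arguments leb2 : clear implicits.

Definition le2 (m n : nat * nat) : bool := (m.1 <= n.1)%N && (m.2 <= n.2)%N.

Definition dyadic_itv (R : realType) (n k : nat) : set R :=
  `[k%:R / 2 ^+ n, k.+1%:R / 2 ^+ n[%classic.
Arguments dyadic_itv : clear implicits.

Definition dyadic_rectangles (R : realType) (n : nat * nat)
  : set (set (plane R)) :=
  [set A | exists k : nat * nat,
     [/\ (k.1 < 2 ^ n.1)%N, (k.2 < 2 ^ n.2)%N &
         A = dyadic_itv R n.1 k.1 `*` dyadic_itv R n.2 k.2]].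
Arguments dyadic_rectangles : clear implicits.

(* A sigma-algebra on the square: its members are subsets of the square. *)
Definition dyadic_sigma (R : realType) (n : nat * nat) : set (set (plane R)) :=
  <<s unit_square R, dyadic_rectangles R n >>.
Arguments dyadic_sigma : clear implicits.

Definition dyadic_measurable (R : realType) (n : nat * nat) (f : plane R -> R)
  : Prop :=
  forall Y : set (measurableTypeR R), measurable Y ->
    dyadic_sigma R n (unit_square R `&` f @^-1` Y).

(* [is_condexp n f g]: g = E_n f.  Every nonempty set of [dyadic_sigma R n] has
   positive measure, so g is determined everywhere on the square. *)
Definition is_condexp (R : realType) (n : nat * nat) (f g : plane R -> R)
  : Prop :=
  [/\ dyadic_measurable n g,
      (leb2 R).-integrable setT (EFin \o g) &
      forall A, dyadic_sigma R n A ->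
        (\int[leb2 R]_(x in A) (g x)%:E = \int[leb2 R]_(x in A) (f x)%:E)%E].

Definition family (R : realType) : Type := nat * nat -> plane R -> R.

(* A function on the square is encoded by its extension by 0 to the plane, so
   that equal martingales are equal families. *)
Definition is_martingale (R : realType) (u : family R) : Prop :=
  [/\ forall n x, ~ unit_square R x -> u n x = 0,
      forall n, (leb2 R).-integrable setT (EFin \o u n),
      forall n, dyadic_measurable n (u n) &
      forall n m, le2 n m -> is_condexp n (u m) (u n)].

Definition is_simple (R : realType) (u : family R) : Prop :=
  exists m : nat * nat, forall n, is_condexp m (u n) (u n).

Definition fam_add (R : realType) (u v : family R) : family R :=
  fun n x => u n x + v n x.

Definition fam_scale (R : realType) (c : R) (u : family R) : family R :=
  fun n x => c * u n x.

Definition norm_Lp (R : realType) (p : R) (u : family R) : \bar R :=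
  ereal_sup (range (fun n : nat * nat => 'N[leb2 R]_(p%:E)[EFin \o u n]%E)).

Definition in_Lp (R : realType) (p : R) (u : family R) : Prop :=
  is_martingale u /\ (norm_Lp p u < +oo)%E.

(* [lag a k] is a_{k-1}, with a_{-1} = 0. *)
Definition lag (R : realType) (a : nat -> R) (k : nat) : R :=
  if k is j.+1 then a j else 0.

Definition mdiff (R : realType) (u : family R) : family R :=
  fun n x => u n x - lag (fun i => u (i, n.2) x) n.1
                   - lag (fun j => u (n.1, j) x) n.2
                   + lag (fun i => lag (fun j => u (i, j) x) n.2) n.1.

Definition square_function (R : realType) (u : family R) (x : plane R)
  : \bar R :=
  (sqrte (\esum_(n in [set: nat * nat]) (`|mdiff u n x| ^+ 2)%:E))%E.

Definition norm_Hp (R : realType) (p : R) (u : family R) : \bar R :=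
  ('N[leb2 R]_(p%:E)[square_function u])%E.

Definition in_Hp (R : realType) (p : R) (u : family R) : Prop :=
  is_martingale u /\ (norm_Hp p u < +oo)%E.

(* An operator takes values in the extended reals, so that total operators such
   as [square_function] are covered; real-valued V are those of the form
   fun u => EFin \o V' u.  Only its values on martingales matter. *)
Definition operator (R : realType) : Type := family R -> plane R -> \bar R.

Definition measurable_valued (R : realType) (V : operator R) : Prop :=
  forall u, is_martingale u ->
    measurable_fun [set: plane R] (V u).

Definition sublinear (R : realType) (V : operator R) : Prop :=
  (forall u v, is_martingale u -> is_martingale v ->
     {ae leb2 R, forall x,
        (`|V (fam_add u v) x| <= `|V u x| + `|V v x|)%E}) /\
  (forall (c : R) u, is_martingale u ->
     {ae leb2 R, forall x,
        (`|V (fam_scale c u) x| = `|c|%:E * `|V u x|)%E}).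

Definition bounded_L2_L2 (R : realType) (V : operator R) : Prop :=
  exists C : R, forall u, in_Lp 2 u ->
    ('N[leb2 R]_(2%:E)[V u] <= C%:E * norm_Lp 2 u)%E.

Definition bounded_Hp_Lp (R : realType) (p : R) (V : operator R) : Prop :=
  exists C : R, forall u, in_Hp p u ->
    ('N[leb2 R]_(p%:E)[V u] <= C%:E * norm_Hp p u)%E.

Definition support_condition (R : realType) (V : operator R) : Prop :=
  forall (u : family R) (e : nat * nat -> set (plane R)),
    is_martingale u -> is_simple u ->
    (forall x, u (0, 0)%N x = 0) ->
    (forall n, n != (0, 0)%N ->
       (exists m, [/\ le2 m n, m != n & dyadic_sigma R m (e n)]) /\
       (forall x, mdiff u n x = \1_(e n) x * mdiff u n x)) ->
    {ae leb2 R, forall x, (0 < `|V u x|)%E ->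
       (\bigcup_(n in [set n : nat * nat | n != (0, 0)%N]) e n) x}.

(* Sublinearity and a bound on L^2 do not constrain V on H^p \ L^2: if l is a
   nonzero linear functional on martingales that vanishes on L^2, the operator
   V u = l(u) * 1 is sublinear and is 0 on L^2.  So an operator controlled on
   L^2 is bounded from H^p to L^p in the sense that its extension W from L^2
   is: as L^2 is dense in H^p, sublinearity and the bound determine |W u| a.e.
   for every u in H^p. *)
Definition extends_from_L2 (R : realType) (V W : operator R) : Prop :=
  forall u, in_Lp 2 u -> {ae leb2 R, forall x, W u x = V u x}.

(* Main.v *)
Require Import Defs.
From mathcomp Require Import all_boot all_order all_algebra.
From mathcomp Require Import all_classical all_reals all_analysis.
From mathcomp Require Import measurable_realfun ring lra zify.
Import Order.TTheory GRing.Theory Num.Theory.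
Import numFieldNormedType.Exports.
Set Implicit Arguments.
Unset Strict Implicit.
Unset Printing Implicit Defensive.
Local Open Scope classical_set_scope.
Local Open Scope ring_scope.

(** The proof has two halves: a bound on martingales with finitely many
    differences, uniform in their number, and a passage to the limit.

    Finite martingales ([finite_bound]). Let [S] be the square function of [u]
    and cut [u], apart from its mean value, into layers of height [t = t0 2^k]:
    a difference [mdiff u n] has constant absolute value on each dyadic
    rectangle [Q] of level [n - (1, 1)] ([mdiff_sqr_pred]), and on [Q] it is
    given to the layer for which [{S > t}] fills more than half of [Q] while
    [{S > 2 t}] does not ([in_layer]). A layer is a martingale transform of [u]
    by sets that are measurable at an earlier level, so the support condition
    confines [V] of the layer to the union of these [Q], whose measure is at
    most 16 times that of [{S > t}] by the weak type estimate for the strong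
    dyadic maximal function ([strong_hull_count]). Half of each [Q] lies where
    [S <= 2 t], so the layer has squared [L^2] norm at most a multiple of
    [t^2] times the measure of [{S > t}] ([energy_layer]). Together with the
    bound on [L^2] this gives that the integral of the [p]-th power of [V] of
    the layer is at most a multiple of [t^p] times the measure of [{S > t}]
    ([power_integral_layer]); subadditivity of [p]-th powers and summation of
    the geometric series in [k] ([layer_cake]) finish the estimate.

    Passage to the limit. For [u] in [L^2] or in a Hardy space the values of [V]
    at differences of far truncations of [u] tend to 0 in measure: by
    orthogonality in the first case ([energy_tail]), by the finite estimate and
    dominated convergence in the second ([hardy_tail]). Martingales with this
    property form a linear space. Along truncations that go to infinity fast
    enough, Borel-Cantelli makes [|V|] converge almost everywhere, to a limit
    that is the same for all faster sequences ([truncate_limit]). The extension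
    is [V] on [L^2], this limit on the rest of the linear space, and [+oo]
    elsewhere. Independence of the sequence gives sublinearity, since finitely
    many martingales can be followed along a common sequence, and Fatou's lemma
    transfers the finite estimate ([extension_power_integral]).

    Everything about finite martingales is computed on grids: a function that is
    constant on the cells of some level is integrated by averaging its values
    at the lower left corners of the cells ([integral_grid_fun]). *)

(** * Dyadic cells of the unit square *)

(** The index of the dyadic interval of length [2 ^- n] containing [t]. *)
Definition idx (R : realType) (n : nat) (t : R) : nat := Num.truncn (2 ^+ n * t).

Definition same_cell (R : realType) (n : nat * nat) (x y : plane R) : Prop :=
  idx n.1 x.1 = idx n.1 y.1 /\ idx n.2 x.2 = idx n.2 y.2.

Definition corner (R : realType) (n c : nat * nat) : plane R :=
  (c.1%:R / 2 ^+ n.1, c.2%:R / 2 ^+ n.2).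

Definition cell (R : realType) (n c : nat * nat) : set (plane R) :=
  Defs.dyadic_itv R n.1 c.1 `*` Defs.dyadic_itv R n.2 c.2.

Arguments cell : clear implicits.

Lemma unit_squareE (R : realType) (x : plane R) :
  unit_square R x <-> (0 <= x.1 < 1) /\ (0 <= x.2 < 1).
Proof. by rewrite /unit_square /= !in_itv. Qed.

Lemma idx_itv (R : realType) n (t : R) : 0 <= t ->
  (idx n t)%:R <= 2 ^+ n * t < (idx n t).+1%:R.
Proof. by move=> t0; apply: truncn_itv; rewrite mulr_ge0// exprn_ge0. Qed.

Lemma idx_lt (R : realType) n (t : R) : 0 <= t < 1 -> (idx n t < 2 ^ n)%N.
Proof.
move=> /andP[t0 t1]; rewrite /idx truncn_lt_nat ?mulr_ge0 ?exprn_ge0//.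
by rewrite natrX -[ltRHS]mulr1 ltr_pM2l ?exprn_gt0.
Qed.

Lemma dyadic_itvE (R : realType) n k (t : R) : 0 <= t ->
  Defs.dyadic_itv R n k t <-> idx n t = k.
Proof.
move=> t0; rewrite /Defs.dyadic_itv /= in_itv /=.
have p0 : 0 < 2 ^+ n :> R by rewrite exprn_gt0.
rewrite ler_pdivrMr// ltr_pdivlMr// -(mulrC (2 ^+ n)).
rewrite -truncn_eq ?mulr_ge0// ?ltW//.
by split=> [/eqP|/eqP].
Qed.

Lemma idx_half (R : realType) n (t : R) : 0 <= t -> idx n t = (idx n.+1 t)./2.
Proof.
move=> t0; have /andP[a b] := idx_itv n.+1 t0.
apply: truncn_def; move: a b; rewrite exprS -mulrA; set y := 2 ^+ n * t => a b.
have h := odd_double_half (idx n.+1 t).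
set j := (idx n.+1 t)./2 in h *; set i := idx n.+1 t in h a b *.
have hR : i%:R = (odd i)%:R + 2 * j%:R :> R.
  by rewrite -[in LHS]h natrD -muln2 natrM [j%:R * _]mulrC.
move: a b; rewrite -[i.+1%:R]natr1 hR -[j.+1%:R]natr1.
by case: (odd i) => /=; rewrite ?mulr1n ?mulr0n => a b; apply/andP; split; lra.
Qed.

Lemma idx_le (R : realType) m n (s t : R) : (m <= n)%N -> 0 <= s -> 0 <= t ->
  idx n s = idx n t -> idx m s = idx m t.
Proof.
move=> /subnK <- s0 t0; elim: (n - m)%N => // k IH /= e; apply: IH.
by rewrite addSn in e; rewrite !(@idx_half _ (k + m)%N)// e.
Qed.

Lemma idx_corner (R : realType) n k : idx n (k%:R / 2 ^+ n : R) = k.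
Proof. by rewrite /idx mulrC divfK ?natrK// expf_neq0. Qed.

Lemma idxM (R : realType) n d k (r : nat) : (r < 2 ^ d)%N ->
  idx n ((k * 2 ^ d + r)%:R / 2 ^+ (n + d) : R) = k.
Proof.
move=> rd; apply: truncn_def.
have p0 : 0 < 2 ^+ n :> R by rewrite exprn_gt0.
have q0 : 0 < 2 ^+ d :> R by rewrite exprn_gt0.
rewrite exprD invfM mulrCA mulVKf ?gt_eqF//.
rewrite ler_pdivlMr// ltr_pdivrMr// -natrX -!natrM ler_nat ltr_nat leq_addr.
by rewrite mulSn addnC ltn_add2r.
Qed.

Lemma unit_square_ge0 (R : realType) (x : plane R) : unit_square R x ->
  0 <= x.1 /\ 0 <= x.2.
Proof. by move=> /unit_squareE[/andP[-> _] /andP[-> _]]. Qed.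

Lemma unit_square_corner (R : realType) n c :
  (c.1 < 2 ^ n.1)%N -> (c.2 < 2 ^ n.2)%N -> unit_square R (corner R n c).
Proof.
move=> c1 c2; apply/unit_squareE; rewrite /corner /=.
by split; rewrite divr_ge0 ?exprn_ge0//= ltr_pdivrMr ?exprn_gt0// mul1r -natrX
  ltr_nat.
Qed.

Lemma cellE (R : realType) n c (x : plane R) : unit_square R x ->
  cell R n c x <-> (idx n.1 x.1, idx n.2 x.2) = c.
Proof.
move=> /unit_square_ge0[x1 x2]; rewrite /cell /=.
rewrite !(dyadic_itvE _ _ x1, dyadic_itvE _ _ x2).
by case: c => a b /=; split=> [[-> ->]|[-> ->]].
Qed.

Lemma cell_sub (R : realType) n c : (c.1 < 2 ^ n.1)%N -> (c.2 < 2 ^ n.2)%N ->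
  cell R n c `<=` unit_square R.
Proof.
move=> c1 c2 x; rewrite /cell /Defs.dyadic_itv /= !in_itv /= => -[/andP[a b] /andP[d e]].
apply/unit_squareE; split; apply/andP; split.
- by apply: le_trans a; rewrite divr_ge0// exprn_ge0.
- apply: lt_le_trans b _.
  by rewrite ler_pdivrMr ?exprn_gt0// mul1r -natrX ler_nat.
- by apply: le_trans d; rewrite divr_ge0// exprn_ge0.
- apply: lt_le_trans e _.
  by rewrite ler_pdivrMr ?exprn_gt0// mul1r -natrX ler_nat.
Qed.

Lemma measurable_cell (R : realType) n c :
  measurable (cell R n c : set (plane R)).
Proof. by apply: measurableX; exact: measurable_itv. Qed.

Lemma leb2_cell (R : realType) n c : (c.1 < 2 ^ n.1)%N -> (c.2 < 2 ^ n.2)%N ->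
  leb2 R (cell R n c) = (2 ^- (n.1 + n.2))%:E.
Proof.
move=> c1 c2.
transitivity ((@lebesgue_measure R \x @lebesgue_measure R)%E
  (cell R n c `&` unit_square R)); first by [].
rewrite setIidl; last exact: cell_sub.
have H (m k : nat) : lebesgue_measure (Defs.dyadic_itv R m k) = (2 ^- m)%:E.
  rewrite /Defs.dyadic_itv lebesgue_measure_itv /= lte_fin.
  rewrite ltr_pM2r ?invr_gt0 ?exprn_gt0// ltr_nat leqnn.
  by rewrite -EFinB -mulrBl -natr1 addrC addKr mul1r.
rewrite product_measure1E; [|exact: measurable_itv..].
by rewrite [LHS](congr2 _ (H _ _) (H _ _)) -EFinM exprD invfM.
Qed.

(** * Integrals of functions that are constant on cells *)

(** Vanishing outside the square makes such functions finite combinations of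
    indicators of cells on the whole plane, hence measurable there. *)
Definition grid_fun (R : realType) (n : nat * nat) (f : plane R -> R) : Prop :=
  (forall x, ~ unit_square R x -> f x = 0) /\
  (forall x y, unit_square R x -> unit_square R y -> same_cell n x y -> f x = f y).

(** The integral over the square of a function that is constant on the cells of
    level [n], as the average of its values at the corners of the cells. *)
Definition grid_mean (R : realType) (n : nat * nat) (f : plane R -> R) : R :=
  2 ^- (n.1 + n.2) *
  \sum_(i < 2 ^ n.1) \sum_(j < 2 ^ n.2) f (corner R n (val i, val j)).

Lemma same_cell_corner (R : realType) n (x : plane R) :
  same_cell n x (corner R n (idx n.1 x.1, idx n.2 x.2)).
Proof. by split; rewrite /= idx_corner. Qed.

Lemma idx_bounds (R : realType) n (x : plane R) : unit_square R x ->
  (idx n.1 x.1 < 2 ^ n.1)%N /\ (idx n.2 x.2 < 2 ^ n.2)%N.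
Proof. by move=> /unit_squareE[a b]; split; exact: idx_lt. Qed.

Lemma grid_fun_corner (R : realType) n (f : plane R -> R) x :
  grid_fun n f -> unit_square R x ->
  f x = f (corner R n (idx n.1 x.1, idx n.2 x.2)).
Proof.
move=> [_ fc] sx; have [a b] := idx_bounds n sx.
by apply: fc => //; [exact: unit_square_corner|exact: same_cell_corner].
Qed.

Lemma grid_fun_sumE (R : realType) n (f : plane R -> R) : grid_fun n f ->
  f = fun x => \sum_(c : 'I_(2 ^ n.1) * 'I_(2 ^ n.2))
        f (corner R n (val c.1, val c.2)) * \1_(cell R n (val c.1, val c.2)) x.
Proof.
move=> gf; apply/funext => x; have [sx|nsx] := pselect (unit_square R x).
- have [a b] := idx_bounds n sx.
  rewrite (bigD1 (Ordinal a, Ordinal b))//= big1 ?addr0.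
    rewrite indicE mem_set ?mulr1; first exact: grid_fun_corner.
    by apply/cellE.
  move=> c cn; rewrite indicE memNset ?mulr0// => /(cellE _ _ sx) e.
  by move/eqP: cn; apply; case: c e => i j [ei ej]; congr pair; apply: val_inj.
- rewrite gf.1// big1// => c _; rewrite indicE memNset ?mulr0// => h.
  by apply: nsx; apply: cell_sub h => /=.
Qed.

Lemma integral_grid_fun (R : realType) n (f : plane R -> R) : grid_fun n f ->
  (leb2 R).-integrable setT (EFin \o f) /\
  (\int[leb2 R]_x (f x)%:E = (grid_mean n f)%:E)%E.
Proof.
move=> gf.
have E x : (f x)%:E = (\sum_(c : 'I_(2 ^ n.1) * 'I_(2 ^ n.2))
    (f (corner R n (val c.1, val c.2)))%:E *
      (\1_(cell R n (val c.1, val c.2)) x)%:E)%E.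
  by rewrite [in LHS](grid_fun_sumE gf) -sumEFin.
have mc (c : 'I_(2 ^ n.1) * 'I_(2 ^ n.2)) :
  measurable (cell R n (val c.1, val c.2) : set (plane R)) by exact: measurable_cell.
have fin (c : 'I_(2 ^ n.1) * 'I_(2 ^ n.2)) :
    (leb2 R).-integrable setT
      (fun x => (\1_(cell R n (val c.1, val c.2)) x)%:E).
  apply/integrableP; split; first by apply/measurable_EFinP.
  under eq_integral do rewrite gee0_abs ?lee_fin//.
  by rewrite integral_indic// setIT leb2_cell//= ltry.
have I (c : 'I_(2 ^ n.1) * 'I_(2 ^ n.2)) : (leb2 R).-integrable setT (fun x =>
   (f (corner R n (val c.1, val c.2)))%:E *
      (\1_(cell R n (val c.1, val c.2)) x)%:E)%E by exact: integrableZl.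
split.
  rewrite (_ : EFin \o f = fun x => (\sum_(c : 'I_(2 ^ n.1) * 'I_(2 ^ n.2))
    (f (corner R n (val c.1, val c.2)))%:E *
      (\1_(cell R n (val c.1, val c.2)) x)%:E)%E).
    by apply: integrable_sum => // c _.
  by apply/funext => x; exact: E.
under eq_integral do rewrite E.
rewrite integral_sum//.
transitivity (\sum_(c : 'I_(2 ^ n.1) * 'I_(2 ^ n.2))
   (2 ^- (n.1 + n.2) * f (corner R n (val c.1, val c.2)))%:E)%E.
  apply: eq_bigr => c _; rewrite integralZl// integral_indic// setIT leb2_cell//=.
  by rewrite -EFinM mulrC.
rewrite sumEFin /grid_mean -mulr_sumr; congr (_ * _)%:E.
by rewrite pair_bigA.
Qed.

Lemma grid_fun_le (R : realType) m n (f : plane R -> R) : le2 m n ->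
  grid_fun m f -> grid_fun n f.
Proof.
move=> /andP[m1 m2] [f0 fc]; split=> // x y sx sy [e1 e2].
have [x1 x2] := unit_square_ge0 sx; have [y1 y2] := unit_square_ge0 sy.
by apply: fc => //; split; [exact: idx_le e1|exact: idx_le e2].
Qed.

(** Both means are the integral of [f]. *)
Lemma grid_mean_refine (R : realType) m n (f : plane R -> R) :
  grid_fun m f -> grid_fun n f -> grid_mean m f = grid_mean n f.
Proof.
move=> /integral_grid_fun[_ a] /integral_grid_fun[_ b].
by apply: EFin_inj; rewrite -a -b.
Qed.

Lemma grid_fun2 (R : realType) n (f g : plane R -> R) (h : R -> R -> R) :
  h 0 0 = 0 -> grid_fun n f -> grid_fun n g -> grid_fun n (fun x => h (f x) (g x)).
Proof.
move=> h0 [f0 fc] [g0 gc]; split=> [x nx|x y sx sy xy]; first by rewrite f0// g0.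
by rewrite (fc _ _ sx sy xy) (gc _ _ sx sy xy).
Qed.

Lemma grid_fun1 (R : realType) n (f : plane R -> R) (h : R -> R) :
  h 0 = 0 -> grid_fun n f -> grid_fun n (fun x => h (f x)).
Proof. by move=> h0 gf; exact: (@grid_fun2 _ _ f f (fun a _ => h a) h0 gf gf). Qed.

Lemma grid_fun_sum (R : realType) n (I : Type) (r : seq I) (P : pred I)
    (f : I -> plane R -> R) :
  (forall i, P i -> grid_fun n (f i)) ->
  grid_fun n (fun x => \sum_(i <- r | P i) f i x).
Proof.
move=> gf; split=> [x nx|x y sx sy xy].
  by rewrite big1// => i /gf[f0 _]; exact: f0.
by apply: eq_bigr => i /gf[_ fc]; exact: fc.
Qed.

(** Unions of cells form a sigma-algebra that contains the cells; conversely
    such a union is countable, so it lies in every such sigma-algebra. *)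
Lemma dyadic_sigmaE (R : realType) n (A : set (plane R)) :
  dyadic_sigma R n A <-> A `<=` unit_square R /\
  (forall x y, unit_square R x -> unit_square R y -> same_cell n x y -> A x -> A y).
Proof.
split.
  move=> /(_ [set B | B `<=` unit_square R /\ forall x y, unit_square R x ->
    unit_square R y -> same_cell n x y -> B x -> B y]); apply; split; last first.
    move=> _ [[i j] /= [i1 j1 ->]]; split.
      by apply: (@cell_sub R n (i, j)).
    move=> x y sx sy [e1 e2] /(@cellE R n (i, j) x sx) h.
    by apply/(@cellE R n (i, j) y sy); rewrite -h e1 e2.
  split.
  - by split.
  - move=> B [BS Bc]; split; first by move=> x [].
    move=> x y sx sy [e1 e2] [_ nB]; split=> // By; apply: nB.
    by apply: Bc By => //; split.
  - move=> F HF; split; first by move=> x [i _ /(HF i).1].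
    by move=> x y sx sy xy [i _ Fx]; exists i => //; exact: (HF i).2 _ _ sx sy xy Fx.
move=> [AS Ac] B [SB GB].
(* [k] enumerates the pairs of indices; cells that are not in [A] are skipped. *)
pose F (k : nat) : set (plane R) :=
  let c := (k %/ 2 ^ n.2, k %% 2 ^ n.2)%N in
  if `[< (c.1 < 2 ^ n.1)%N /\ A (corner R n c) >] then cell R n c else set0.
have -> : A = \bigcup_k F k.
  apply/seteqP; split=> [x Ax|x [k _]].
    have sx := AS _ Ax; have [a b] := idx_bounds n sx.
    exists (idx n.1 x.1 * 2 ^ n.2 + idx n.2 x.2)%N => //; rewrite /F.
    rewrite divnMDl ?expn_gt0// divn_small// addn0 modnMDl modn_small//.
    rewrite asboolT; first by apply/cellE.
    split=> //; apply: Ac Ax => //; first exact: unit_square_corner.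
    exact: same_cell_corner.
  rewrite /F; case: asboolP => // -[k1 Ak] xk.
  have k2 : (k %% 2 ^ n.2 < 2 ^ n.2)%N by rewrite ltn_mod expn_gt0.
  have sx : unit_square R x by exact: cell_sub xk.
  apply: Ac Ak => //; first exact: unit_square_corner.
  move: xk => /(cellE _ _ sx) e.
  have [E1 E2] : idx n.1 x.1 = (k %/ 2 ^ n.2)%N /\ idx n.2 x.2 = (k %% 2 ^ n.2)%N.
    by case: e.
  by split; rewrite /= idx_corner ?E1 ?E2.
have [B0 _ BU] := SB; apply: BU => k; rewrite /F; case: asboolP => [[k1 _]|_].
  apply: GB; exists (k %/ 2 ^ n.2, k %% 2 ^ n.2)%N; split=> //=.
  by rewrite ltn_mod expn_gt0.
exact: B0.
Qed.

Lemma dyadic_measurableE (R : realType) n (f : plane R -> R) :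
  dyadic_measurable n f <->
  (forall x y, unit_square R x -> unit_square R y -> same_cell n x y -> f x = f y).
Proof.
split=> [mf x y sx sy xy|fc Y mY].
  have /dyadic_sigmaE[_ h] := mf [set f x] (measurable_set1 _).
  by have [_ ->] := h _ _ sx sy xy (conj sx erefl).
apply/dyadic_sigmaE; split; first by move=> x [].
by move=> x y sx sy xy [_ Yx]; split=> //=; rewrite -(fc _ _ sx sy xy).
Qed.

(** * Martingales as families averaging over the two halves of a cell *)

(** Points in the two halves of a dyadic interval of generation [k] of the first
    axis. Comparing values at siblings expresses the martingale property without
    integrals and without shifting indices of cells between levels. *)
Definition sibling1 (R : realType) (k : nat) (x y : plane R) : Prop :=
  [/\ unit_square R x, unit_square R y, x.2 = y.2, idx k x.1 = idx k y.1 &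
      idx k.+1 x.1 <> idx k.+1 y.1].

Definition swap_pt (R : realType) (x : plane R) : plane R := (x.2, x.1).

(** Defined by exchanging the axes, so that facts about one variable carry over
    to the other. *)
Definition sibling2 (R : realType) (k : nat) (x y : plane R) : Prop :=
  sibling1 k (swap_pt x) (swap_pt y).

Lemma sum_double (V : nmodType) m (h : nat -> V) :
  \sum_(i < m.*2) h i = \sum_(i < m) (h i.*2 + h i.*2.+1).
Proof.
elim: m => [|m IH]; first by rewrite !big_ord0.
by rewrite doubleS !big_ord_recr /= IH addrA.
Qed.

Lemma expn2S k : (2 ^ k.+1 = (2 ^ k).*2)%N.
Proof. by rewrite expnS mul2n. Qed.

Lemma grid_mean_pair1 (R : realType) k l (g : plane R -> R) :
  grid_mean (k.+1, l) g = 2 ^- (k.+1 + l) *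
    \sum_(i < 2 ^ k) \sum_(j < 2 ^ l)
      (g (corner R (k.+1, l) (i.*2, val j)) + g (corner R (k.+1, l) (i.*2.+1, val j))).
Proof.
rewrite /grid_mean /=; congr (_ * _); rewrite expn2S.
rewrite (sum_double _ (fun i => \sum_(j < 2 ^ l) g (corner R (k.+1, l) (i, val j)))).
by apply: eq_bigr => i _; rewrite -big_split.
Qed.

Lemma half_idx (R : realType) k i : idx k (i%:R / 2 ^+ k.+1 : R) = i./2.
Proof. by rewrite idx_half ?idx_corner// divr_ge0// exprn_ge0. Qed.

Lemma sibling1_corner (R : realType) k l (i j : nat) :
  (i < 2 ^ k)%N -> (j < 2 ^ l)%N ->
  sibling1 k (corner R (k.+1, l) (i.*2, j)) (corner R (k.+1, l) (i.*2.+1, j)).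
Proof.
move=> ik jl; split.
- by apply: unit_square_corner => //=; rewrite expn2S ltn_double.
- by apply: unit_square_corner => //=; rewrite expn2S ltn_Sdouble.
- by [].
- by rewrite /= !half_idx doubleK /= uphalf_double.
- by rewrite /= !idx_corner => /eqP; rewrite -[X in X == _]addn0 -addn1 eqn_add2l.
Qed.

Lemma grid_mean0_sibling1 (R : realType) k l (g : plane R -> R) :
  (forall x y, sibling1 k x y -> g x + g y = 0) -> grid_mean (k.+1, l) g = 0.
Proof.
move=> h; rewrite grid_mean_pair1 big1 ?mulr0// => i _; rewrite big1// => j _.
by apply: h; exact: (sibling1_corner R (ltn_ord i) (ltn_ord j)).
Qed.

Lemma grid_fun_indic (R : realType) n A (f : plane R -> R) :
  dyadic_sigma R n A -> grid_fun n f -> grid_fun n (fun x => f x * \1_A x).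
Proof.
move=> /dyadic_sigmaE[AS Ac] [f0 fc]; split=> [x nx|x y sx sy xy].
  by rewrite f0// mul0r.
rewrite (fc _ _ sx sy xy); congr (_ * _); rewrite !indicE; congr ((nat_of_bool _)%:R).
apply/idP/idP; rewrite !inE; apply: Ac => //.
by case: xy => a b; split.
Qed.

Lemma integral_grid_fun_in (R : realType) n A (f : plane R -> R) :
  dyadic_sigma R n A -> grid_fun n f ->
  (\int[leb2 R]_(x in A) (f x)%:E = (grid_mean n (fun x => f x * \1_A x)%R)%:E)%E.
Proof.
move=> sA gf; have [_ <-] := integral_grid_fun (grid_fun_indic sA gf).
rewrite integral_mkcond; apply: eq_integral => x _.
by rewrite patchE indicE; case: ifP; rewrite ?mulr1 ?mulr0.
Qed.

Lemma dyadic_sigma_le (R : realType) m n (A : set (plane R)) : le2 m n ->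
  dyadic_sigma R m A -> dyadic_sigma R n A.
Proof.
move=> /andP[m1 m2] /dyadic_sigmaE[AS Ac]; apply/dyadic_sigmaE; split=> //.
move=> x y sx sy [e1 e2].
have [x1 x2] := unit_square_ge0 sx; have [y1 y2] := unit_square_ge0 sy.
by apply: Ac => //; split; [exact: idx_le e1|exact: idx_le e2].
Qed.

Lemma grid_meanB (R : realType) n (f g : plane R -> R) :
  grid_mean n (fun x => f x - g x) = grid_mean n f - grid_mean n g.
Proof.
rewrite /grid_mean -mulrBr; congr (_ * _).
by rewrite -sumrB; apply: eq_bigr => i _; rewrite -sumrB.
Qed.

(** The integral of [f] over a cell of level [(k, l)] is the average of the two
    values of [f] on the halves of the cell, and cells suffice to test the
    identity that defines the conditional expectation. *)
Lemma condexp_sibling1 (R : realType) k l (f g : plane R -> R) :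
  grid_fun (k.+1, l) f -> grid_fun (k, l) g ->
  (forall A, dyadic_sigma R (k, l) A ->
    (\int[leb2 R]_(x in A) (g x)%:E = \int[leb2 R]_(x in A) (f x)%:E)%E) <->
  (forall x y, sibling1 k x y -> f x + f y = 2 * g x).
Proof.
move=> gf gg.
have kl : le2 (k, l) (k.+1, l) by rewrite /le2 /= leqnSn leqnn.
have gg' := grid_fun_le kl gg.
have sig A : dyadic_sigma R (k, l) A -> dyadic_sigma R (k.+1, l) A.
  exact: dyadic_sigma_le.
have key A : dyadic_sigma R (k, l) A ->
    (\int[leb2 R]_(x in A) (g x)%:E = \int[leb2 R]_(x in A) (f x)%:E)%E <->
    grid_mean (k.+1, l) (fun x => f x * \1_A x - g x * \1_A x) = 0.
  move=> sA; rewrite !(integral_grid_fun_in (sig _ sA))//.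
  rewrite grid_meanB; split=> [[->]|/eqP]; first by rewrite subrr.
  by rewrite subr_eq0 => /eqP ->.
split=> [H x y xy|H A sA].
  have [sx sy exy i1 i2] := xy.
  have [a b] := idx_bounds (k, l) sx; rewrite /= in a b.
  pose c := (idx k x.1, idx l x.2).
  have sA : dyadic_sigma R (k, l) (cell R (k, l) c).
    apply/dyadic_sigmaE; split; first exact: cell_sub.
    move=> z w sz sw [e1 e2] /(cellE _ _ sz) h; apply/cellE => //.
    by rewrite -h -e1 -e2.
  move/(_ _ sA)/(key _ sA): H; rewrite grid_mean_pair1.
  move/eqP; rewrite mulf_eq0 invr_eq0 expf_eq0 pnatr_eq0 andbF /=.
  pose F z := f z * \1_(cell R (k, l) c) z - g z * \1_(cell R (k, l) c) z.
  rewrite -/(F _) (bigD1 (Ordinal a))//= (bigD1 (Ordinal b))//=.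
  rewrite big1 ?addr0; last first.
    move=> j jb; have sj := sibling1_corner R a (ltn_ord j).
    case: sj => s1 s2 _ _ _.
    suff Z z : unit_square R z -> idx l z.2 = j -> F z = 0.
      by rewrite -!/(F _) !Z ?addr0//= idx_corner.
    move=> sz zj; rewrite /F indicE memNset ?mulr0 ?subrr// => /(cellE _ _ sz).
    rewrite /c /= zj => -[_ jb2]; move/eqP: jb; apply; exact: val_inj.
  rewrite big1 ?addr0; last first.
    move=> i ib; rewrite big1// => j _.
    have sj := sibling1_corner R (ltn_ord i) (ltn_ord j).
    case: sj => s1 s2 _ _ _.
    suff Z z : unit_square R z -> idx k z.1 = i -> F z = 0.
      by rewrite -!/(F _) !Z ?addr0//= half_idx ?doubleK//= uphalf_double.
    move=> sz zj; rewrite /F indicE memNset ?mulr0 ?subrr// => /(cellE _ _ sz).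
    rewrite /c /= zj => -[jb2 _]; move/eqP: ib; apply; exact: val_inj.
  rewrite -!/(F _).
  have [s1 s2 _ _ _] := sibling1_corner R a b.
  have Fz z : unit_square R z -> same_cell (k, l) z x -> F z = f z - g x.
    move=> sz zx; rewrite /F indicE mem_set ?mulr1.
      by congr (_ - _); apply: gg.2.
    by apply/(cellE _ _ sz); case: zx => /= -> ->.
  have half0 (b0 : bool) : (b0 + (idx k x.1).*2)./2 = idx k x.1.
    by rewrite half_bit_double.
  rewrite !Fz//; try by split; rewrite /= ?idx_corner// half_idx
     ?(half0 true) ?(half0 false).
  have yl : idx l y.2 = idx l x.2 by rewrite exy.
  have [x0 _] := unit_square_ge0 sx; have [y0 _] := unit_square_ge0 sy.
  have hx := odd_double_half (idx k.+1 x.1); have hy := odd_double_half (idx k.+1 y.1).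
  rewrite -!idx_half// -i1 in hx hy.
  have E z (i : nat) : unit_square R z -> idx k.+1 z.1 = i -> idx l z.2 = idx l x.2 ->
      f (corner R (k.+1, l) (i, idx l x.2)) = f z.
    by move=> sz <- <-; rewrite (grid_fun_corner gf sz).
  move=> /eqP s0.
  suff -> : f x + f y = f (corner R (k.+1, l) ((idx k x.1).*2, idx l x.2)) +
     f (corner R (k.+1, l) ((idx k x.1).*2.+1, idx l x.2)) by move: s0; lra.
  move: hx hy i2; case: (odd (idx k.+1 x.1)); case: (odd (idx k.+1 y.1)) => /=;
    rewrite ?add0n ?add1n => hx hy i2.
  - by case: i2; rewrite -hx -hy.
  - by rewrite addrC (E x _ sx (esym hx) erefl) (E y _ sy (esym hy) yl).
  - by rewrite (E x _ sx (esym hx) erefl) (E y _ sy (esym hy) yl).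
  - by case: i2; rewrite -hx -hy.
apply/(key _ sA); apply: grid_mean0_sibling1 => x y xy.
have := H _ _ xy; have [sx sy e1 e2 _] := xy.
have sc : same_cell (k, l) x y by split=> //=; rewrite e1.
have [_ h] := grid_fun_indic sA gg.
have eA : \1_A x = \1_A y :> R.
  have /dyadic_sigmaE[_ Ac] := sA.
  rewrite !indicE; congr ((nat_of_bool _)%:R); apply/idP/idP; rewrite !inE; apply: Ac => //.
  by case: sc => a b; split.
rewrite -eA -(gg.2 _ _ sx sy sc) => s; transitivity ((f x + f y - 2 * g x) * \1_A x).
  by ring.
by rewrite s subrr mul0r.
Qed.

Lemma unit_square_swap (R : realType) (x : plane R) :
  unit_square R (swap_pt x) <-> unit_square R x.
Proof. by split=> -[a b]; split. Qed.

Lemma grid_fun_swap (R : realType) k l (f : plane R -> R) :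
  grid_fun (k, l) f -> grid_fun (l, k) (f \o @swap_pt R).
Proof.
move=> [f0 fc]; split=> [x nx|x y sx sy [e1 e2]].
  by apply: f0 => /unit_square_swap.
by apply: fc; [exact/unit_square_swap..|split].
Qed.

Lemma dyadic_sigma_swap (R : realType) k l (A : set (plane R)) :
  dyadic_sigma R (k, l) A -> dyadic_sigma R (l, k) (@swap_pt R @^-1` A).
Proof.
move=> /dyadic_sigmaE[AS Ac]; apply/dyadic_sigmaE; split.
  by move=> x /AS /unit_square_swap.
move=> x y sx sy [e1 e2]; apply: Ac; [exact/unit_square_swap..|].
by split.
Qed.

Lemma swap_ptK (R : realType) : involutive (@swap_pt R).
Proof. by case. Qed.

Lemma grid_mean_swap (R : realType) k l (f : plane R -> R) :
  grid_mean (l, k) (f \o @swap_pt R) = grid_mean (k, l) f.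
Proof. by rewrite /grid_mean /= addnC exchange_big. Qed.

Lemma grid_mean0_sibling2 (R : realType) k l (g : plane R -> R) :
  (forall x y, sibling2 l x y -> g x + g y = 0) -> grid_mean (k, l.+1) g = 0.
Proof.
move=> h; rewrite -grid_mean_swap; apply: grid_mean0_sibling1 => x y xy.
by apply: h; rewrite /sibling2 !swap_ptK.
Qed.

Lemma integral_swap (R : realType) k l (A : set (plane R)) (f : plane R -> R) :
  dyadic_sigma R (k, l) A -> grid_fun (k, l) f ->
  (\int[leb2 R]_(x in A) (f x)%:E =
   \int[leb2 R]_(x in @swap_pt R @^-1` A) (f (swap_pt x))%:E)%E.
Proof.
move=> sA gf; rewrite (integral_grid_fun_in sA gf).
rewrite (integral_grid_fun_in (dyadic_sigma_swap sA) (grid_fun_swap gf)).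
by rewrite -grid_mean_swap.
Qed.

Lemma condexp_sibling2 (R : realType) k l (f g : plane R -> R) :
  grid_fun (k, l.+1) f -> grid_fun (k, l) g ->
  (forall A, dyadic_sigma R (k, l) A ->
    (\int[leb2 R]_(x in A) (g x)%:E = \int[leb2 R]_(x in A) (f x)%:E)%E) <->
  (forall x y, sibling2 l x y -> f x + f y = 2 * g x).
Proof.
move=> gf gg; have := condexp_sibling1 (grid_fun_swap gf) (grid_fun_swap gg).
have kl : le2 (k, l) (k, l.+1) by rewrite /le2 /= leqnSn leqnn.
have sig A : dyadic_sigma R (k, l) A -> dyadic_sigma R (k, l.+1) A.
  exact: dyadic_sigma_le.
move=> [H1 H2]; split=> [H x y xy|H A sA].
  rewrite -[x]swap_ptK -[y]swap_ptK; apply: H1 => // A sA.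
  have sA' := dyadic_sigma_swap sA.
  have := H _ sA'; rewrite (integral_swap sA' gg) (integral_swap (sig _ sA') gf).
  by rewrite (_ : @swap_pt R @^-1` (@swap_pt R @^-1` A) = A)//;
    apply/funext => z; rewrite /preimage /= swap_ptK.
rewrite (integral_swap sA gg) (integral_swap (sig _ sA) gf).
apply: H2 (dyadic_sigma_swap sA) => x y xy.
by apply: H; rewrite /sibling2 !swap_ptK.
Qed.

Definition averages1 (R : realType) (u : Defs.family R) : Prop :=
  forall k l x y, sibling1 k x y ->
    u (k.+1, l) x + u (k.+1, l) y = 2 * u (k, l) x.

Definition averages2 (R : realType) (u : Defs.family R) : Prop :=
  forall k l x y, sibling2 l x y ->
    u (k, l.+1) x + u (k, l.+1) y = 2 * u (k, l) x.

(** A conditional expectation from level [m] to level [n] is a chain of steps that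
    merge the halves of a cell, first in one variable and then in the other. *)
Lemma martingaleP (R : realType) (u : Defs.family R) :
  is_martingale u <-> [/\ forall n, grid_fun n (u n), averages1 u & averages2 u].
Proof.
split=> [[u0 ui um uc]|[gu a1 a2]].
  have gu n : grid_fun n (u n).
    by split=> [|]; [exact: u0|exact/dyadic_measurableE].
  split=> // [k l|k l].
    apply/(condexp_sibling1 (gu (k.+1, l)) (gu (k, l))) => A.
    by have [|_ _] := uc (k, l) (k.+1, l); [rewrite /le2 /= leqnSn leqnn|apply].
  apply/(condexp_sibling2 (gu (k, l.+1)) (gu (k, l))) => A.
  by have [|_ _] := uc (k, l) (k, l.+1); [rewrite /le2 /= leqnSn leqnn|apply].
have mu n : dyadic_measurable n (u n) by apply/dyadic_measurableE; exact: (gu n).2.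
have iu n : (leb2 R).-integrable setT (EFin \o u n).
  by have [] := integral_grid_fun (gu n).
split=> [n|//|//|[k l] [k' l']]; first exact: (gu n).1.
move=> /andP[/= kk ll]; split=> // A sA.
have E1 k0 l0 B : dyadic_sigma R (k0, l0) B ->
  (\int[leb2 R]_(x in B) (u (k0, l0) x)%:E =
   \int[leb2 R]_(x in B) (u (k0.+1, l0) x)%:E)%E.
  by move: B; apply/(condexp_sibling1 (gu (k0.+1, l0)) (gu (k0, l0))); exact: a1.
have E2 k0 l0 B : dyadic_sigma R (k0, l0) B ->
  (\int[leb2 R]_(x in B) (u (k0, l0) x)%:E =
   \int[leb2 R]_(x in B) (u (k0, l0.+1) x)%:E)%E.
  by move: B; apply/(condexp_sibling2 (gu (k0, l0.+1)) (gu (k0, l0))); exact: a2.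
transitivity (\int[leb2 R]_(x in A) (u (k', l) x)%:E)%E.
  rewrite -(subnK kk); elim: (k' - k)%N => // i IH; rewrite IH addSn E1//.
  by apply: dyadic_sigma_le sA; rewrite /le2 /= leq_addl leqnn.
rewrite -(subnK ll); elim: (l' - l)%N => // i IH; rewrite IH addSn E2//.
by apply: dyadic_sigma_le sA; rewrite /le2 /= leq_addl kk.
Qed.

(** * Martingale differences, transforms and energies *)

(** The inverse of [mdiff]. *)
Definition partial_sums (R : realType) (c : Defs.family R) : Defs.family R :=
  fun n x => \sum_(i < n.1.+1) \sum_(j < n.2.+1) c (val i, val j) x.

Definition diff1 (R : realType) (u : Defs.family R) : Defs.family R :=
  fun n x => u n x - lag (fun i => u (i, n.2) x) n.1.

(** The level at which [mdiff u n] is predictable up to sign. *)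
Definition predn2 (n : nat * nat) : nat * nat := (n.1.-1, n.2.-1).

Lemma mdiffE (R : realType) (u : Defs.family R) n x :
  mdiff u n x = diff1 u n x - lag (fun j => diff1 u (n.1, j) x) n.2.
Proof. by case: n => -[|k] [|l]; rewrite /mdiff /diff1 /=; ring. Qed.

Lemma sum_sub_lag (R : realType) (a : nat -> R) k :
  \sum_(i < k.+1) (a i - lag a i) = a k.
Proof.
elim: k => [|k IH]; first by rewrite big_ord_recr big_ord0 /= subr0 add0r.
by rewrite big_ord_recr /= IH addrC subrK.
Qed.

Lemma partial_sums_mdiff (R : realType) (u : Defs.family R) n x :
  partial_sums (mdiff u) n x = u n x.
Proof.
case: n => k l; rewrite /partial_sums /= -[RHS](sum_sub_lag (fun i => u (i, l) x)).
apply: eq_bigr => i _; under eq_bigr do rewrite mdiffE.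
by rewrite (sum_sub_lag (fun j => diff1 u (val i, j) x)).
Qed.

Lemma mdiff_partial_sums (R : realType) (c : Defs.family R) n x :
  mdiff (partial_sums c) n x = c n x.
Proof.
have D k l : diff1 (partial_sums c) (k, l) x = \sum_(j < l.+1) c (k, val j) x.
  rewrite /diff1 /partial_sums /= big_ord_recr /=.
  case: k => [|k] /=; first by rewrite big_ord0 add0r subr0.
  by rewrite addrAC subrr add0r.
case: n => k l; rewrite mdiffE /= !D; case: l => [|l] /=.
  by rewrite big_ord_recr big_ord0 /= add0r subr0.
by rewrite D big_ord_recr /= addrAC subrr add0r.
Qed.

Lemma mdiff_add (R : realType) (u v : Defs.family R) n x :
  mdiff (fam_add u v) n x = mdiff u n x + mdiff v n x.
Proof. by case: n => -[|k] [|l]; rewrite /mdiff /fam_add /=; ring. Qed.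

Lemma mdiff_scale (R : realType) c (u : Defs.family R) n x :
  mdiff (fam_scale c u) n x = c * mdiff u n x.
Proof. by case: n => -[|k] [|l]; rewrite /mdiff /fam_scale /=; ring. Qed.

Lemma is_martingale_add (R : realType) (u v : Defs.family R) :
  is_martingale u -> is_martingale v -> is_martingale (fam_add u v).
Proof.
move=> /martingaleP[gu a1 a2] /martingaleP[gv b1 b2]; apply/martingaleP; split.
- by move=> n; apply: (grid_fun2 (h := +%R)); rewrite ?addr0.
- by move=> k l x y xy; rewrite /fam_add mulrDr -(a1 _ _ _ _ xy) -(b1 _ _ _ _ xy) addrACA.
- by move=> k l x y xy; rewrite /fam_add mulrDr -(a2 _ _ _ _ xy) -(b2 _ _ _ _ xy) addrACA.
Qed.

Lemma is_martingale_scale (R : realType) c (u : Defs.family R) :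
  is_martingale u -> is_martingale (fam_scale c u).
Proof.
move=> /martingaleP[gu a1 a2]; apply/martingaleP; split.
- by move=> n; apply: (grid_fun1 (h := *%R c)); rewrite ?mulr0.
- by move=> k l x y xy; rewrite /fam_scale mulrCA -(a1 _ _ _ _ xy) mulrDr.
- by move=> k l x y xy; rewrite /fam_scale mulrCA -(a2 _ _ _ _ xy) mulrDr.
Qed.

Lemma sibling1_same (R : realType) k l (x y : plane R) :
  sibling1 k x y -> same_cell (k, l) x y.
Proof. by move=> [_ _ e1 e2 _]; split=> //=; rewrite e1. Qed.

Lemma sibling2_same (R : realType) k l (x y : plane R) :
  sibling2 l x y -> same_cell (k, l) x y.
Proof. by move=> [_ _ /= e1 e2 _]; split=> //=; rewrite e1. Qed.

Lemma sibling1_sq (R : realType) k (x y : plane R) :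
  sibling1 k x y -> unit_square R x /\ unit_square R y.
Proof. by case. Qed.

Lemma sibling2_sq (R : realType) k (x y : plane R) :
  sibling2 k x y -> unit_square R x /\ unit_square R y.
Proof. by case=> /unit_square_swap a /unit_square_swap. Qed.

Lemma grid_fun_sibling1 (R : realType) k l (f : plane R -> R) x y :
  grid_fun (k, l) f -> sibling1 k x y -> f y = f x.
Proof.
move=> [_ fc] xy; have [sx sy] := sibling1_sq xy.
by rewrite (fc _ _ sx sy)//; exact: sibling1_same.
Qed.

Lemma grid_fun_sibling2 (R : realType) k l (f : plane R -> R) x y :
  grid_fun (k, l) f -> sibling2 l x y -> f y = f x.
Proof.
move=> [_ fc] xy; have [sx sy] := sibling2_sq xy.
by rewrite (fc _ _ sx sy)//; exact: sibling2_same.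
Qed.

Lemma grid_fun0 (R : realType) n : grid_fun n (fun _ : plane R => 0).
Proof. by []. Qed.

Lemma grid_fun_lag1 (R : realType) (u : Defs.family R) n :
  (forall n, grid_fun n (u n)) -> grid_fun n (fun x => lag (fun i => u (i, n.2) x) n.1).
Proof.
case: n => -[|k] l gu /=; first exact: grid_fun0.
by apply: grid_fun_le (gu (k, l)); rewrite /le2 /= leqnSn leqnn.
Qed.

Lemma grid_fun_lag2 (R : realType) (u : Defs.family R) n :
  (forall n, grid_fun n (u n)) -> grid_fun n (fun x => lag (fun j => u (n.1, j) x) n.2).
Proof.
case: n => k [|l] gu /=; first exact: grid_fun0.
by apply: grid_fun_le (gu (k, l)); rewrite /le2 /= leqnSn leqnn.
Qed.

Lemma grid_fun_diff1 (R : realType) (u : Defs.family R) :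
  (forall n, grid_fun n (u n)) -> forall n, grid_fun n (diff1 u n).
Proof.
move=> gu n; apply: (grid_fun2 (h := fun a b => a - b)); rewrite ?subr0//.
exact: grid_fun_lag1.
Qed.

Lemma grid_fun_mdiff (R : realType) (u : Defs.family R) :
  (forall n, grid_fun n (u n)) -> forall n, grid_fun n (mdiff u n).
Proof.
move=> gu n.
rewrite (_ : mdiff u n = fun x => diff1 u n x - lag (fun j => diff1 u (n.1, j) x) n.2).
  apply: (grid_fun2 (h := fun a b => a - b)); rewrite ?subr0//.
    exact: grid_fun_diff1.
  exact: (grid_fun_lag2 _ (grid_fun_diff1 gu)).
by apply/funext => x; exact: mdiffE.
Qed.

Lemma diff1_sibling1 (R : realType) (u : Defs.family R) k l x y :
  is_martingale u -> sibling1 k x y ->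
  diff1 u (k.+1, l) x + diff1 u (k.+1, l) y = 0.
Proof.
move=> /martingaleP[gu a1 a2] xy; rewrite /diff1 /=.
rewrite (grid_fun_sibling1 (gu (k, l)) xy).
transitivity (u (k.+1, l) x + u (k.+1, l) y - 2 * u (k, l) x); first by ring.
by rewrite a1// subrr.
Qed.

Lemma mdiff_sibling1 (R : realType) (u : Defs.family R) k l x y :
  is_martingale u -> sibling1 k x y ->
  mdiff u (k.+1, l) x + mdiff u (k.+1, l) y = 0.
Proof.
move=> mu xy; rewrite !mdiffE /=.
have D l' := @diff1_sibling1 _ u k l' x y mu xy.
case: l => [|l] /=; first by rewrite !subr0.
transitivity (diff1 u (k.+1, l.+1) x + diff1 u (k.+1, l.+1) y -
   (diff1 u (k.+1, l) x + diff1 u (k.+1, l) y)); first by ring.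
by rewrite !D subrr.
Qed.

Lemma diff1_averages2 (R : realType) (u : Defs.family R) :
  is_martingale u -> averages2 (diff1 u).
Proof.
move=> /martingaleP[gu a1 a2] k l x y xy; rewrite /diff1 /=.
case: k => [|k] /=; first by rewrite !subr0 a2.
transitivity (u (k.+1, l.+1) x + u (k.+1, l.+1) y -
   (u (k, l.+1) x + u (k, l.+1) y)); first by ring.
by rewrite !a2// mulrBr.
Qed.

Lemma mdiff_sibling2 (R : realType) (u : Defs.family R) k l x y :
  is_martingale u -> sibling2 l x y ->
  mdiff u (k, l.+1) x + mdiff u (k, l.+1) y = 0.
Proof.
move=> mu xy; rewrite !mdiffE /=.
have [gu _ _] := (martingaleP u).1 mu.
rewrite (grid_fun_sibling2 (grid_fun_diff1 gu (k, l)) xy).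
transitivity (diff1 u (k, l.+1) x + diff1 u (k, l.+1) y - 2 * diff1 u (k, l) x).
  by ring.
by rewrite diff1_averages2// subrr.
Qed.

(** The difference changes sign between siblings of either axis, and a cell of
    level [n - (1, 1)] is cut at most once along each axis on the way to level
    [n]. *)
Lemma mdiff_sqr_pred (R : realType) (u : Defs.family R) n x y :
  is_martingale u -> unit_square R x -> unit_square R y ->
  same_cell (predn2 n) x y -> mdiff u n x ^+ 2 = mdiff u n y ^+ 2.
Proof.
move=> mu sx sy [e1 e2].
have [gu _ _] := (martingaleP u).1 mu; have gd := grid_fun_mdiff gu n.
(* From [x] to [y] along one axis at a time. *)
pose z : plane R := (y.1, x.2).
have sz : unit_square R z by case: sx; case: sy => ? ? ? ?; split.
transitivity (mdiff u n z ^+ 2).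
  have [i|/eqP i] := eqVneq (idx n.1 x.1) (idx n.1 y.1).
    by congr (_ ^+ 2); apply: gd.2 => //; split.
  case: n e1 e2 i gd => -[//|k] l /= e1 e2 i gd.
  have : mdiff u (k.+1, l) x + mdiff u (k.+1, l) z = 0 by apply: mdiff_sibling1.
  by move/eqP; rewrite addr_eq0 => /eqP ->; rewrite sqrrN.
have [i|/eqP i] := eqVneq (idx n.2 x.2) (idx n.2 y.2).
  by congr (_ ^+ 2); apply: gd.2 => //; split.
case: n e1 e2 i gd => k [//|l] /= e1 e2 i gd.
have : mdiff u (k, l.+1) z + mdiff u (k, l.+1) y = 0.
  by apply: mdiff_sibling2 => //; split=> //=; exact/unit_square_swap.
by move/eqP; rewrite addr_eq0 => /eqP ->; rewrite sqrrN.
Qed.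

Lemma partial_sums_succ1 (R : realType) (c : Defs.family R) k l x :
  partial_sums c (k.+1, l) x =
  partial_sums c (k, l) x + \sum_(j < l.+1) c (k.+1, val j) x.
Proof. by rewrite /partial_sums big_ord_recr. Qed.

Lemma partial_sums_succ2 (R : realType) (c : Defs.family R) k l x :
  partial_sums c (k, l.+1) x =
  partial_sums c (k, l) x + \sum_(i < k.+1) c (val i, l.+1) x.
Proof.
by rewrite /partial_sums -big_split; apply: eq_bigr => i _; rewrite big_ord_recr.
Qed.

(** Siblings of the level at which [w n] is constant get the same factor, so the
    products still cancel over siblings. *)
Lemma is_martingale_transform (R : realType) (u : Defs.family R)
    (w : nat * nat -> plane R -> R) :
  is_martingale u ->
  (forall n x y, unit_square R x -> unit_square R y ->
     same_cell (predn2 n) x y -> w n x = w n y) ->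
  is_martingale (partial_sums (fun n x => w n x * mdiff u n x)).
Proof.
move=> mu wp; have [gu a1 a2] := (martingaleP u).1 mu.
set c := fun n x => _.
have gc n : grid_fun n (c n).
  have gd := grid_fun_mdiff gu n; split=> [x nx|x y sx sy xy].
    by rewrite /c gd.1// mulr0.
  rewrite /c (gd.2 _ _ sx sy xy); congr (_ * _); apply: wp => //.
  have [x1 x2] := unit_square_ge0 sx; have [y1 y2] := unit_square_ge0 sy.
  case: xy => e1 e2; split; [apply: idx_le e1|apply: idx_le e2] => //;
    exact: leq_pred.
have gv n : grid_fun n (partial_sums c n).
  apply: (@grid_fun_sum _ n _ _ _
    (fun (i : 'I_n.1.+1) x => \sum_(j < n.2.+1) c (val i, val j) x)) => i _.
  apply: (@grid_fun_sum _ n _ _ _ (fun (j : 'I_n.2.+1) x => c (val i, val j) x)) => j _.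
  have ij : le2 (val i, val j) n.
    by have := ltn_ord i; have := ltn_ord j; rewrite /le2 /= !ltnS => -> ->.
  exact: grid_fun_le ij (gc (val i, val j)).
apply/martingaleP; split=> // k l x y xy.
  rewrite !partial_sums_succ1 (grid_fun_sibling1 (gv (k, l)) xy).
  move: (partial_sums c (k, l) x) => s.
  rewrite addrACA -big_split /= big1 ?addr0; first by ring.
  move=> j _; rewrite /c; have [sx sy e1 e2 _] := xy.
  rewrite (@wp (k.+1, val j) y x)//; last by split=> //=; rewrite e1.
  by rewrite -mulrDr mdiff_sibling1// mulr0.
rewrite !partial_sums_succ2 (grid_fun_sibling2 (gv (k, l)) xy).
move: (partial_sums c (k, l) x) => s.
rewrite addrACA -big_split /= big1 ?addr0; first by ring.
move=> j _; rewrite /c; have [sx sy] := sibling2_sq xy; have [_ _ /= e1 e2 _] := xy.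
rewrite (@wp (val j, l.+1) y x)//; last by split=> //=; rewrite e1.
by rewrite -mulrDr mdiff_sibling2// mulr0.
Qed.

(** The squared [L^2] norm of [u n]. *)
Definition energy (R : realType) (u : Defs.family R) n : R :=
  grid_mean n (fun x => u n x ^+ 2).

Lemma grid_meanD (R : realType) n (f g : plane R -> R) :
  grid_mean n (fun x => f x + g x) = grid_mean n f + grid_mean n g.
Proof.
rewrite /grid_mean -mulrDr; congr (_ * _).
by rewrite -big_split; apply: eq_bigr => i _; rewrite -big_split.
Qed.

Lemma grid_meanZ (R : realType) n c (f : plane R -> R) :
  grid_mean n (fun x => c * f x) = c * grid_mean n f.
Proof.
rewrite /grid_mean mulrCA; congr (_ * _); rewrite mulr_sumr.
by apply: eq_bigr => i _; rewrite mulr_sumr.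
Qed.

(** With [a] the conditional expectation of [b], the hypothesis on the mean is the
    orthogonality of [a] and [b - a]. *)
Lemma grid_mean_pythagoras (R : realType) m n (a b : plane R -> R) :
  le2 m n -> grid_fun m a -> grid_fun n b ->
  grid_mean n (fun x => a x * (b x - a x)) = 0 ->
  grid_mean n (fun x => b x ^+ 2) =
  grid_mean m (fun x => a x ^+ 2) + grid_mean n (fun x => (b x - a x) ^+ 2).
Proof.
move=> mn ga gb h.
have gaa : grid_fun m (fun x => a x ^+ 2) by apply: (grid_fun1 (h := fun t => t ^+ 2)); rewrite ?expr0n.
rewrite (grid_mean_refine gaa (grid_fun_le mn gaa)) -grid_meanD.
rewrite -[RHS]addr0 -(mulr0 2) -h -grid_meanZ -grid_meanD.
by congr grid_mean; apply/funext => x; ring.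
Qed.

Lemma energy_diff1 (R : realType) (u : Defs.family R) k l : is_martingale u ->
  energy u (k, l) = \sum_(i < k.+1) energy (diff1 u) (val i, l).
Proof.
move=> mu; have [gu a1 a2] := (martingaleP u).1 mu.
elim: k => [|k IH].
  rewrite big_ord_recr big_ord0 /= add0r; congr grid_mean.
  by apply/funext => x; rewrite /diff1 /= subr0.
rewrite big_ord_recr /= -IH /energy (grid_mean_pythagoras _ (gu (k, l)) (gu _))//.
  by rewrite /le2 /= leqnSn leqnn.
apply: grid_mean0_sibling1 => x y xy; rewrite (grid_fun_sibling1 (gu (k, l)) xy).
transitivity (u (k, l) x * (u (k.+1, l) x + u (k.+1, l) y - 2 * u (k, l) x)).
  by ring.
by rewrite a1// subrr mulr0.
Qed.

(** Orthogonality of the martingale differences, one variable at a time. *)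
Lemma energy_mdiff (R : realType) (u : Defs.family R) n : is_martingale u ->
  energy u n = \sum_(i < n.1.+1) \sum_(j < n.2.+1) energy (mdiff u) (val i, val j).
Proof.
case: n => k l mu; rewrite energy_diff1//; apply: eq_bigr => i _ /=.
have [gu a1 a2] := (martingaleP u).1 mu.
have gd := grid_fun_diff1 gu; move: (val i) => {}i.
elim: l => [|l IH].
  rewrite big_ord_recr big_ord0 /= add0r; congr grid_mean.
  by apply/funext => x; rewrite mdiffE /= subr0.
rewrite big_ord_recr /= -IH /energy (grid_mean_pythagoras _ (gd (i, l)) (gd _)).
- congr (_ + grid_mean _ _).
  by apply/funext => x; rewrite mdiffE.
- by rewrite /le2 /= leqnSn leqnn.
apply: grid_mean0_sibling2 => x y xy; rewrite (grid_fun_sibling2 (gd (i, l)) xy).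
transitivity (diff1 u (i, l) x *
    (diff1 u (i, l.+1) x + diff1 u (i, l.+1) y - 2 * diff1 u (i, l) x)).
  by ring.
by rewrite diff1_averages2// subrr mulr0.
Qed.

(** * The dyadic maximal function, on a finite grid *)

(** Levels are counted upwards from the finest grid: the block of generation [d]
    and index [c] consists of the [2 ^ d] points from [c * 2 ^ d] on. *)
Definition block_count (E : nat -> bool) (d c : nat) : nat :=
  \sum_(r < 2 ^ d) E (c * 2 ^ d + r)%N.

(** The set where the dyadic maximal function of the indicator of [E] exceeds
    1/4. *)
Definition quarter_hull (N : nat) (E : nat -> bool) (i : nat) : bool :=
  [exists d : 'I_N.+1, (2 ^ d < 4 * block_count E d (i %/ 2 ^ d))%N].

Lemma sum_block_halves (V : nmodType) (h : nat -> V) d c :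
  \sum_(r < 2 ^ d.+1) h (c * 2 ^ d.+1 + r)%N =
  \sum_(r < 2 ^ d) h (c.*2 * 2 ^ d + r)%N + \sum_(r < 2 ^ d) h (c.*2.+1 * 2 ^ d + r)%N.
Proof.
rewrite expn2S -addnn big_split_ord /=; congr (_ + _); apply: eq_bigr => r _.
  by congr h; nia.
by congr h; nia.
Qed.

Lemma block_divn d c r : (r < 2 ^ d)%N -> ((c * 2 ^ d + r) %/ 2 ^ d = c)%N.
Proof. by move=> rd; rewrite divnMDl ?expn_gt0// divn_small// addn0. Qed.

(** The maximal dyadic intervals in which [E] has density more than 1/4 are
    disjoint; the induction on the generation replaces their selection: either
    the whole block is such an interval, or each of its halves is treated
    separately. *)
Lemma quarter_hull_block E d c :
  (\sum_(r < 2 ^ d) quarter_hull d E (c * 2 ^ d + r) <= 4 * block_count E d c)%N.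
Proof.
have le_all d' c' : (2 ^ d' < 4 * block_count E d' c')%N ->
    (\sum_(r < 2 ^ d') quarter_hull d' E (c' * 2 ^ d' + r) <= 4 * block_count E d' c')%N.
  move=> h; apply: leq_trans _ (ltnW h); rewrite -[leqRHS]card_ord -sum1_card.
  by apply: leq_sum => r _; case: quarter_hull.
elim: d c => [|d IH] c.
  have [h|h] := ltnP (2 ^ 0) (4 * block_count E 0 c); first exact: le_all.
  rewrite big_ord_recr big_ord0 /= add0n.
  suff -> : quarter_hull 0 E (c * 2 ^ 0 + 0) = false by [].
  apply: negbTE; rewrite /quarter_hull. rewrite negb_exists; apply/forallP => -[[|//] i] /=.
  by rewrite -leqNgt divn1 muln1 addn0.
have [h|h] := ltnP (2 ^ d.+1) (4 * block_count E d.+1 c); first exact: le_all.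
have -> : block_count E d.+1 c = (block_count E d c.*2 + block_count E d c.*2.+1)%N.
  exact: (sum_block_halves (fun i => E i : nat)).
rewrite (sum_block_halves (fun i => quarter_hull d.+1 E i : nat)).
have step c' : c'./2 = c -> (\sum_(r < 2 ^ d) quarter_hull d.+1 E (c' * 2 ^ d + r) <=
    4 * block_count E d c')%N.
  move=> hc; apply: leq_trans _ (IH c'); apply: leq_sum => r _.
  suff : quarter_hull d.+1 E (c' * 2 ^ d + r) -> quarter_hull d E (c' * 2 ^ d + r).
    by case: quarter_hull => // ->.
  move=> /existsP[[i id]] /= hi.
  have [e|ne] := eqVneq i d.+1.
    move: hi; rewrite e ltnNge; have -> : ((c' * 2 ^ d + r) %/ 2 ^ d.+1 = c)%N.
      by rewrite expnSr divnMA block_divn// divn2.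
    by rewrite h.
  have id' : (i < d.+1)%N by rewrite ltn_neqAle ne -ltnS.
  by apply/existsP; exists (Ordinal id').
by rewrite mulnDr leq_add// step ?doubleK//= uphalf_double.
Qed.

Lemma quarter_hull_count E N :
  (\sum_(i < 2 ^ N) quarter_hull N E i <= 4 * \sum_(i < 2 ^ N) E i)%N.
Proof.
have := quarter_hull_block E N 0; rewrite /block_count.
under eq_bigr do rewrite mul0n add0n.
by under [X in (_ <= 4 * X)%N]eq_bigr do rewrite mul0n add0n.
Qed.

Definition rect_count (F : nat -> nat -> bool) d1 d2 c1 c2 : nat :=
  \sum_(r < 2 ^ d1) block_count (F (c1 * 2 ^ d1 + r)%N) d2 c2.

(** Two one-parameter maximal functions in a row bound the strong maximal
    function, whose rectangles have independent side lengths. *)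
Definition strong_hull N (F : nat -> nat -> bool) i j : bool :=
  quarter_hull N (fun i => quarter_hull N (F i) j) i.

(** Iterating the one-parameter estimate: if [F] fills more than half of a
    rectangle, then more than a quarter of its rows are filled to more than a
    quarter. *)
Lemma heavy_strong_hull N F d1 d2 i j : (d1 <= N)%N -> (d2 <= N)%N ->
  (2 ^ (d1 + d2) < 2 * rect_count F d1 d2 (i %/ 2 ^ d1) (j %/ 2 ^ d2))%N ->
  strong_hull N F i j.
Proof.
move=> d1N d2N h; apply/existsP.
have d1S : (d1 < N.+1)%N by [].
exists (Ordinal d1S) => /=; set c := (i %/ 2 ^ d1)%N in h *.
set c2 := (j %/ 2 ^ d2)%N in h.
(* A row counts at most 1, and at most 1/4 unless it is filled to more than a
   quarter. *)
have bl (r : 'I_(2 ^ d1)) : (4 * block_count (F (c * 2 ^ d1 + r)%N) d2 c2 <=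
    2 ^ d2 + 3 * 2 ^ d2 * quarter_hull N (F (c * 2 ^ d1 + r)%N) j)%N.
  have := leqnn (block_count (F (c * 2 ^ d1 + r)%N) d2 c2).
  have full : (block_count (F (c * 2 ^ d1 + r)%N) d2 c2 <= 2 ^ d2)%N.
    rewrite -[leqRHS]card_ord -sum1_card; apply: leq_sum => s _; exact: leq_b1.
  case E : quarter_hull => /= _; first by lia.
  rewrite muln0 addn0 leqNgt; apply: contraFN E => hb.
  by apply/existsP; exists (Ordinal (d2N : d2 < N.+1)%N).
have : (4 * rect_count F d1 d2 c c2 <= 2 ^ d1 * 2 ^ d2 +
    3 * 2 ^ d2 * block_count (fun i => quarter_hull N (F i) j) d1 c)%N.
  rewrite /rect_count big_distrr /= [block_count _ d1 c]/block_count big_distrr /=.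
  rewrite -[X in (_ <= X * _ + _)%N](card_ord (2 ^ d1)) -sum_nat_const -big_split /=.
  by apply: leq_sum => r _; exact: bl.
rewrite expnD in h; set K := block_count _ _ _; set X := rect_count _ _ _ _ _ in h *.
have : (0 < 2 ^ d2)%N by rewrite expn_gt0.
move: h; set a := (2 ^ d1)%N; set b := (2 ^ d2)%N; nia.
Qed.

Lemma strong_hull_count N F :
  (\sum_(i < 2 ^ N) \sum_(j < 2 ^ N) strong_hull N F i j <=
   16 * \sum_(i < 2 ^ N) \sum_(j < 2 ^ N) F i j)%N.
Proof.
rewrite exchange_big /=.
apply: (@leq_trans (\sum_(j < 2 ^ N) 4 * \sum_(i < 2 ^ N) quarter_hull N (F i) j)%N).
  by apply: leq_sum => j _; exact: quarter_hull_count.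
rewrite -big_distrr /= exchange_big /= -[16%N]/(4 * 4)%N -mulnA leq_mul2l /=.
by rewrite big_distrr /=; apply: leq_sum => i _; exact: quarter_hull_count.
Qed.

Lemma idx_divn (R : realType) m n (t : R) : (m <= n)%N -> 0 <= t ->
  idx m t = (idx n t %/ 2 ^ (n - m))%N.
Proof.
move=> mn t0; have H d : idx m t = (idx (m + d) t %/ 2 ^ d)%N.
  elim: d => [|d IH]; first by rewrite addn0 expn0 divn1.
  by rewrite addnS expnS divnMA divn2 -idx_half.
by rewrite {1}(H (n - m)%N) subnKC.
Qed.

Definition corner_table (R : realType) (N : nat) (S : plane R -> bool) (i j : nat) : bool :=
  S (corner R (N, N) (i, j)).

(** More than half of the cell of level [n] around [x] is covered by [S], counted
    with the points of the grid of level [(N, N)]. *)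
Definition heavy (R : realType) (N : nat) (S : plane R -> bool) (n : nat * nat)
    (x : plane R) : bool :=
  (2 ^ ((N - n.1) + (N - n.2)) < 2 * rect_count (corner_table N S)
     (N - n.1) (N - n.2) (idx n.1 x.1) (idx n.2 x.2))%N.

Definition heavy_hull (R : realType) (N : nat) (S : plane R -> bool) (x : plane R) : bool :=
  strong_hull N (corner_table N S) (idx N x.1) (idx N x.2).

Lemma heavy_same_cell (R : realType) N (S : plane R -> bool) n x y :
  same_cell n x y -> heavy N S n x = heavy N S n y.
Proof. by rewrite /heavy => -[-> ->]. Qed.

Lemma heavy_heavy_hull (R : realType) N (S : plane R -> bool) n x :
  le2 n (N, N) -> unit_square R x -> heavy N S n x -> heavy_hull N S x.
Proof.
move=> /andP[/= n1 n2] /unit_square_ge0[x1 x2].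
rewrite /heavy (idx_divn n1 x1) (idx_divn n2 x2).
by apply: heavy_strong_hull; exact: leq_subr.
Qed.

(** Indicators are cut off outside the square, to stay within [grid_fun]. *)
Definition square_ind (R : realType) (S : plane R -> bool) (x : plane R) : R :=
  (`[< unit_square R x >] && S x)%:R.

Lemma square_indE (R : realType) (S : plane R -> bool) x : unit_square R x ->
  square_ind S x = (S x)%:R.
Proof. by move=> sx; rewrite /square_ind asboolT. Qed.

Lemma grid_fun_heavy_hull (R : realType) N (S : plane R -> bool) :
  grid_fun (N, N) (square_ind (heavy_hull N S)).
Proof.
split=> [x nx|x y sx sy [/= e1 e2]]; first by rewrite /square_ind asboolF.
by rewrite !square_indE// /heavy_hull e1 e2.
Qed.

Lemma heavy_hull_mean (R : realType) N (S : plane R -> bool) :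
  grid_mean (N, N) (square_ind (heavy_hull N S)) <= 16 * grid_mean (N, N) (square_ind S).
Proof.
rewrite /grid_mean mulrCA ler_wpM2l ?invr_ge0 ?exprn_ge0//=.
have cv (T : plane R -> bool) : \sum_(i < 2 ^ N) \sum_(j < 2 ^ N)
    square_ind T (corner R (N, N) (val i, val j)) =
    (\sum_(i < 2 ^ N) \sum_(j < 2 ^ N) T (corner R (N, N) (val i, val j)))%:R.
  rewrite natr_sum; apply: eq_bigr => i _; rewrite natr_sum; apply: eq_bigr => j _.
  by rewrite square_indE//; apply: unit_square_corner => /=; exact: ltn_ord.
rewrite !cv -natrM ler_nat.
apply: leq_trans (strong_hull_count N (corner_table N S)).
apply: leq_sum => i _; apply: leq_sum => j _.
by rewrite /heavy_hull /= !idx_corner.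
Qed.

Lemma sum_blocks (V : nmodType) n m d (f : nat -> V) : n = (m * d)%N ->
  \sum_(i < n) f i = \sum_(c < m) \sum_(r < d) f (c * d + r)%N.
Proof.
move=> ->; elim: m => [|m IH]; first by rewrite !big_ord0.
by rewrite mulSnr big_split_ord big_ord_recr /= IH.
Qed.

Lemma block_corner (R : realType) N m1 m2 c1 c2 r1 r2 :
  (m1 <= N)%N -> (m2 <= N)%N -> (c1 < 2 ^ m1)%N -> (c2 < 2 ^ m2)%N ->
  (r1 < 2 ^ (N - m1))%N -> (r2 < 2 ^ (N - m2))%N ->
  let y := corner R (N, N) (c1 * 2 ^ (N - m1) + r1, c2 * 2 ^ (N - m2) + r2)%N in
  [/\ unit_square R y, idx m1 y.1 = c1 & idx m2 y.2 = c2].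
Proof.
move=> m1N m2N c1m c2m r1N r2N y.
have B m c r : (m <= N)%N -> (c < 2 ^ m)%N -> (r < 2 ^ (N - m))%N ->
    (c * 2 ^ (N - m) + r < 2 ^ N)%N.
  by move=> mN cm rN; rewrite -[X in (_ < 2 ^ X)%N](subnKC mN) expnD; nia.
split; first by apply: unit_square_corner => /=; exact: B.
  by rewrite /y /= -[X in 2 ^+ X](subnKC m1N) idxM.
by rewrite /y /= -[X in 2 ^+ X](subnKC m2N) idxM.
Qed.

(** In each cell of level [m] on which [g] does not vanish, at least half of the
    points lie outside [S], and [g] is constant there. *)
Lemma grid_mean_light (R : realType) N (S : plane R -> bool) m (g : plane R -> R) :
  le2 m (N, N) -> grid_fun m g -> (forall x, unit_square R x -> 0 <= g x) ->
  (forall x, unit_square R x -> g x != 0 -> ~~ heavy N S m x) ->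
  grid_mean (N, N) g <= 2 * grid_mean (N, N) (fun x => g x * (~~ S x)%:R).
Proof.
case: m => m1 m2 /andP[/= m1N m2N] gg g0 gl.
rewrite /grid_mean mulrCA ler_wpM2l ?invr_ge0 ?exprn_ge0//=.
have blocks (h : plane R -> R) : \sum_(i < 2 ^ N) \sum_(j < 2 ^ N)
    h (corner R (N, N) (val i, val j)) =
  \sum_(c1 < 2 ^ m1) \sum_(c2 < 2 ^ m2) \sum_(r1 < 2 ^ (N - m1))
    \sum_(r2 < 2 ^ (N - m2)) h (corner R (N, N)
       (c1 * 2 ^ (N - m1) + r1, c2 * 2 ^ (N - m2) + r2)%N).
  have pw m : (m <= N)%N -> (2 ^ N = 2 ^ m * 2 ^ (N - m))%N.
    by move=> mN; rewrite -expnD subnKC.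
  rewrite (sum_blocks (fun i => \sum_(j < 2 ^ N) h (corner R (N, N) (i, val j))) (pw _ m1N)).
  apply: eq_bigr => c1 _; rewrite [RHS]exchange_big /=; apply: eq_bigr => r1 _.
  exact: (sum_blocks (fun j => h (corner R (N, N) (c1 * 2 ^ (N - m1) + r1, j)%N)) (pw _ m2N)).
rewrite blocks (blocks (fun x => g x * (~~ S x)%:R)) mulr_sumr; apply: ler_sum => c1 _.
rewrite mulr_sumr; apply: ler_sum => c2 _.
set x := corner R (m1, m2) (val c1, val c2).
have sx : unit_square R x by apply: unit_square_corner => /=; exact: ltn_ord.
pose y (r1 r2 : nat) := corner R (N, N)
   (c1 * 2 ^ (N - m1) + r1, c2 * 2 ^ (N - m2) + r2)%N.
have gy (r1 : 'I_(2 ^ (N - m1))) (r2 : 'I_(2 ^ (N - m2))) : g (y r1 r2) = g x.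
  have [sy e1 e2] := block_corner R m1N m2N (ltn_ord c1) (ltn_ord c2) (ltn_ord r1) (ltn_ord r2).
  by apply: gg.2 => //; split; rewrite /x /= idx_corner.
under eq_bigr do under eq_bigr do rewrite -/(y _ _) gy.
under [X in 2 * X]eq_bigr do under eq_bigr do rewrite -/(y _ _) gy.
under [X in 2 * X]eq_bigr do rewrite -mulr_sumr.
rewrite -mulr_sumr !sumr_const !card_ord -mulrnA -[X in X *+ _]mulr1 -mulrnAr.
rewrite [leRHS]mulrCA.
have [->|gx0] := eqVneq (g x) 0; first by rewrite !mul0r.
rewrite ler_wpM2l ?g0//.
have := gl x sx gx0; rewrite /heavy -leqNgt /x /= !idx_corner => hv.
have : (rect_count (corner_table N S) (N - m1) (N - m2) c1 c2 +
   \sum_(r1 < 2 ^ (N - m1)) \sum_(r2 < 2 ^ (N - m2)) ~~ S (y r1 r2) =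
   2 ^ (N - m1) * 2 ^ (N - m2))%N.
  rewrite /rect_count /block_count -big_split /= -[X in _ = (X * _)%N]card_ord -sum_nat_const.
  apply: eq_bigr => r1 _; rewrite -big_split /= -[RHS]card_ord -sum1_card.
  by apply: eq_bigr => r2 _; rewrite /corner_table -/(y _ _); case: (S _).
have -> : \sum_(r1 < 2 ^ (N - m1)) \sum_(r2 < 2 ^ (N - m2)) (~~ S (y r1 r2))%:R =
  (\sum_(r1 < 2 ^ (N - m1)) \sum_(r2 < 2 ^ (N - m2)) ~~ S (y r1 r2))%N%:R :> R.
  by rewrite natr_sum; apply: eq_bigr => r1 _; rewrite natr_sum.
rewrite -natrM ler_nat mulnC; rewrite expnD in hv.
set A := (_ * _)%N in hv *; set B := rect_count _ _ _ _ _ in hv *; lia.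
Qed.

(** * Integrals of powers *)

Definition power_integral (R : realType) (p : R) (f : plane R -> \bar R) : \bar R :=
  (\int[leb2 R]_x `|f x| `^ p)%E.

Lemma power_integral_ge0 (R : realType) (p : R) f : (0 <= power_integral p f)%E.
Proof. by apply: integral_ge0 => x _; exact: poweR_ge0. Qed.

Lemma measurable_abse_poweR (R : realType) (p : R) (f : plane R -> \bar R) :
  measurable_fun setT f -> measurable_fun setT (fun x => (`|f x| `^ p)%E).
Proof.
move=> mf; apply: (measurableT_comp (measurable_poweR p)).
exact: measurableT_comp.
Qed.

Lemma lee_poweR (R : realType) (p : R) (x y : \bar R) : 0 <= p ->
  (0 <= x -> x <= y -> x `^ p <= y `^ p)%E.
Proof.
move=> p0 x0 xy; apply: gt0_ler_poweR; rewrite // in_itv /= leey andbT//.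
exact: le_trans xy.
Qed.

(** Concavity: [z / (x + y)] lies below its [p]-th power for [z = x] and
    [z = y]. *)
Lemma powR_subadd (R : realType) (p x y : R) : 0 < p -> p <= 1 -> 0 <= x -> 0 <= y ->
  (x + y) `^ p <= x `^ p + y `^ p.
Proof.
move=> p0 p1 x0 y0; have [->|xy] := eqVneq (x + y) 0.
  by rewrite powR0 ?gt_eqF// addr_ge0// powR_ge0.
have s0 : 0 < x + y by rewrite lt_def xy addr_ge0.
have K z : 0 <= z -> z <= x + y -> z / (x + y) * (x + y) `^ p <= z `^ p.
  move=> z0 zs; have [->|zn] := eqVneq z 0; first by rewrite !mul0r powR_ge0.
  have zp : 0 < z by rewrite lt_def zn.
  have -> : z `^ p = (z / (x + y)) `^ p * (x + y) `^ p.
    by rewrite -powRM ?divfK// ?divr_ge0// ltW.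
  rewrite ler_wpM2r ?powR_ge0// ger1_powR// divr_gt0//=.
  by rewrite ler_pdivrMr ?mul1r.
apply: le_trans (lerD (K x x0 _) (K y y0 _)); rewrite ?lerDl ?lerDr//.
by rewrite -mulrDl -mulrDl divff ?mul1r.
Qed.

Lemma poweR_subadd (R : realType) (p : R) (x y : \bar R) : 0 < p -> p <= 1 ->
  (0 <= x -> 0 <= y -> (x + y) `^ p <= x `^ p + y `^ p)%E.
Proof.
move=> p0 p1; case: x y => [x| |] [y| |]//.
- by rewrite !lee_fin => x0 y0; exact: powR_subadd.
- by move=> _ _; rewrite addeC !addye//= gt_eqF//= addey.
- by move=> _ _; rewrite addye//= gt_eqF//= addye.
- by move=> _ _; rewrite addye//= gt_eqF//= addye.
Qed.

(** Replaces Hoelder's inequality when passing from an [L^2] bound to an [L^p]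
    bound on a set of finite measure: optimal for [y] of size [t]. *)
Lemma poweR_young (R : realType) (p t : R) (y : \bar R) : 0 < p -> p <= 2 -> 0 < t ->
  (0 <= y -> y `^ p <= (t `^ p)%:E + (t `^ (p - 2))%:E * y `^ 2)%E.
Proof.
move=> p0 p1 t0; case: y => [y| |]//; last first.
  by move=> _; rewrite /= gt_eqF//= gt_eqF// gt0_muley ?lte_fin ?powR_gt0// addey.
rewrite lee_fin => y0; rewrite !poweR_EFin -EFinM -EFinD lee_fin.
have [yt|ty] := leP y t.
  apply: (@le_trans _ _ (t `^ p)); last by rewrite lerDl mulr_ge0 ?powR_ge0.
  by apply: ge0_ler_powR; rewrite ?nnegrE// ltW.
have yp : 0 < y by exact: lt_trans ty.
apply: (@le_trans _ _ (t `^ (p - 2) * y `^ 2)); last by rewrite lerDr powR_ge0.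
have -> : y `^ p = y `^ (p - 2) * y `^ 2.
  by rewrite -powRD ?subrK// gt_eqF//= implybT.
rewrite ler_wpM2r ?powR_ge0//.
rewrite -[p - 2]opprB !powRN lef_pV2 ?posrE ?powR_gt0//.
by apply: ge0_ler_powR; rewrite ?nnegrE ?subr_ge0// ltW.
Qed.

Lemma poweR2E (R : realType) (y : R) : (`|y%:E| `^ 2)%E = (y ^+ 2)%:E.
Proof.
by rewrite abse_EFin poweR_EFin (powR_mulrn 2)// real_normK// num_real.
Qed.

Lemma grid_mean_le (R : realType) n (f g : plane R -> R) :
  (forall x, unit_square R x -> f x <= g x) -> grid_mean n f <= grid_mean n g.
Proof.
move=> fg; rewrite /grid_mean ler_wpM2l ?invr_ge0 ?exprn_ge0//.
apply: ler_sum => i _; apply: ler_sum => j _; apply: fg.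
by apply: unit_square_corner => /=; exact: ltn_ord.
Qed.

Lemma grid_mean_ge0 (R : realType) n (f : plane R -> R) :
  (forall x, unit_square R x -> 0 <= f x) -> 0 <= grid_mean n f.
Proof.
move=> f0; apply: mulr_ge0; first by rewrite invr_ge0 exprn_ge0.
apply: sumr_ge0 => i _; apply: sumr_ge0 => j _; apply: f0.
by apply: unit_square_corner => /=; exact: ltn_ord.
Qed.

Lemma energy_ge0 (R : realType) (u : Defs.family R) n : 0 <= energy u n.
Proof. by apply: grid_mean_ge0 => x _; exact: sqr_ge0. Qed.

Lemma grid_fun_sqr (R : realType) n (f : plane R -> R) :
  grid_fun n f -> grid_fun n (fun x => f x ^+ 2).
Proof. by move=> gf; apply: (grid_fun1 (h := fun t => t ^+ 2)); rewrite ?expr0n. Qed.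

Lemma martingale_grid (R : realType) (u : Defs.family R) n :
  is_martingale u -> grid_fun n (u n).
Proof. by move=> /martingaleP[]. Qed.

Lemma power_integral_energy (R : realType) (u : Defs.family R) n : is_martingale u ->
  power_integral 2 (EFin \o u n) = (energy u n)%:E.
Proof.
move=> mu; have [_ <-] := integral_grid_fun (grid_fun_sqr (martingale_grid n mu)).
by apply: eq_integral => x _; rewrite poweR2E.
Qed.

Lemma power_integral_norm (R : realType) (p : R) f : 0 < p ->
  power_integral p f = ('N[leb2 R]_(p%:E)[f] `^ p)%E.
Proof. by move=> p0; rewrite poweR_Lnorm// gt_eqF. Qed.

Lemma norm_Lp_energy (R : realType) (u : Defs.family R) (E : R) : is_martingale u ->
  0 <= E -> (forall n, energy u n <= E) -> (norm_Lp 2 u <= (Num.sqrt E)%:E)%E.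
Proof.
move=> mu E0 uE; apply: ge_ereal_sup => _ [n _ <-].
have -> : ('N[leb2 R]_2%:E[EFin \o u n] = power_integral 2 (EFin \o u n) `^ 2^-1)%E.
  by rewrite unlock.
rewrite power_integral_energy// poweR12_sqrt ?lee_fin ?energy_ge0//=.
exact: (ler_wsqrtr (uE n)).
Qed.

(** Stated with integrals of squares instead of norms: it then adds up with
    [poweR_young]. *)
Definition energy_estimate (R : realType) (V : Defs.operator R) (C : R) : Prop :=
  forall u E, is_martingale u -> (forall n, energy u n <= E) ->
    (power_integral 2 (V u) <= (C * E)%:E)%E.

Lemma bounded_L2_energy (R : realType) (V : Defs.operator R) : bounded_L2_L2 V ->
  exists C : R, 0 <= C /\ energy_estimate V C.
Proof.
move=> [C HC]; exists (C ^+ 2); split=> [|u E mu uE]; first exact: sqr_ge0.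
have E0 : 0 <= E by apply: le_trans (energy_ge0 u (0, 0)%N) (uE _).
have nu := norm_Lp_energy mu E0 uE.
have := HC u (conj mu (le_lt_trans nu (ltry _))) => h.
rewrite power_integral_norm//.
have h' : ('N[leb2 R]_2%:E[V u] <= (`|C| * Num.sqrt E)%:E)%E.
  apply: le_trans h _; apply: (@le_trans _ _ (`|C|%:E * norm_Lp 2 u)%E).
    apply: lee_wpmul2r; last by rewrite lee_fin ler_norm.
    apply: le_trans (ereal_sup_ubound _); last by exists (0, 0)%N.
    exact: Lnorm_ge0.
  by rewrite EFinM lee_wpmul2l// lee_fin.
apply: le_trans (lee_poweR _ (Lnorm_ge0 _ _ _) h') _ => //. 
suff -> : C ^+ 2 * E = (`|C| * Num.sqrt E) `^ 2 by [].
by rewrite (powR_mulrn 2) ?mulr_ge0 ?sqrtr_ge0// exprMn sqr_sqrtr// real_normK// num_real.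
Qed.

Lemma in_L2_energy (R : realType) (u : Defs.family R) : in_Lp 2 u ->
  exists E : R, forall n, energy u n <= E.
Proof.
move=> [mu]; set X := norm_Lp 2 u => Xoo.
have X0 : (0 <= X)%E.
  apply: le_trans (ereal_sup_ubound _); last by exists (0, 0)%N.
  exact: Lnorm_ge0.
have Xf : X \is a fin_num by rewrite ge0_fin_numE.
exists (fine (X `^ 2)%E) => n; rewrite -lee_fin fineK ?fin_num_poweR//.
rewrite -power_integral_energy// power_integral_norm//.
apply: lee_poweR => //; first exact: Lnorm_ge0.
by apply: ereal_sup_ubound; exists n.
Qed.

Lemma energy_in_L2 (R : realType) (u : Defs.family R) (E : R) :
  is_martingale u -> (forall n, energy u n <= E) -> in_Lp 2 u.
Proof.
move=> mu uE; split=> //; apply: le_lt_trans (norm_Lp_energy mu _ uE) (ltry _).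
exact: le_trans (energy_ge0 u (0, 0)%N) (uE _).
Qed.

(** * Splitting a finite martingale by the size of its square function *)

(** [u] is determined by its values at level [(N, N)]. *)
Definition confined (R : realType) (N : nat) (u : Defs.family R) : Prop :=
  forall n x, ~~ le2 n (N, N) -> mdiff u n x = 0.

(** The square of the square function of a confined martingale. *)
Definition square_sum (R : realType) (N : nat) (u : Defs.family R) (x : plane R) : R :=
  \sum_(i < N.+1) \sum_(j < N.+1) mdiff u (val i, val j) x ^+ 2.

Definition level_set (R : realType) (N : nat) (u : Defs.family R) (t : R)
    (x : plane R) : bool := t ^+ 2 < square_sum N u x.

(** Membership of [x] in the set [e_n] of the layer of height [t]: the cell at
    which the difference of index [n] is predictable is mostly covered by
    [{S > t}] but not by [{S > 2 t}]. *)
Definition in_layer (R : realType) (N : nat) (u : Defs.family R) (t : R)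
    (n : nat * nat) (x : plane R) : bool :=
  [&& n != (0, 0)%N, le2 n (N, N), heavy N (level_set N u t) (predn2 n) x &
      ~~ heavy N (level_set N u (2 * t)) (predn2 n) x].

(** The restriction to [n != (0, 0)] in [in_layer] removes the mean value. *)
Definition layer (R : realType) (N : nat) (u : Defs.family R) (t : R) : Defs.family R :=
  partial_sums (fun n x => (in_layer N u t n x)%:R * mdiff u n x).

Lemma layer_predictable (R : realType) N (u : Defs.family R) t n x y :
  same_cell (predn2 n) x y -> in_layer N u t n x = in_layer N u t n y.
Proof. by move=> xy; rewrite /in_layer !(heavy_same_cell _ _ xy). Qed.

Lemma is_martingale_layer (R : realType) N (u : Defs.family R) t :
  is_martingale u -> is_martingale (layer N u t).
Proof.
move=> mu; apply: (is_martingale_transform (w := fun n x => (in_layer N u t n x)%:R) mu).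
by move=> n x y sx sy xy; rewrite (layer_predictable _ _ _ xy).
Qed.

Lemma predn2_le (n : nat * nat) : le2 (predn2 n) n.
Proof. by rewrite /le2 /= !leq_pred. Qed.

Lemma le2_ord N (i j : 'I_N.+1) : le2 (val i, val j) (N, N).
Proof. by rewrite /le2 /= -ltnS ltn_ord -ltnS ltn_ord. Qed.

Lemma le2_trans (m n k : nat * nat) : le2 m n -> le2 n k -> le2 m k.
Proof.
by move=> /andP[a b] /andP[c d]; rewrite /le2 (leq_trans a c) (leq_trans b d).
Qed.

Lemma mdiff_layer (R : realType) N (u : Defs.family R) t n x :
  mdiff (layer N u t) n x = (in_layer N u t n x)%:R * mdiff u n x.
Proof. exact: mdiff_partial_sums. Qed.

Lemma grid_fun_partial_sums (R : realType) (c : Defs.family R) N n :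
  (forall m, grid_fun m (c m)) -> (forall m x, ~~ le2 m N -> c m x = 0) ->
  grid_fun N (partial_sums c n).
Proof.
move=> gc c0.
apply: (@grid_fun_sum _ N _ _ _
    (fun (i : 'I_n.1.+1) x => \sum_(j < n.2.+1) c (val i, val j) x)) => i _.
apply: (@grid_fun_sum _ N _ _ _ (fun (j : 'I_n.2.+1) x => c (val i, val j) x)) => j _.
have [h|h] := boolP (le2 (val i, val j) N); first exact: grid_fun_le h (gc _).
rewrite (_ : (fun x => _) = fun=> 0); first exact: grid_fun0.
by apply/funext => x; rewrite c0.
Qed.

Lemma partial_sums_mdiffE (R : realType) (u : Defs.family R) :
  u = partial_sums (mdiff u).
Proof. by apply/funext => n; apply/funext => x; rewrite partial_sums_mdiff. Qed.

Lemma confined_simple (R : realType) N (u : Defs.family R) :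
  is_martingale u -> confined N u -> is_simple u.
Proof.
move=> mu cu; exists (N, N) => n.
have gu : grid_fun (N, N) (u n).
  rewrite [u]partial_sums_mdiffE; apply: grid_fun_partial_sums.
    by apply: grid_fun_mdiff => m; exact: martingale_grid.
  by move=> m x; exact: cu.
split=> //; first by apply/dyadic_measurableE; exact: gu.2.
by have [] := integral_grid_fun gu.
Qed.

Lemma confined_layer (R : realType) N (u : Defs.family R) t : confined N (layer N u t).
Proof.
by move=> n x /negbTE nN; rewrite mdiff_layer /in_layer nN andbF mul0r.
Qed.

Lemma mdiff00 (R : realType) (u : Defs.family R) x : mdiff u (0, 0)%N x = u (0, 0)%N x.
Proof. by rewrite /mdiff /= !subr0 addr0. Qed.

Lemma grid_fun_square_sum (R : realType) N (u : Defs.family R) : is_martingale u ->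
  grid_fun (N, N) (square_sum N u).
Proof.
move=> mu.
apply: (@grid_fun_sum _ (N, N) _ _ _
    (fun (i : 'I_N.+1) x => \sum_(j < N.+1) mdiff u (val i, val j) x ^+ 2)) => i _.
apply: (@grid_fun_sum _ (N, N) _ _ _ (fun (j : 'I_N.+1) x => mdiff u (val i, val j) x ^+ 2)) => j _.
apply: grid_fun_sqr; apply: grid_fun_le (grid_fun_mdiff _ _).
  exact: le2_ord.
by move=> n; exact: martingale_grid.
Qed.

(** The sets [e_n] of the support condition are the cells of the layer of level
    [n - (1, 1)]; these are mostly covered by [{S > t}], so they lie in the hull
    of that set. *)
Lemma layer_support (R : realType) (V : Defs.operator R) N (u : Defs.family R) t :
  support_condition V -> is_martingale u ->
  {ae leb2 R, forall x, (0 < `|V (layer N u t) x|)%E ->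
     square_ind (heavy_hull N (level_set N u t)) x = 1}.
Proof.
move=> Vs mu; have ml := is_martingale_layer N t mu.
pose e n : set (plane R) := [set x | unit_square R x /\ in_layer N u t n x].
have [||] := Vs (layer N u t) e ml (confined_simple ml (@confined_layer _ N u t)).
- move=> x; rewrite -mdiff00 mdiff_layer /in_layer /=; exact: mul0r.
- move=> n n0; split.
    exists (predn2 n); split; first exact: predn2_le.
      apply/eqP => e'; move/eqP: n0; apply; move: e'.
      by case: n => -[|k] [|l] //= [] /eqP; rewrite ?(ltn_eqF (ltnSn _))// => /n_Sn.
    apply/dyadic_sigmaE; split=> [x []//|x y sx sy xy [_ lx]].
    by split=> //; rewrite -(layer_predictable _ _ _ xy).
  move=> x; rewrite mdiff_layer; have [sx|nx] := pselect (unit_square R x).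
    rewrite indicE; case: (boolP (in_layer N u t n x)) => h.
      by rewrite mem_set// !mul1r.
    by rewrite mul0r mulr0.
  have gd : grid_fun n (mdiff u n) by apply: grid_fun_mdiff => m; exact: martingale_grid.
  by rewrite gd.1// !mulr0.
move=> A [mA A0 HA]; exists A; split=> // x /= nx; apply: HA => /= h; apply: nx => /h.
move=> [n n0 [sx /and4P[_ nN hv _]]].
by rewrite square_indE// (heavy_heavy_hull _ sx hv)//; apply: le2_trans nN; exact: predn2_le.
Qed.

Lemma sum_le_support (R : realType) (f : nat -> R) a b : (forall i, 0 <= f i) ->
  (forall i, (b <= i)%N -> f i = 0) -> \sum_(i < a) f i <= \sum_(i < b) f i.
Proof.
move=> f0 fb; rewrite -!(big_mkord xpredT f).
have [ab|ba] := leqP a b.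
  by rewrite (big_cat_nat (leq0n a) ab) /= lerDl sumr_ge0.
rewrite (big_cat_nat (leq0n b) (ltnW ba)) /= gerDl big_nat_cond big1//.
by move=> i /andP[/andP[/fb]].
Qed.

Lemma sum2_le_support (R : realType) (f : nat * nat -> R) a b N :
  (forall n, 0 <= f n) -> (forall n, ~~ le2 n (N, N) -> f n = 0) ->
  \sum_(i < a) \sum_(j < b) f (val i, val j) <=
  \sum_(i < N.+1) \sum_(j < N.+1) f (val i, val j).
Proof.
move=> f0 fN.
apply: (@le_trans _ _ (\sum_(i < a) \sum_(j < N.+1) f (val i, val j))).
  apply: ler_sum => i _; apply: (sum_le_support (f := fun j => f (val i, j))) => // j jN.
  by apply: fN; rewrite /le2 /= negb_and -!ltnNge jN orbT.
apply: (sum_le_support (f := fun i => \sum_(j < N.+1) f (i, val j))) => [i|i iN].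
  exact: sumr_ge0.
by apply: big1 => j _; apply: fN; rewrite /le2 /= negb_and -!ltnNge iN.
Qed.

Lemma grid_mean_sum (R : realType) n M (g : nat -> plane R -> R) :
  \sum_(i < M) grid_mean n (g i) = grid_mean n (fun x => \sum_(i < M) g i x).
Proof.
elim: M => [|M IH].
  rewrite big_ord0 /grid_mean big1 ?mulr0// => i _; rewrite big1// => j _.
  by rewrite big_ord0.
rewrite big_ord_recr /= IH -grid_meanD; congr grid_mean.
by apply/funext => x; rewrite big_ord_recr.
Qed.

Lemma grid_mean_sum2 (R : realType) n N (f : nat * nat -> plane R -> R) :
  \sum_(i < N) \sum_(j < N) grid_mean n (f (val i, val j)) =
  grid_mean n (fun x => \sum_(i < N) \sum_(j < N) f (val i, val j) x).
Proof.
rewrite -(grid_mean_sum n N (fun i x => \sum_(j < N) f (i, val j) x)); apply: eq_bigr => i _.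
exact: (grid_mean_sum n N (fun j => f (val i, j))).
Qed.

Lemma level_setN (R : realType) N (u : Defs.family R) t x :
  ~~ level_set N u t x -> square_sum N u x <= t ^+ 2.
Proof. by rewrite /level_set -leNgt. Qed.

(** Each cell that carries a difference of the layer keeps half of its mass
    outside [{S > 2 t}], where the squares add up to at most [4 t ^ 2]. The
    constant is 2 (for the half) times 4 times 16 (for the hull). *)
Lemma energy_layer (R : realType) N (u : Defs.family R) t n : is_martingale u ->
  energy (layer N u t) n <= 128 * (t ^+ 2 * grid_mean (N, N) (square_ind (level_set N u t))).
Proof.
move=> mu; have ml := is_martingale_layer N t mu.
pose c : Defs.family R := fun n x => (in_layer N u t n x)%:R * mdiff u n x.
have cE m : energy (mdiff (layer N u t)) m = energy c m.
  by congr grid_mean; apply/funext => x; rewrite mdiff_layer.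
have cN m : ~~ le2 m (N, N) -> c m = fun=> 0.
  by move=> /negbTE mN; apply/funext => x; rewrite /c /in_layer mN andbF mul0r.
pose S2 := level_set N u (2 * t).
have cL m : le2 m (N, N) ->
    energy c m <= 2 * grid_mean (N, N) (fun x => c m x ^+ 2 * (~~ S2 x)%:R).
  move=> mN; have pN := le2_trans (predn2_le m) mN.
  have gc : grid_fun m (c m).
    have := grid_fun_mdiff (fun k => martingale_grid k ml) m.
    by congr grid_fun; apply/funext => x; rewrite mdiff_layer.
  have gp : grid_fun (predn2 m) (fun x => c m x ^+ 2).
    split=> [x nx|x y sx sy xy]; first by rewrite gc.1// expr0n.
    by rewrite /c !exprMn (layer_predictable _ _ _ xy) (mdiff_sqr_pred mu sx sy xy).
  rewrite /energy (grid_mean_refine (grid_fun_sqr gc) (grid_fun_le mN (grid_fun_sqr gc))).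
  apply: (grid_mean_light pN gp) => x sx; first exact: sqr_ge0.
  rewrite expf_eq0 /= /c; case h : (in_layer N u t m x); last by rewrite mul0r eqxx.
  by move: h => /and4P[].
rewrite energy_mdiff//; under eq_bigr do under eq_bigr do rewrite cE.
apply: (@le_trans _ _ (\sum_(i < N.+1) \sum_(j < N.+1) energy c (val i, val j))).
  apply: sum2_le_support => m; first exact: energy_ge0.
  move=> /cN c0; rewrite /energy c0 /grid_mean big1 ?mulr0// => i _.
  by rewrite big1// => j _; rewrite /= expr0n.
apply: (@le_trans _ _ (\sum_(i < N.+1) \sum_(j < N.+1) 2 *
    grid_mean (N, N) (fun x => c (val i, val j) x ^+ 2 * (~~ S2 x)%:R))).
  apply: ler_sum => i _; apply: ler_sum => j _; apply: cL.
  exact: le2_ord.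
under eq_bigr do rewrite -mulr_sumr.
rewrite -mulr_sumr (grid_mean_sum2 _ _ (fun m x => c m x ^+ 2 * (~~ S2 x)%:R)).
apply: (@le_trans _ _ (2 * grid_mean (N, N)
   (fun x => (2 * t) ^+ 2 * square_ind (heavy_hull N (level_set N u t)) x))).
  rewrite ler_pM2l//; apply: grid_mean_le => x sx.
  under eq_bigr do rewrite -mulr_suml; rewrite -mulr_suml square_indE//.
  case: (boolP (S2 x)) => /= [_|/level_setN Qt]; first by rewrite mulr0 mulr_ge0// sqr_ge0.
  rewrite mulr1; case: (boolP (heavy_hull _ _ _)) => hh; rewrite ?mulr1 ?mulr0.
    apply: le_trans Qt; apply: ler_sum => i _; apply: ler_sum => j _.
    rewrite exprMn; case: in_layer; rewrite ?expr1n ?mul1r// expr0n mul0r; exact: sqr_ge0.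
  rewrite big1// => i _; rewrite big1// => j _; rewrite /c.
  case h : (in_layer N u t (val i, val j) x); last by rewrite mul0r expr0n.
  move/and4P: h => [_ nN hv _]; case/negP: hh; apply: heavy_heavy_hull hv => //.
  exact: le2_trans (predn2_le _) nN.
rewrite grid_meanZ; have := heavy_hull_mean N (level_set N u t).
have t2 : 0 <= t ^+ 2 by exact: sqr_ge0.
move: (grid_mean _ _) (grid_mean _ _) => a b ab; nra.
Qed.

(** [poweR_young] is used on the hull of [{S > t}], outside which [V] of the layer
    vanishes. *)
Lemma power_integral_layer (R : realType) (V : Defs.operator R) (p C : R) N
    (u : Defs.family R) t :
  0 < p -> p <= 1 -> 0 < t -> 0 <= C ->
  measurable_valued V -> support_condition V ->
  energy_estimate V C ->
  is_martingale u ->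
  (power_integral p (V (layer N u t)) <=
   ((16 + 128 * C) * (t `^ p * grid_mean (N, N) (square_ind (level_set N u t))))%:E)%E.
Proof.
move=> p0 p1 t0 C0 Vm Vs V2 mu; have ml := is_martingale_layer N t mu.
pose H := square_ind (heavy_hull N (level_set N u t)).
have gH : grid_fun (N, N) H by exact: grid_fun_heavy_hull.
have [iH eH] := integral_grid_fun gH.
have mH : measurable_fun setT (EFin \o H) by case/integrableP: iH.
have H0 x : 0 <= H x by rewrite /H /square_ind.
have mV := Vm _ ml.
have D0 (x : plane R) : (0 <= (t `^ p)%:E * (H x)%:E +
    (t `^ (p - 2))%:E * `|V (layer N u t) x| `^ 2)%E.
  by rewrite adde_ge0// mule_ge0 ?lee_fin ?powR_ge0 ?H0 ?poweR_ge0.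
apply: (@le_trans _ _ (\int[leb2 R]_x ((t `^ p)%:E * (H x)%:E +
    (t `^ (p - 2))%:E * `|V (layer N u t) x| `^ 2))%E).
  apply: ae_ge0_le_integral => //.
  - by move=> x _; exact: poweR_ge0.
  - exact: measurable_abse_poweR.
  - apply: emeasurable_funD; apply: measurable_funeM => //.
    exact: measurable_abse_poweR.
  apply: filterS (layer_support N t Vs mu) => x Hx _.
  have [V0|V0] := eqVneq (`|V (layer N u t) x|)%E 0%E.
    by rewrite [leLHS](_ : _ = 0%E) ?D0// V0 poweR0r ?gt_eqF.
  have -> : H x = 1 by apply: Hx; rewrite lt0e V0 abse_ge0.
  by rewrite mule1; apply: poweR_young => //; lra.
rewrite ge0_integralD//; last 4 first.
- by move=> x _; rewrite mule_ge0 ?lee_fin ?powR_ge0.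
- exact: measurable_funeM.
- by move=> x _; rewrite mule_ge0 ?lee_fin ?powR_ge0// poweR_ge0.
- by apply: measurable_funeM; exact: measurable_abse_poweR.
rewrite !ge0_integralZl ?lee_fin ?powR_ge0//; last 3 first.
- exact: measurable_abse_poweR.
- by move=> x _; exact: poweR_ge0.
- by move=> x _; rewrite lee_fin.
rewrite eH; have := V2 _ _ ml (fun n => energy_layer N t n mu).
have hm := heavy_hull_mean N (level_set N u t).
rewrite -/H in hm; move: (grid_mean _ H) hm => h.
set s := grid_mean _ _ => hs; rewrite -/(power_integral 2 _) => X.
apply: (@le_trans _ _ ((t `^ p * (16 * s))%:E +
   (t `^ (p - 2) * (C * (128 * (t ^+ 2 * s))))%:E)%E).
  apply: leeD; first by rewrite -EFinM lee_fin ler_wpM2l ?powR_ge0.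
  by rewrite EFinM lee_wpmul2l// lee_fin powR_ge0.
have tp : t `^ (p - 2) * t ^+ 2 = t `^ p.
  by rewrite -(powR_mulrn 2) ?ltW// -powRD ?subrK// gt_eqF//= implybT.
by rewrite -EFinD lee_fin -tp; rewrite le_eqVlt; apply/orP; left; apply/eqP; ring.
Qed.

Lemma heavy_mono (R : realType) N (S S' : plane R -> bool) n x :
  le2 n (N, N) -> unit_square R x ->
  (forall y, unit_square R y -> same_cell n y x -> S y -> S' y) ->
  heavy N S n x -> heavy N S' n x.
Proof.
case: n => m1 m2 /andP[/= m1N m2N] sx SS; rewrite /heavy => h; apply: leq_trans h _.
rewrite leq_mul2l /=; apply: leq_sum => r1 _; apply: leq_sum => r2 _.
have [a b] := idx_bounds (m1, m2) sx; rewrite /= in a b.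
rewrite /corner_table /=; set y := corner R (N, N) _.
have [sy e1 e2] := block_corner R m1N m2N a b (ltn_ord r1) (ltn_ord r2).
have xy : same_cell (m1, m2) y x by split.
by have := SS y sy xy; case: (S y) => // ->.
Qed.

Lemma heavy_full (R : realType) N (S : plane R -> bool) n x :
  le2 n (N, N) -> unit_square R x ->
  (forall y, unit_square R y -> same_cell n y x -> S y) -> heavy N S n x.
Proof.
move=> nN sx Sx; apply: (heavy_mono (S := fun=> true) nN sx); first by move=> y sy /Sx ->.
rewrite /heavy /rect_count /block_count /corner_table.
under eq_bigr do rewrite sum1_card card_ord.
by rewrite sum_nat_const card_ord -expnD mul2n -addnn -[ltnLHS]addn0 ltn_add2l expn_gt0.
Qed.

Lemma heavy_empty (R : realType) N (S : plane R -> bool) n x :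
  le2 n (N, N) -> unit_square R x ->
  (forall y, unit_square R y -> ~~ S y) -> ~~ heavy N S n x.
Proof.
move=> nN sx Sx; apply/negP => /(heavy_mono (S' := fun=> false) nN sx) H.
have : heavy N (fun=> false) n x by apply: H => y sy _; rewrite (negbTE (Sx y sy)).
rewrite /heavy /rect_count /block_count /corner_table.
by under eq_bigr do rewrite big1 ?muln0//; rewrite big1 ?muln0.
Qed.

(** Finitely many values leave a gap between 0 and the positive ones. *)
Lemma gap_below (R : realType) (s : seq R) :
  exists2 t, 0 < t & forall y, y \in s -> 0 < y -> t ^+ 2 < y.
Proof.
elim: s => [|y s [t t0 IH]]; first by exists 1.
have [y0|y0] := leP y 0.
  exists t => // z; rewrite inE => /predU1P[->|/IH//].
  by rewrite ltNge y0.
pose m := Num.min t (Num.min 1 y / 2).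
have m0 : 0 < m by rewrite lt_min t0 divr_gt0// lt_min ltr01.
have mt : m <= t by rewrite ge_min lexx.
have m1 : m <= 1 / 2 by rewrite ge_min ler_pM2r ?invr_gt0// ge_min lexx orbT.
have my : m <= y / 2 by rewrite ge_min ler_pM2r ?invr_gt0// ge_min lexx !orbT.
exists m => // z; rewrite inE => /predU1P[-> _|zs z0]; first by nra.
apply: le_lt_trans (IH z zs z0); nra.
Qed.

(** Only finitely many heights matter: below [t] the level sets do not change, and
    above [t * 2 ^+ K] they are empty. *)
Lemma thresholds (R : realType) N (u : Defs.family R) : is_martingale u ->
  exists t K, [/\ 0 < t,
    forall x, unit_square R x -> 0 < square_sum N u x -> t ^+ 2 < square_sum N u x &
    forall x, unit_square R x -> square_sum N u x <= (t * 2 ^+ K) ^+ 2].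
Proof.
move=> mu; pose f (c : 'I_(2 ^ N) * 'I_(2 ^ N)) :=
  square_sum N u (corner R (N, N) (val c.1, val c.2)).
have fE x : unit_square R x -> exists c, square_sum N u x = f c.
  move=> sx; have [a b] := idx_bounds (N, N) sx.
  by exists (Ordinal a, Ordinal b); exact: grid_fun_corner (grid_fun_square_sum N mu) sx.
have f0 c : 0 <= f c by apply: sumr_ge0 => i _; apply: sumr_ge0 => j _; exact: sqr_ge0.
have [t t0 tf] := gap_below [seq f c | c <- enum {: 'I_(2 ^ N) * 'I_(2 ^ N)}].
pose B := \sum_c f c.
have B0 : 0 <= B by exact: sumr_ge0.
exists t, (Num.truncn ((B + 1) / t)).+1; split=> // x /fE[c ->].
  by apply: tf; rewrite map_f// mem_enum.
have : f c <= B by rewrite /B (bigD1 c)//= lerDl sumr_ge0.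
set K := (Num.truncn _).+1 => fB.
have : B + 1 <= t * 2 ^+ K.
  rewrite mulrC -ler_pdivrMr//; apply: le_trans (ltW (truncnS_gt _)) _.
  by rewrite -/K -natrX ler_nat ltnW// ltn_expl.
nra.
Qed.

Lemma powR2_gt1 (R : realType) (p : R) : 0 < p -> 1 < 2 `^ p.
Proof.
move=> p0; rewrite -[ltLHS](powRr0 2) /powR pnatr_eq0/= ltr_expR ltr_pM2r//.
by rewrite ln_gt0// ltr1n.
Qed.

(** The terms with [t * 2 ^+ k < s] form a geometric progression, whose sum is
    controlled by the last one, which is less than [s `^ p]. *)
Lemma layer_cake (R : realType) (p t s : R) K : 0 < p -> 0 < t -> 0 <= s ->
  \sum_(k < K) (t * 2 ^+ k) `^ p * (t * 2 ^+ k < s)%R%:R <=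
  2 `^ p / (2 `^ p - 1) * s `^ p.
Proof.
move=> p0 t0 s0; set q := 2 `^ p.
have q1 : 1 < q by exact: powR2_gt1.
have tS k : (t * 2 ^+ k.+1) `^ p = q * (t * 2 ^+ k) `^ p.
  have e : 0 <= t * 2 ^+ k by rewrite mulr_ge0 ?exprn_ge0// ltW.
  by rewrite exprS mulrCA [LHS]powRM.
have geo k : \sum_(i < k) (t * 2 ^+ i) `^ p <= (t * 2 ^+ k) `^ p / (q - 1).
  elim: k => [|k IH]; first by rewrite big_ord0 divr_ge0 ?powR_ge0// subr_ge0 ltW.
  rewrite big_ord_recr /= tS; move: IH.
  set X := (t * 2 ^+ k) `^ p => IH.
  have -> : q * X / (q - 1) = X / (q - 1) + X.
    by field; rewrite gt_eqF// subr_gt0.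
  by rewrite lerD2r.
elim: K => [|K IH].
  by rewrite big_ord0 mulr_ge0 ?powR_ge0// divr_ge0 ?powR_ge0// subr_ge0 ltW.
have [ts|st] := ltP (t * 2 ^+ K) s; last by rewrite big_ord_recr /= ltNge st mulr0 addr0.
apply: (@le_trans _ _ (\sum_(i < K.+1) (t * 2 ^+ i) `^ p)).
  apply: ler_sum => i _; rewrite -[leRHS]mulr1 ler_wpM2l ?powR_ge0//.
  by case: (_ < _).
apply: le_trans (geo _) _; rewrite tS mulrAC ler_wpM2l//.
  by rewrite divr_ge0 ?subr_ge0// ltW// (lt_trans _ q1).
apply: ge0_ler_powR; rewrite ?nnegrE//; [exact: ltW| |exact: ltW].
by rewrite mulr_ge0 ?exprn_ge0// ltW.
Qed.

Definition fam_sum (R : realType) (K : nat) (F : nat -> Defs.family R) : Defs.family R :=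
  fun n x => \sum_(k < K) F k n x.

Definition fam_one (R : realType) : Defs.family R :=
  fun _ x => (`[< unit_square R x >])%:R.

Arguments fam_one : clear implicits.

Lemma is_martingale_one (R : realType) : is_martingale (fam_one R).
Proof.
apply/martingaleP; split.
- move=> n; split=> [x nx|x y sx sy _]; first by rewrite /fam_one asboolF.
  by rewrite /fam_one !asboolT.
- move=> k l x y /sibling1_sq[sx sy]; rewrite /fam_one !asboolT//.
  by rewrite mulr1.
- move=> k l x y /sibling2_sq[sx sy]; rewrite /fam_one !asboolT//.
  by rewrite mulr1.
Qed.

Lemma energy_one (R : realType) n : energy (fam_one R) n = 1.
Proof.
rewrite /energy /grid_mean.
transitivity (2 ^- (n.1 + n.2) * \sum_(i < 2 ^ n.1) \sum_(j < 2 ^ n.2) (1 : R)).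
  congr (_ * _); apply: eq_bigr => i _; apply: eq_bigr => j _.
  rewrite /fam_one asboolT ?expr1n//.
  by apply: unit_square_corner => /=; exact: ltn_ord.
by rewrite !sumr_const !card_ord -mulrnA -expnD addnC natrX mulVf // expf_neq0.
Qed.

(** At each [x] and each [n != (0, 0)] with [mdiff u n x != 0], the cell at which
    this difference is predictable is filled by the lowest level set and missed
    by the highest one; as the level sets decrease, it belongs to exactly one
    layer. *)
Lemma layer_decomposition (R : realType) N (u : Defs.family R) (t : R) K :
  is_martingale u -> confined N u ->
  (forall x, unit_square R x -> 0 < square_sum N u x -> t ^+ 2 < square_sum N u x) ->
  (forall x, unit_square R x -> square_sum N u x <= (t * 2 ^+ K) ^+ 2) -> 0 < t ->
  u = fam_add (fam_scale (u (0, 0)%N (corner R (0, 0)%N (0, 0)%N)) (fam_one R))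
              (fam_sum K (fun k => layer N u (t * 2 ^+ k))).
Proof.
move=> mu cu tlow thigh t0; apply/funext => n; apply/funext => x.
rewrite /fam_add /fam_scale /fam_sum.
have [sx|nx] := pselect (unit_square R x); last first.
  rewrite (martingale_grid n mu).1// (martingale_grid n (is_martingale_one R)).1//.
  rewrite mulr0 add0r big1// => k _.
  exact: (martingale_grid n (is_martingale_layer N _ mu)).1.
have -> : u (0, 0)%N (corner R (0, 0)%N (0, 0)%N) * fam_one R n x = mdiff u (0, 0)%N x.
  rewrite /fam_one asboolT// mulr1 mdiff00; apply: (martingale_grid _ mu).2 => //.
    by apply: unit_square_corner.
  have [a b] := idx_bounds (0, 0)%N sx.
  by split; rewrite /= ?idx_corner; apply/eqP; rewrite eq_sym -leqn0 -ltnS.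
have E i j : mdiff u (i, j) x = ((i, j) == (0, 0)%N)%:R * mdiff u (i, j) x +
    \sum_(k < K) (in_layer N u (t * 2 ^+ k) (i, j) x)%:R * mdiff u (i, j) x.
  move: (i, j) => m {i j}; rewrite -mulr_suml -mulrDl.
  have [->|d0] := eqVneq (mdiff u m x) 0; first by rewrite mulr0.
  rewrite -[LHS]mul1r; congr (_ * _).
  have mN : le2 m (N, N) by apply/negPn/negP => /(cu m x)/eqP; rewrite (negbTE d0).
  have pN := le2_trans (predn2_le m) mN.
  have [m0|m0] := eqVneq m (0, 0)%N.
    by rewrite big1 ?addr0// => k _; rewrite /in_layer m0.
  rewrite add0r.
  (* The indicators of the layers are the increments of [h]. *)
  pose h k := (heavy N (level_set N u (t * 2 ^+ k)) (predn2 m) x)%:R : R.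
  have hE k : (in_layer N u (t * 2 ^+ k) m x)%:R = h k - h k.+1.
    rewrite /in_layer m0 mN /= mulrCA -exprS /h.
    have : heavy N (level_set N u (t * 2 ^+ k.+1)) (predn2 m) x ->
           heavy N (level_set N u (t * 2 ^+ k)) (predn2 m) x.
      apply: heavy_mono => // y sy _; rewrite /level_set; apply: le_lt_trans.
      have e i0 : 0 <= t * 2 ^+ i0 by rewrite mulr_ge0 ?exprn_ge0// ltW.
      by rewrite ler_sqr ?nnegrE ?e// ler_pM2l// ler_eXn2l// ?ltr1n.
    case: (heavy _ _ _ _); case: (heavy _ _ _ _) => //=; rewrite ?subrr ?subr0//.
    by move=> /(_ isT).
  under eq_bigr do rewrite hE.
  have -> : \sum_(k < K) (h k - h k.+1) = h 0%N - h K.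
    elim: (K) => [|k IH]; first by rewrite big_ord0 subrr.
    by rewrite big_ord_recr /= IH addrA subrK.
  rewrite /h heavy_full ?(negbTE (heavy_empty _ _ _)) ?subr0//.
    by move=> y sy; rewrite /level_set -leNgt; exact: thigh.
  move=> y sy yx; rewrite /level_set expr0 mulr1; apply: tlow => //.
  have m1N : (m.1 < N.+1)%N by case/andP: mN.
  have m2N : (m.2 < N.+1)%N by case/andP: mN.
  rewrite /square_sum (bigD1 (Ordinal m1N))//= (bigD1 (Ordinal m2N))//= -surjective_pairing.
  rewrite (mdiff_sqr_pred mu sy sx yx) -addrA; apply: ltr_wpDr.
    apply: addr_ge0; first by apply: sumr_ge0 => j _; exact: sqr_ge0.
    by apply: sumr_ge0 => i' _; apply: sumr_ge0 => j _; exact: sqr_ge0.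
  by rewrite lt_def sqr_ge0 expf_eq0 /= d0.
rewrite [u in LHS]partial_sums_mdiffE /partial_sums.
under eq_bigr do under eq_bigr do rewrite E.
under eq_bigr do rewrite big_split /=.
rewrite big_split /=; congr (_ + _).
  rewrite big_ord_recl big_ord_recl /= mul1r big1 ?addr0; last first.
    by move=> j _; rewrite mul0r.
  by rewrite big1 ?addr0// => i _; rewrite big1// => j _; rewrite mul0r.
under eq_bigr do rewrite exchange_big /=.
by rewrite exchange_big.
Qed.

(** * The estimate for finite martingales *)

Lemma power_integral_fam_add (R : realType) (V : Defs.operator R) (p : R) u v :
  0 < p -> p <= 1 -> measurable_valued V -> sublinear V ->
  is_martingale u -> is_martingale v ->
  (power_integral p (V (fam_add u v)) <=
   power_integral p (V u) + power_integral p (V v))%E.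
Proof.
move=> p0 p1 Vm [Va _] mu mv.
rewrite /power_integral -ge0_integralD//; last 4 first.
- by move=> x _; exact: poweR_ge0.
- by apply: measurable_abse_poweR; exact: Vm.
- by move=> x _; exact: poweR_ge0.
- by apply: measurable_abse_poweR; exact: Vm.
apply: ae_ge0_le_integral => //.
- by move=> x _; exact: poweR_ge0.
- by apply: measurable_abse_poweR; apply: Vm; exact: is_martingale_add.
- by move=> x _; rewrite adde_ge0 ?poweR_ge0.
- by apply: emeasurable_funD; apply: measurable_abse_poweR; exact: Vm.
apply: filterS (Va u v mu mv) => x h _.
apply: (@le_trans _ _ ((`|V u x| + `|V v x|) `^ p)%E).
  by apply: lee_poweR => //; exact: ltW.
by apply: poweR_subadd => //.
Qed.

Lemma power_integral_fam_scale (R : realType) (V : Defs.operator R) (p c : R) u :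
  0 < p -> measurable_valued V -> sublinear V -> is_martingale u ->
  (power_integral p (V (fam_scale c u)) = (`|c| `^ p)%:E * power_integral p (V u))%E.
Proof.
move=> p0 Vm [_ Vs] mu; rewrite /power_integral -ge0_integralZl//; last 2 first.
- by apply: measurable_abse_poweR; exact: Vm.
- by move=> x _; exact: poweR_ge0.
apply: ae_eq_integral => //.
- by apply: measurable_abse_poweR; apply: Vm; exact: is_martingale_scale.
- by apply: measurable_funeM; apply: measurable_abse_poweR; exact: Vm.
by apply: filterS (Vs c u mu) => x h _; rewrite /= h poweRM// lee_fin.
Qed.

Lemma is_martingale_fam_sum (R : realType) K (F : nat -> Defs.family R) :
  (forall k, is_martingale (F k)) -> is_martingale (fam_sum K F).
Proof.
move=> mF; elim: K => [|K IH].
  rewrite (_ : fam_sum 0 F = fam_scale 0 (F 0%N)); first exact: is_martingale_scale.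
  by apply/funext => n; apply/funext => x; rewrite /fam_sum /fam_scale big_ord0 mul0r.
rewrite (_ : fam_sum K.+1 F = fam_add (fam_sum K F) (F K)); first exact: is_martingale_add.
by apply/funext => n; apply/funext => x; rewrite /fam_sum /fam_add big_ord_recr.
Qed.

Lemma power_integral_fam_sum (R : realType) (V : Defs.operator R) (p : R) K F :
  0 < p -> p <= 1 -> measurable_valued V -> sublinear V ->
  (forall k, is_martingale (F k)) ->
  (power_integral p (V (fam_sum K F)) <= \sum_(k < K) power_integral p (V (F k)))%E.
Proof.
move=> p0 p1 Vm Vs mF; elim: K => [|K IH].
  rewrite (_ : fam_sum 0 F = fam_scale 0 (F 0%N)).
    by rewrite power_integral_fam_scale// normr0 powR0 ?gt_eqF// mul0e big_ord0.
  by apply/funext => n; apply/funext => x; rewrite /fam_sum /fam_scale big_ord0 mul0r.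
rewrite (_ : fam_sum K.+1 F = fam_add (fam_sum K F) (F K)).
  rewrite big_ord_recr /=.
  apply: le_trans (power_integral_fam_add p0 p1 Vm Vs _ (mF K)) _.
    exact: is_martingale_fam_sum.
  exact: leeD.
by apply/funext => n; apply/funext => x; rewrite /fam_sum /fam_add big_ord_recr.
Qed.

Lemma leb2_setT (R : realType) : leb2 R setT = 1%E.
Proof.
have -> : leb2 R setT = leb2 R (cell R (0, 0)%N (0, 0)%N).
  transitivity ((@lebesgue_measure R \x @lebesgue_measure R)%E (setT `&` unit_square R)).
    by [].
  transitivity ((@lebesgue_measure R \x @lebesgue_measure R)%E
     (cell R (0, 0)%N (0, 0)%N `&` unit_square R)); last by [].
  congr (_ _); apply/seteqP; split=> x [_ sx]; split=> //.
  have [a b] := idx_bounds (0, 0)%N sx; apply/cellE => //.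
  by move: a b; rewrite !ltnS !leqn0 /= => /eqP -> /eqP ->.
by rewrite leb2_cell//= addn0 expr0 invr1.
Qed.

Lemma power_integral_one (R : realType) (V : Defs.operator R) (p C : R) :
  0 < p -> p <= 1 -> measurable_valued V ->
  energy_estimate V C ->
  (power_integral p (V (fam_one R)) <= (1 + C)%:E)%E.
Proof.
move=> p0 p1 Vm V2; have mV := Vm _ (is_martingale_one R).
apply: (@le_trans _ _ (\int[leb2 R]_x (1%:E + `|V (fam_one R) x| `^ 2))%E).
  apply: ge0_le_integral => //.
  - by move=> x _; exact: poweR_ge0.
  - exact: measurable_abse_poweR.
  - by apply: emeasurable_funD => //; exact: measurable_abse_poweR.
  move=> x _; have p2 : p <= 2 by lra.
  have := poweR_young p0 p2 ltr01 (abse_ge0 (V (fam_one R) x)).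
  by rewrite !powR1 mul1e.
rewrite ge0_integralD//; last 2 first.
- by move=> x _; exact: poweR_ge0.
- exact: measurable_abse_poweR.
rewrite (integral_cst (leb2 R) measurableT) mul1e leb2_setT EFinD leeD2l//.
by rewrite -[C]mulr1; apply: V2 (is_martingale_one R) _ => n; rewrite energy_one.
Qed.

Lemma square_sum_ge0 (R : realType) N (u : Defs.family R) x : 0 <= square_sum N u x.
Proof. by apply: sumr_ge0 => i _; apply: sumr_ge0 => j _; exact: sqr_ge0. Qed.

(** On the finest grid the integral of [S(u)] to the power [p] is a finite mean. *)
Definition finite_estimate (R : realType) (V : Defs.operator R) (p C : R) : Prop :=
  forall N u, is_martingale u -> confined N u ->
    (power_integral p (V u) <=
     (C * grid_mean (N, N) (fun x => Num.sqrt (square_sum N u x) `^ p))%:E)%E.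

(** The mean value is handled by homogeneity, each layer of height [t] costs a
    multiple of [t `^ p] times the measure of [{S(u) > t}], and these costs form
    a geometric sum. As [V (u + v)] is dominated in the sense of [p]-th powers,
    the number of layers does not enter the constant. *)
Lemma finite_bound (R : realType) (V : Defs.operator R) (p : R) :
  0 < p -> p <= 1 ->
  measurable_valued V -> sublinear V -> bounded_L2_L2 V -> support_condition V ->
  exists2 C : R, 0 <= C & finite_estimate V p C.
Proof.
move=> p0 p1 Vm Vs /bounded_L2_energy[C [C0 V2]] Vsupp.
pose D := 2 `^ p / (2 `^ p - 1) : R.
have D0 : 0 <= D.
  by rewrite divr_ge0 ?powR_ge0// subr_ge0 ltW// powR2_gt1.
exists ((1 + C) + (16 + 128 * C) * D) => [|N u mu cu].
  by apply: addr_ge0; [lra|apply: mulr_ge0 => //; lra].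
have [t [K [t0 tlow thigh]]] := thresholds N mu.
set a := u (0, 0)%N (corner R (0, 0)%N (0, 0)%N).
set M := grid_mean _ _.
have uE := layer_decomposition mu cu tlow thigh t0; rewrite -/a in uE.
have ml k := is_martingale_layer N (t * 2 ^+ k) mu.
rewrite uE; apply: le_trans (power_integral_fam_add p0 p1 Vm Vs _ _) _.
- exact: is_martingale_scale (is_martingale_one R).
- exact: is_martingale_fam_sum.
rewrite mulrDl EFinD; apply: leeD.
  rewrite (power_integral_fam_scale _ p0 Vm Vs (is_martingale_one R)).
  apply: (@le_trans _ _ ((`|a| `^ p)%:E * (1 + C)%:E)%E).
    by rewrite lee_wpmul2l ?lee_fin ?powR_ge0// (power_integral_one p0 p1 Vm V2).
  rewrite -EFinM lee_fin mulrC ler_wpM2l//; first lra.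
  have -> : `|a| `^ p = grid_mean (0, 0)%N (fun x => `|u (0, 0)%N x| `^ p).
    by rewrite /grid_mean /= expr0 invr1 mul1r !big_ord1.
  have g0 : grid_fun (0, 0)%N (fun x => `|u (0, 0)%N x| `^ p).
    apply: (grid_fun1 (h := fun t => `|t| `^ p)) (martingale_grid _ mu).
    by rewrite normr0 powR0// gt_eqF.
  rewrite (grid_mean_refine g0 (grid_fun_le (n := (N, N)) _ g0))//.
  apply: grid_mean_le => x sx; apply: ge0_ler_powR; rewrite ?nnegrE ?sqrtr_ge0//.
    exact: ltW.
  rewrite -sqrtr_sqr; apply: ler_wsqrtr; rewrite -mdiff00.
  rewrite /square_sum big_ord_recl big_ord_recl /= -addrA lerDl addr_ge0//.
    by apply: sumr_ge0 => j _; exact: sqr_ge0.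
  by apply: sumr_ge0 => i _; apply: sumr_ge0 => j _; exact: sqr_ge0.
apply: le_trans (power_integral_fam_sum K p0 p1 Vm Vs ml) _.
apply: (@le_trans _ _ (\sum_(k < K) ((16 + 128 * C) * ((t * 2 ^+ k) `^ p *
   grid_mean (N, N) (square_ind (level_set N u (t * 2 ^+ k)))))%:E)%E).
  apply: lee_sum => k _; apply: power_integral_layer => //.
  by rewrite mulr_gt0// exprn_gt0.
rewrite sumEFin lee_fin -mulr_sumr -mulrA ler_wpM2l//; first lra.
under eq_bigr do rewrite -grid_meanZ.
rewrite (grid_mean_sum _ K (fun k x => (t * 2 ^+ k) `^ p * square_ind (level_set N u (t * 2 ^+ k)) x)).
rewrite -grid_meanZ; apply: grid_mean_le => x sx.
apply: le_trans (layer_cake K p0 t0 (sqrtr_ge0 _)).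
apply: ler_sum => k _; rewrite ler_wpM2l ?powR_ge0// square_indE// ler_nat /level_set.
have tk : 0 <= t * 2 ^+ k by rewrite mulr_ge0 ?exprn_ge0// ltW.
rewrite -{1}(sqr_sqrtr (square_sum_ge0 N u x)).
by rewrite ltr_sqr ?nnegrE ?sqrtr_ge0.
Qed.

(** * Truncations and tails of a martingale *)

(** Truncations, remainders and differences of truncations are all of this form. *)
Definition multiplier (R : realType) (th : nat * nat -> R) (u : Defs.family R) :
  Defs.family R := partial_sums (fun n x => th n * mdiff u n x).

Definition box (R : realType) (k : nat) (n : nat * nat) : R := (le2 n (k, k))%:R.

Definition truncate (R : realType) (k : nat) (u : Defs.family R) : Defs.family R :=
  multiplier (@box R k) u.

(** The multipliers bounded by 1 that vanish on the box of side [k]: these give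
    differences of two truncations beyond [k], as well as remainders. *)
Definition tail (R : realType) (k : nat) (th : nat * nat -> R) : Prop :=
  forall n, th n ^+ 2 + box R k n <= 1.

Definition finitely_supported (R : realType) (th : nat * nat -> R) : Prop :=
  exists N, forall n, ~~ le2 n (N, N) -> th n = 0.

Lemma is_martingale_multiplier (R : realType) th (u : Defs.family R) :
  is_martingale u -> is_martingale (multiplier th u).
Proof. by move=> mu; apply: (is_martingale_transform (w := fun n _ => th n) mu). Qed.

Lemma mdiff_multiplier (R : realType) th (u : Defs.family R) n x :
  mdiff (multiplier th u) n x = th n * mdiff u n x.
Proof. exact: mdiff_partial_sums. Qed.

(** Identities between families reduce to pointwise identities between their
    martingale differences. *)
Lemma eq_family (R : realType) (u v : Defs.family R) :
  (forall n x, mdiff u n x = mdiff v n x) -> u = v.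
Proof.
move=> uv; rewrite [u]partial_sums_mdiffE [v]partial_sums_mdiffE.
apply/funext => n; apply/funext => x.
by apply: eq_bigr => i _; apply: eq_bigr => j _; exact: uv.
Qed.

Lemma multiplier_fam_add (R : realType) th (u v : Defs.family R) :
  multiplier th (fam_add u v) = fam_add (multiplier th u) (multiplier th v).
Proof.
by apply: eq_family => n x; rewrite !(mdiff_multiplier, mdiff_add) mulrDr.
Qed.

Lemma multiplier_fam_scale (R : realType) th c (u : Defs.family R) :
  multiplier th (fam_scale c u) = fam_scale c (multiplier th u).
Proof.
by apply: eq_family => n x; rewrite !(mdiff_multiplier, mdiff_scale) mulrCA.
Qed.

Lemma multiplierB (R : realType) th th' (u : Defs.family R) :
  multiplier th u =
  fam_add (multiplier th' u) (multiplier (fun n => th n - th' n) u).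
Proof.
by apply: eq_family => n x; rewrite mdiff_add !mdiff_multiplier -mulrDl addrC subrK.
Qed.

Lemma multiplier1 (R : realType) (u : Defs.family R) :
  multiplier (fun=> 1) u = u.
Proof. by apply: eq_family => n x; rewrite mdiff_multiplier mul1r. Qed.

Lemma box_le (R : realType) k l n : (k <= l)%N -> box R k n <= box R l n.
Proof.
move=> kl; rewrite ler_nat; case: (boolP (le2 n (k, k))) => // h.
by rewrite (le2_trans h)//= /le2 /= kl.
Qed.

Lemma tail_box_sub (R : realType) k a b : (k <= a)%N -> (k <= b)%N ->
  tail k (fun n => box R a n - box R b n).
Proof.
move=> ka kb n; have := box_le R n ka; have := box_le R n kb.
rewrite /box; case: (le2 n (k, k)); case: (le2 n (a, a)); case: (le2 n (b, b));
  rewrite /= ?mulr1n ?mulr0n; lra.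
Qed.

Lemma tail_box (R : realType) k a : (k <= a)%N -> tail k (fun n => 1 - box R a n).
Proof.
move=> ka n; have := box_le R n ka.
rewrite /box; case: (le2 n (k, k)); case: (le2 n (a, a)); rewrite /= ?mulr1n ?mulr0n; lra.
Qed.

Lemma tail_box' (R : realType) k a : (k <= a)%N -> tail k (fun n => box R a n - 1).
Proof. by move=> ka n; rewrite -sqrrN opprB; exact: tail_box. Qed.

Lemma tail_le (R : realType) k l (th : nat * nat -> R) : (k <= l)%N -> tail l th -> tail k th.
Proof. by move=> kl t n; apply: le_trans (t n); rewrite lerD2l box_le. Qed.

Lemma finitely_supported_box_sub (R : realType) a b :
  finitely_supported (fun n => box R a n - box R b n).
Proof.
exists (maxn a b) => n h.
have H k : (k <= maxn a b)%N -> le2 n (k, k) = false.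
  move=> kab; apply/negbTE; apply: contraNN h => h.
  by apply: le2_trans h _; rewrite /le2 /= kab.
by rewrite /box !H ?leq_maxl ?leq_maxr// subrr.
Qed.

Lemma confined_multiplier (R : realType) th N (u : Defs.family R) :
  (forall n, ~~ le2 n (N, N) -> th n = 0) -> confined N (multiplier th u).
Proof. by move=> t0 n x /t0 e; rewrite mdiff_multiplier e mul0r. Qed.

(** Where [th] is not 0, the index lies outside the box of side [k]. *)
Lemma tail_sum (R : realType) (f : nat * nat -> R) th k N :
  (forall n, 0 <= f n) -> tail k th -> (k <= N)%N ->
  \sum_(i < N.+1) \sum_(j < N.+1) th (val i, val j) ^+ 2 * f (val i, val j) +
  \sum_(i < k.+1) \sum_(j < k.+1) f (val i, val j) <=
  \sum_(i < N.+1) \sum_(j < N.+1) f (val i, val j).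
Proof.
move=> f0 tk kN.
apply: (@le_trans _ _ (\sum_(i < N.+1) \sum_(j < N.+1) th (val i, val j) ^+ 2 * f (val i, val j)
  + \sum_(i < N.+1) \sum_(j < N.+1) box R k (val i, val j) * f (val i, val j))).
  rewrite lerD2l.
  apply: (@le_trans _ _ (\sum_(i < k.+1) \sum_(j < k.+1) box R k (val i, val j) * f (val i, val j))).
    apply: ler_sum => i _; apply: ler_sum => j _; by rewrite /box le2_ord mul1r.
  apply: (sum2_le_support (f := fun n => box R k n * f n)) => n; first by rewrite mulr_ge0.
  move=> nN; rewrite /box (_ : le2 n (k, k) = false) ?mul0r//; apply/negbTE.
  by apply: contraNN nN => h; apply: le2_trans h _; rewrite /le2 /= kN.
rewrite -big_split; apply: ler_sum => i _; rewrite -big_split; apply: ler_sum => j _ /=.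
by rewrite -mulrDl -[leRHS]mul1r ler_wpM2r.
Qed.

Lemma energy_multiplier (R : realType) th (u : Defs.family R) n :
  energy (mdiff (multiplier th u)) n = th n ^+ 2 * energy (mdiff u) n.
Proof.
rewrite /energy -grid_meanZ; congr grid_mean; apply/funext => x.
by rewrite mdiff_multiplier exprMn.
Qed.

Lemma energy_box (R : realType) (u : Defs.family R) a b N : is_martingale u ->
  (a <= N)%N -> (b <= N)%N -> energy u (a, b) <=
  \sum_(i < N.+1) \sum_(j < N.+1) energy (mdiff u) (val i, val j).
Proof.
move=> mu aN bN; rewrite energy_mdiff//=.
pose f n := box R N n * energy (mdiff u) n.
have fE M M' : (M <= N)%N -> (M' <= N)%N ->
    \sum_(i < M.+1) \sum_(j < M'.+1) energy (mdiff u) (val i, val j) =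
    \sum_(i < M.+1) \sum_(j < M'.+1) f (val i, val j).
  move=> MN MN'; apply: eq_bigr => i _; apply: eq_bigr => j _; rewrite /f /box /le2 /=.
  have := ltn_ord i; have := ltn_ord j; rewrite !ltnS => jM iM.
  by rewrite (leq_trans iM MN) (leq_trans jM MN') mul1r.
rewrite !fE//; apply: sum2_le_support => n; first by rewrite mulr_ge0 ?energy_ge0.
by rewrite /f /box => /negbTE ->; rewrite mul0r.
Qed.

Lemma energy_diag (R : realType) (u : Defs.family R) N : is_martingale u ->
  energy u (N, N) = \sum_(i < N.+1) \sum_(j < N.+1) energy (mdiff u) (val i, val j).
Proof. by move=> mu; rewrite energy_mdiff. Qed.

(** The energies of the truncations increase to a finite limit, and the energy of
    a tail is at most what is missing at [k]. *)
Lemma energy_tail (R : realType) (u : Defs.family R) (E e : R) : is_martingale u ->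
  (forall n, energy u n <= E) -> 0 < e ->
  exists k, forall th, tail k th -> forall n, energy (multiplier th u) n <= e.
Proof.
move=> mu uE e0; pose A : set R := range (fun N => energy u (N, N)).
have hA : has_sup A.
  split; first by exists (energy u (0, 0)%N), 0%N.
  by exists E => _ [N _ <-].
have [_ [k _ <-] hk] := sup_adherent e0 hA.
exists k => th tk [a b].
pose N := maxn k (maxn a b).
have mth := is_martingale_multiplier th mu.
apply: le_trans (energy_box (N := N) mth _ _) _.
- by rewrite /N; lia.
- by rewrite /N; lia.
under eq_bigr do under eq_bigr do rewrite energy_multiplier.
have := tail_sum (N := N) (fun n => energy_ge0 (mdiff u) n) tk.
rewrite -!energy_diag// => /(_ (leq_maxl _ _)).
have : energy u (N, N) <= sup A by apply: sup_upper_bound => //; exists N.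
move: (energy u (N, N)) (energy u (k, k)) hk (\sum_(i < _) _) => x y hk z; lra.
Qed.

(** * The square function *)

(** The square of the square function. *)
Definition square_esum (R : realType) (u : Defs.family R) (x : plane R) : \bar R :=
  (\esum_(n in [set: nat * nat]) (`|mdiff u n x| ^+ 2)%:E)%E.

(** The box as a sequence without duplicates, to compare sums over boxes with
    unordered sums. *)
Definition box_seq (N : nat) : seq (nat * nat) :=
  [seq (i, j) | i <- iota 0 N.+1, j <- iota 0 N.+1].

Lemma mem_box_seq N n : (n \in box_seq N) = le2 n (N, N).
Proof.
case: n => a b; apply/allpairsP/idP => [[[i j]] []|/andP[aN bN]].
  by rewrite !mem_iota !ltnS => iN jN [-> ->]; rewrite /le2 /=; apply/andP.
by exists (a, b); rewrite !mem_iota !ltnS.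
Qed.

Lemma uniq_box_seq N : uniq (box_seq N).
Proof. by apply: allpairs_uniq; [exact: iota_uniq..|case=> ? ? []]. Qed.

Lemma square_sum_seq (R : realType) N (u : Defs.family R) x :
  square_sum N u x = \sum_(n <- box_seq N) `|mdiff u n x| ^+ 2.
Proof.
rewrite /box_seq big_allpairs -{1}[iota _ _]/(index_iota 0 N.+1) big_mkord.
apply: eq_bigr => i _; rewrite -[iota _ _]/(index_iota 0 N.+1) big_mkord.
by apply: eq_bigr => j _; rewrite real_normK ?num_real.
Qed.

Lemma square_sum_le (R : realType) (u : Defs.family R) x M N : (M <= N)%N ->
  square_sum M u x <= square_sum N u x.
Proof.
move=> MN.
have f0 n : 0 <= box R M n * mdiff u n x ^+ 2 by rewrite mulr_ge0 ?sqr_ge0.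
apply: (@le_trans _ _ (\sum_(i < M.+1) \sum_(j < M.+1)
    box R M (val i, val j) * mdiff u (val i, val j) x ^+ 2)).
  apply: ler_sum => i _; apply: ler_sum => j _; by rewrite /box le2_ord mul1r.
apply: le_trans (sum2_le_support (N := N) _ _ f0 _) _.
  move=> n nN; rewrite /box (_ : le2 n (M, M) = false) ?mul0r//; apply/negbTE.
  by apply: contraNN nN => h; apply: le2_trans h _; rewrite /le2 /= MN.
apply: ler_sum => i _; apply: ler_sum => j _.
by rewrite -[leRHS]mul1r ler_wpM2r ?sqr_ge0// /box; case: le2.
Qed.

Lemma square_esum_ge (R : realType) (u : Defs.family R) x N :
  ((square_sum N u x)%:E <= square_esum u x)%E.
Proof.
apply: esum_ge; exists [set` box_seq N]; first by split=> //; exact: finite_seq.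
by rewrite -fsbig_seq ?uniq_box_seq// sumEFin square_sum_seq.
Qed.

Lemma square_esum_cvg (R : realType) (u : Defs.family R) x :
  (fun N => (square_sum N u x)%:E) @ \oo --> square_esum u x.
Proof.
have nd : nondecreasing_seq (fun N => (square_sum N u x)%:E).
  by move=> M N MN; rewrite lee_fin square_sum_le.
have := ereal_nondecreasing_cvgn nd.
suff -> : ereal_sup (range (fun N => (square_sum N u x)%:E)) = square_esum u x by [].
apply/eqP; rewrite eq_le; apply/andP; split.
  by apply: ge_ereal_sup => _ [N _ <-]; exact: square_esum_ge.
apply: ge_ereal_sup => _ [X [fX _] <-].
pose s := finmap.enum_fset (fset_set X).
have us : uniq s by exact: finmap.fset_uniq.
pose N := \max_(n <- s) maxn n.1 n.2.
have sN n : n \in s -> n \in box_seq N.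
  move=> ns; rewrite mem_box_seq /le2 /=.
  have := @leq_bigmax_seq _ s xpredT (fun n : nat * nat => maxn n.1 n.2) n ns isT.
  by rewrite -/N geq_max.
apply: le_trans (ereal_sup_ubound _); last by exists N.
rewrite fsbig_finite//= -/s sumEFin lee_fin square_sum_seq.
have pe : perm_eq s [seq n <- box_seq N | n \in s].
  apply: uniq_perm => //; first by rewrite filter_uniq// uniq_box_seq.
  move=> n; rewrite mem_filter; case: (boolP (n \in s)) => //= ns.
  by rewrite sN.
rewrite (perm_big _ pe).
rewrite big_filter big_mkcond /=; apply: ler_sum => n _.
by case: ifP => // _; rewrite sqr_ge0.
Qed.

Lemma square_esum_ge0 (R : realType) (u : Defs.family R) x : (0 <= square_esum u x)%E.
Proof. by apply: esum_ge0 => n _; rewrite lee_fin sqr_ge0. Qed.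

Lemma measurable_grid_fun (R : realType) n (f : plane R -> R) : grid_fun n f ->
  measurable_fun setT (EFin \o f).
Proof. by case/integral_grid_fun => /integrableP[]. Qed.

Lemma measurable_square_esum (R : realType) (u : Defs.family R) : is_martingale u ->
  measurable_fun setT (square_esum u).
Proof.
move=> mu; apply: (@emeasurable_fun_cvg _ _ _ _ (fun N x => (square_sum N u x)%:E)).
  by move=> N; exact: measurable_grid_fun (grid_fun_square_sum N mu).
by move=> x _; exact: square_esum_cvg.
Qed.

Lemma square_function_power (R : realType) (u : Defs.family R) (p : R) x :
  (`|square_function u x| `^ p = square_esum u x `^ (p / 2))%E.
Proof.
rewrite /square_function -/(square_esum u x) gee0_abs ?sqrte_ge0//.
by rewrite -poweR12_sqrt ?square_esum_ge0// -poweRrM mulrC.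
Qed.

Lemma in_Hp_power_integral (R : realType) (p : R) u : 0 < p -> in_Hp p u ->
  (power_integral p (square_function u) < +oo)%E.
Proof.
move=> p0 [mu]; rewrite /norm_Hp => h.
by rewrite power_integral_norm// poweR_lty.
Qed.

Lemma powR_half_sqrt (R : realType) (p y : R) : 0 <= y -> Num.sqrt y `^ p = y `^ (p / 2).
Proof. by move=> y0; rewrite -powR12_sqrt// -powRrM mulrC. Qed.

(** The mean in [finite_estimate] is an integral, which any majorant [g] bounds. *)
Lemma truncate_bound (R : realType) (V : Defs.operator R) (p C : R) u N : 0 < p -> 0 <= C ->
  finite_estimate V p C ->
  is_martingale u -> forall th, (forall n, th n ^+ 2 <= 1) ->
  (forall n, ~~ le2 n (N, N) -> th n = 0) ->
  forall g : plane R -> \bar R, measurable_fun setT g -> (forall x, 0 <= g x)%E ->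
  {ae leb2 R, forall x, ((square_sum N (multiplier th u) x `^ (p / 2))%:E <= g x)%E} ->
  (power_integral p (V (multiplier th u)) <= C%:E * \int[leb2 R]_x g x)%E.
Proof.
move=> p0 C0 HC mu th th1 thN g mg g0 hg.
have mm := is_martingale_multiplier th mu.
apply: le_trans (HC N _ mm (confined_multiplier u thN)) _.
rewrite EFinM; apply: lee_wpmul2l; first by rewrite lee_fin.
have gf : grid_fun (N, N) (fun x => Num.sqrt (square_sum N (multiplier th u) x) `^ p).
  apply: (grid_fun1 (h := fun t => Num.sqrt t `^ p)) (grid_fun_square_sum N mm).
  by rewrite sqrtr0 powR0// gt_eqF.
have [_ <-] := integral_grid_fun gf.
apply: ae_ge0_le_integral => //.
- exact: (measurable_grid_fun gf).
by apply: filterS hg => x hx _; rewrite powR_half_sqrt// square_sum_ge0.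
Qed.

Lemma square_sum_multiplier (R : realType) N th (u : Defs.family R) x :
  square_sum N (multiplier th u) x =
  \sum_(i < N.+1) \sum_(j < N.+1) th (val i, val j) ^+ 2 * mdiff u (val i, val j) x ^+ 2.
Proof.
by apply: eq_bigr => i _; apply: eq_bigr => j _; rewrite mdiff_multiplier exprMn.
Qed.

Lemma powR_cvg0_seq (R : realType) (r : R) (z : nat -> R) : 0 < r ->
  (forall k, 0 <= z k) -> z @ \oo --> 0 -> (fun k => z k `^ r) @ \oo --> 0.
Proof.
move=> r0 z0 /cvgrPdist_lt zc; apply/cvgrPdist_lt => e e0.
have d0 : 0 < e `^ r^-1 by rewrite powR_gt0.
apply: filterS (zc _ d0) => k; rewrite !sub0r !normrN (ger0_norm (z0 k)) => zk.
rewrite ger0_norm ?powR_ge0//.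
rewrite -[ltRHS](powRr1 (ltW e0)) -(mulVf (lt0r_neq0 r0)) powRrM.
by apply: gt0_ltr_powR; rewrite ?nnegrE ?powR_ge0.
Qed.

(** * Convergence in measure along truncations *)

(** The squared square function of a tail beyond the box of side [k] is at most
    [S(u)^2 - S_k(u)^2], with [S_k(u)] the square function of the truncation.
    This tends to 0 wherever [S(u)] is finite and is dominated by [S(u)^2], so
    dominated convergence applies to its power [p / 2]. *)
Lemma hardy_tail (R : realType) (V : Defs.operator R) (p C : R) u : 0 < p -> 0 <= C ->
  finite_estimate V p C ->
  in_Hp p u -> forall e, 0 < e ->
  exists k, forall th, tail k th -> finitely_supported th ->
    (power_integral p (V (multiplier th u)) <= e%:E)%E.
Proof.
move=> p0 C0 HC uH e e0; have [mu _] := uH.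
have p2 : 0 < p / 2 by rewrite divr_gt0.
pose Q k x : \bar R := (square_sum k u x)%:E.
pose g k (x : plane R) := (`|square_esum u x - Q k x| `^ (p / 2))%E.
have mZ := measurable_square_esum mu.
have mQ k : measurable_fun setT (Q k) by exact: measurable_grid_fun (grid_fun_square_sum k mu).
have mg k : measurable_fun setT (g k).
  by apply: measurable_abse_poweR; exact: emeasurable_funB.
have iZ : (leb2 R).-integrable setT (fun x => square_esum u x `^ (p / 2))%E.
  apply/integrableP; split.
    by apply: (measurableT_comp (measurable_poweR _)).
  under eq_integral do rewrite gee0_abs ?poweR_ge0// -square_function_power.
  exact: in_Hp_power_integral.
have dom k x : (g k x <= square_esum u x `^ (p / 2))%E.
  apply: lee_poweR => //; first exact: ltW.
  have := square_esum_ge u x k; have := square_sum_ge0 k u x; rewrite /Q.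
  case: (square_esum u x) => [z| |]//= q0.
  by rewrite !lee_fin => qz; rewrite ger0_norm ?subr_ge0// gerBl.
have gc0 : {ae leb2 R, forall x, setT x -> g ^~ x @ \oo --> (cst 0 x : \bar R)%E}.
  apply: filterS (integrable_ae measurableT iZ) => x /(_ I) + _ => Zf.
  have : square_esum u x \is a fin_num.
    move: Zf (square_esum_ge0 u x); case: (square_esum u x) => //=.
    by rewrite gt_eqF.
  have := square_esum_cvg (u := u) (x := x); rewrite /g /Q.
  case: (square_esum u x) => // z /fine_cvgP[_ zc] _.
  apply: cvg_EFin; first by apply: nearW => k.
  apply: (@powR_cvg0_seq _ _ (fun k => `|z - square_sum k u x|)) => //.
  rewrite -(normr0 R) -(subrr z).
  by apply: cvg_norm; apply: cvgB => //; exact: cvg_cst.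
have gdom : {ae leb2 R, forall x n, setT x -> (`|g n x| <= square_esum u x `^ (p / 2))%E}.
  by apply: nearW => x k _; rewrite gee0_abs ?poweR_ge0.
have [_ _] := dominated_convergence measurableT mg (@measurable_cst _ _ _ _ setT 0%E) gc0 iZ gdom.
rewrite integral0 => gc.
(* [C + 1] instead of [C], which may be 0. *)
have d0 : 0 < e / (C + 1) by rewrite divr_gt0// ltr_pwDr.
have [k _ hk] := gc [set y | (y < (e / (C + 1))%:E)%E] (@open_ereal_lt' _ 0%E (e / (C + 1))%:E d0).
exists k => th tk [N thN].
pose M := maxn N k.
have thM n : ~~ le2 n (M, M) -> th n = 0.
  move=> h; apply: thN; apply: contraNN h => h; apply: le2_trans h _.
  by rewrite /le2 /= /M leq_maxl.
apply: (@le_trans _ _ (C%:E * \int[leb2 R]_x g k x)%E).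
  apply: (truncate_bound p0 C0 HC mu _ thM) => //.
  - by move=> n; apply: le_trans (tk n); rewrite lerDl.
  - by move=> x; exact: poweR_ge0.
  apply: nearW => x; rewrite -poweR_EFin; apply: lee_poweR; first exact: ltW.
    by rewrite lee_fin square_sum_ge0.
  have := tail_sum (N := M) (fun n => sqr_ge0 (mdiff u n x)) tk (leq_maxr _ _).
  rewrite -square_sum_multiplier -/(square_sum k u x) -/(square_sum M u x) => h.
  have := square_esum_ge u x M; rewrite /Q.
  case: (square_esum u x) => [z| |]//=; last by move=> _; rewrite leey.
  rewrite !lee_fin => qz; apply: le_trans (ler_norm _); lra.
have := hk k (leqnn k); rewrite /= => hk'.
apply: (@le_trans _ _ (C%:E * (e / (C + 1))%:E)%E).
  by apply: lee_wpmul2l; [rewrite lee_fin|exact: ltW].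
have C1 : 0 < C + 1 by rewrite ltr_pwDr.
by rewrite -EFinM lee_fin mulrA ler_pdivrMr//; nra.
Qed.

(** One parameter for the size and for the measure of the exceptional set: the
    usual distance of convergence in measure. *)
Definition small (R : realType) (e : R) (f : plane R -> \bar R) : Prop :=
  (leb2 R [set x | (e%:E <= `|f x|)%E] <= e%:E)%E.

Lemma measurable_ge_abse (R : realType) (e : R) (f : plane R -> \bar R) :
  measurable_fun setT f -> measurable [set x | (e%:E <= `|f x|)%E].
Proof.
move=> mf; rewrite -[X in measurable X]setTI.
by apply: emeasurable_fun_c_infty => //; exact: measurableT_comp.
Qed.

(** Markov's inequality. *)
Lemma small_power (R : realType) (p e : R) (f : plane R -> \bar R) : 0 < p -> 0 < e ->
  measurable_fun setT f -> (power_integral p f <= (e `^ p * e)%:E)%E -> small e f.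
Proof.
move=> p0 e0 mf h; rewrite /small; set A := [set x | _].
have mA : measurable A by exact: measurable_ge_abse.
have ep : 0 < e `^ p by rewrite powR_gt0.
rewrite -(@lee_pmul2l _ (e `^ p)%:E)// ?lte_fin// -EFinM.
apply: le_trans h; rewrite -(setIT A) -integral_indic// -ge0_integralZl//; last 2 first.
- by apply/measurable_EFinP; exact: measurable_indic.
- by rewrite lee_fin ltW.
apply: ge0_le_integral => //.
- by move=> x _; rewrite mule_ge0// lee_fin// ltW.
- by apply: measurable_funeM; apply/measurable_EFinP; exact: measurable_indic.
- exact: measurable_abse_poweR.
move=> x _; rewrite indicE; case: (boolP (x \in A)) => xA /=; last by rewrite mule0 poweR_ge0.
rewrite mule1 -poweR_EFin; apply: lee_poweR; [exact: ltW|by rewrite lee_fin ltW|].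
by move: xA; rewrite inE.
Qed.

Lemma small_ae_le (R : realType) (e : R) (f g : plane R -> \bar R) :
  measurable_fun setT f -> measurable_fun setT g ->
  {ae leb2 R, forall x, (`|f x| <= `|g x|)%E} -> small e g -> small e f.
Proof.
move=> mf mg [N [mN N0 hN]]; apply: le_trans.
have mG := measurable_ge_abse e mg.
apply: (@le_trans _ _ (leb2 R ([set x | (e%:E <= `|g x|)%E] `|` N))).
  apply: le_measure; rewrite ?inE.
  - exact: measurable_ge_abse.
  - exact: measurableU.
  move=> x /= ef; have [fg|nfg] := pselect (`|f x| <= `|g x|)%E.
    by left; exact: le_trans fg.
  by right; exact: hN.
apply: le_trans (measureU2 _ _ _) _ => //.
by rewrite /= in N0 *; rewrite N0 adde0.
Qed.

Lemma small_add (R : realType) (e : R) (f g : plane R -> \bar R) :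
  measurable_fun setT f -> measurable_fun setT g ->
  small (e / 2) f -> small (e / 2) g -> small e (fun x => `|f x| + `|g x|)%E.
Proof.
move=> mf mg hf hg; rewrite /small.
have mF := measurable_ge_abse (e / 2) mf; have mG := measurable_ge_abse (e / 2) mg.
apply: (@le_trans _ _ (leb2 R ([set x | ((e / 2)%:E <= `|f x|)%E] `|`
    [set x | ((e / 2)%:E <= `|g x|)%E]))).
  apply: le_measure; rewrite ?inE.
  - apply: measurable_ge_abse; apply: emeasurable_funD; exact: measurableT_comp.
  - exact: measurableU.
  move=> x /=; rewrite gee0_abs ?adde_ge0// => h.
  have [a|a] := leP (e / 2)%:E `|f x|%E; first by left.
  have [b|b] := leP (e / 2)%:E `|g x|%E; first by right.
  have := lteD a b; rewrite -EFinD -splitr => /(le_lt_trans h).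
  by rewrite ltxx.
apply: le_trans (measureU2 _ _ _) _ => //.
by rewrite [in leRHS](splitr e) EFinD; apply: leeD.
Qed.

Lemma small_scale (R : realType) (e c : R) (f : plane R -> \bar R) : 0 < e ->
  measurable_fun setT f -> small (e / (`|c| + 1)) f -> small e (fun x => `|c|%:E * `|f x|)%E.
Proof.
move=> e0 mf; set d := e / _ => hf; rewrite /small.
have c1 : 0 < `|c| + 1 by rewrite ltr_pwDr.
have de : d <= e.
  by rewrite /d ler_pdivrMr//; have := normr_ge0 c; nra.
apply: le_trans (le_trans hf _); last by rewrite lee_fin.
apply: le_measure; rewrite ?inE.
- by apply: measurable_ge_abse; apply: measurable_funeM; exact: measurableT_comp.
- exact: measurable_ge_abse.
move=> x /=; rewrite gee0_abs ?mule_ge0 ?lee_fin// => h.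
apply: contraTT h; rewrite -!ltNge => fd.
apply: (@le_lt_trans _ _ (`|c|%:E * d%:E)%E).
  by apply: lee_wpmul2l; [rewrite lee_fin|exact: ltW].
rewrite -EFinM lte_fin /d mulrCA -[ltRHS]mulr1 ltr_pM2l//.
by rewrite ltr_pdivrMr// mul1r ltrDl.
Qed.

(** * The extension of the operator *)

(** [V] maps the differences of far truncations of [u] to functions that are
    small in measure; both [L^2] and the Hardy spaces lie in this linear class. *)
Definition convergent (R : realType) (V : Defs.operator R) (u : Defs.family R) : Prop :=
  forall e, 0 < e -> exists k, forall th, tail k th -> finitely_supported th ->
    small e (V (multiplier th u)).

Lemma measurable_multiplier (R : realType) (V : Defs.operator R) th u :
  measurable_valued V -> is_martingale u -> measurable_fun setT (V (multiplier th u)).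
Proof. by move=> Vm mu; apply: Vm; exact: is_martingale_multiplier. Qed.

Lemma convergent_add (R : realType) (V : Defs.operator R) u v :
  measurable_valued V -> sublinear V -> is_martingale u -> is_martingale v ->
  convergent V u -> convergent V v -> convergent V (fam_add u v).
Proof.
move=> Vm [Va _] mu mv hu hv e e0.
have e20 : 0 < e / 2 by rewrite divr_gt0.
have [k hk] := hu _ e20; have [l hl] := hv _ e20.
exists (maxn k l) => th tkl fth; rewrite multiplier_fam_add.
have mmu := measurable_multiplier th Vm mu; have mmv := measurable_multiplier th Vm mv.
have Mu := is_martingale_multiplier th mu; have Mv := is_martingale_multiplier th mv.
apply: small_ae_le (small_add mmu mmv _ _).
- by apply: Vm; exact: is_martingale_add.
- by apply: emeasurable_funD; exact: measurableT_comp.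
- apply: filterS (Va _ _ Mu Mv) => x h.
  by rewrite [leRHS]gee0_abs ?adde_ge0.
- by apply: hk => //; apply: tail_le tkl; exact: leq_maxl.
- by apply: hl => //; apply: tail_le tkl; exact: leq_maxr.
Qed.

Lemma convergent_scale (R : realType) (V : Defs.operator R) c u :
  measurable_valued V -> sublinear V -> is_martingale u ->
  convergent V u -> convergent V (fam_scale c u).
Proof.
move=> Vm [_ Vs] mu hu e e0.
have d0 : 0 < e / (`|c| + 1) by rewrite divr_gt0// ltr_pwDr.
have [k hk] := hu _ d0.
exists k => th tk fth; rewrite multiplier_fam_scale.
have mmu := measurable_multiplier th Vm mu; have Mu := is_martingale_multiplier th mu.
apply: small_ae_le (small_scale (c := c) e0 mmu _).
- by apply: Vm; exact: is_martingale_scale.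
- by apply: measurable_funeM; exact: measurableT_comp.
- apply: filterS (Vs c _ Mu) => x ->.
  by rewrite [leRHS]gee0_abs ?mule_ge0 ?lee_fin.
- exact: hk.
Qed.

Lemma in_L2_tail (R : realType) (V : Defs.operator R) u :
  measurable_valued V -> bounded_L2_L2 V -> in_Lp 2 u ->
  forall e, 0 < e -> exists k, forall th, tail k th -> small e (V (multiplier th u)).
Proof.
move=> Vm /bounded_L2_energy[C [C0 V2]] uL e e0; have [mu _] := uL.
have [E uE] := in_L2_energy uL.
(* Markov's inequality asks for the bound [e ^+ 2 * e]. *)
have d0 : 0 < e ^+ 3 / (C + 1) by rewrite divr_gt0 ?exprn_gt0// ltr_pwDr.
have [k hk] := energy_tail mu uE d0.
exists k => th tk; apply: (@small_power _ 2) => //.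
  exact: measurable_multiplier.
apply: le_trans (V2 _ _ (is_martingale_multiplier th mu) (hk th tk)) _.
rewrite lee_fin (powR_mulrn 2 (ltW e0)) -exprSr.
have C1 : 0 < C + 1 by rewrite ltr_pwDr.
have e3 : 0 < e ^+ 3 by rewrite exprn_gt0.
by rewrite mulrA ler_pdivrMr//; nra.
Qed.

Lemma in_L2_convergent (R : realType) (V : Defs.operator R) u :
  measurable_valued V -> bounded_L2_L2 V -> in_Lp 2 u -> convergent V u.
Proof.
move=> Vm V2 uL e e0; have [k hk] := in_L2_tail Vm V2 uL e0.
by exists k => th tk _; exact: hk.
Qed.

Lemma in_Hp_convergent (R : realType) (V : Defs.operator R) (p : R) u :
  0 < p -> p <= 1 ->
  measurable_valued V -> sublinear V -> bounded_L2_L2 V -> support_condition V ->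
  in_Hp p u -> convergent V u.
Proof.
move=> p0 p1 Vm Vs V2 Vsupp uH e e0.
have [C C0 HC] := finite_bound p0 p1 Vm Vs V2 Vsupp.
have d0 : 0 < e `^ p * e by rewrite mulr_gt0// powR_gt0.
have [k hk] := hardy_tail p0 C0 HC uH d0.
exists k => th tk fth; apply: (small_power p0 e0); last exact: hk.
by apply: measurable_multiplier => //; case: uH.
Qed.

Lemma half_pow_gt0 (R : realType) j : 0 < 2 ^- j :> R.
Proof. by rewrite invr_gt0 exprn_gt0. Qed.

(** The measures of the exceptional sets are summable. *)
Lemma small_borel_cantelli (R : realType) (f : nat -> plane R -> \bar R) :
  (forall j, measurable_fun setT (f j)) -> (forall j, small (2 ^- j) (f j)) ->
  {ae leb2 R, forall x, exists J, forall j, (J <= j)%N -> (`|f j x| < (2 ^- j)%:E)%E}.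
Proof.
move=> mf sf; pose F j : set (plane R) := [set x | ((2 ^- j)%:E <= `|f j x|)%E].
have mF j : measurable (F j) by exact: measurable_ge_abse.
have F0 : leb2 R (lim_sup_set F) = 0%E.
  apply: lim_sup_set_cvg0 => //.
  apply: (@le_lt_trans _ _ (\sum_(j <oo) (2 / (2 ^ j.+1)%:R)%:E)%E).
    apply: lee_nneseries => // j _; apply: le_trans (sf j) _.
    by rewrite lee_fin natrX exprS invfM mulrA divff// mul1r.
  by apply: le_lt_trans (epsilon_trick0 _ _) (ltry _).
exists (lim_sup_set F); split=> //.
  by apply: bigcap_measurable => // k _; exact: bigcup_measurable.
move=> x /= nx J _; apply: contrapT => h; apply: nx; exists J => j Jj.
rewrite ltNge; apply/negP => fj; apply: h; exists j => //.
Qed.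

Lemma in_L2_ae_finite (R : realType) (V : Defs.operator R) u :
  measurable_valued V -> bounded_L2_L2 V -> in_Lp 2 u ->
  {ae leb2 R, forall x, V u x \is a fin_num}.
Proof.
move=> Vm /bounded_L2_energy[C [C0 V2]] uL; have [mu _] := uL.
have [E uE] := in_L2_energy uL.
have iV : (leb2 R).-integrable setT (fun x => `|V u x| `^ 2)%E.
  apply/integrableP; split; first by apply: measurable_abse_poweR; exact: Vm.
  under eq_integral do rewrite gee0_abs ?poweR_ge0//.
  exact: le_lt_trans (V2 _ _ mu uE) (ltry _).
apply: filterS (integrable_ae measurableT iV) => x /(_ I).
by case: (V u x) => //=; rewrite gt_eqF.
Qed.

Lemma truncate_in_L2 (R : realType) k (u : Defs.family R) : is_martingale u ->
  in_Lp 2 (truncate k u).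
Proof.
move=> mu; have mt := is_martingale_multiplier (@box R k) mu.
apply: (energy_in_L2 (E := energy (truncate k u) (k, k))) => // -[a b].
rewrite (energy_diag k mt) energy_mdiff//=.
apply: (sum2_le_support (f := energy (mdiff (truncate k u)))) => n.
  exact: energy_ge0.
by move=> /negbTE h; rewrite energy_multiplier /box h expr0n mul0r.
Qed.

Definition threshold (R : realType) (V : Defs.operator R) (u : Defs.family R) (e : R) : nat :=
  xget 0%N [set k | forall th, tail k th -> finitely_supported th ->
    small e (V (multiplier th u))].

(** Thresholds for the sequence [2 ^- j], made nondecreasing in [j]. *)
Definition rate (R : realType) (V : Defs.operator R) (u : Defs.family R) (j : nat) : nat :=
  \max_(i < j.+1) threshold V u (2 ^- i).

Lemma rate_succ (R : realType) (V : Defs.operator R) u j : (rate V u j <= rate V u j.+1)%N.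
Proof. by rewrite /rate [X in (_ <= X)%N]big_ord_recr leq_maxl. Qed.

Lemma rate_small (R : realType) (V : Defs.operator R) u j th : convergent V u ->
  tail (rate V u j) th -> finitely_supported th -> small (2 ^- j) (V (multiplier th u)).
Proof.
move=> cu tth fth.
have := @xgetPex _ 0%N [set k | forall th, tail k th -> finitely_supported th ->
    small (2 ^- j) (V (multiplier th u))] (cu _ (half_pow_gt0 R j)).
apply => //; apply: tail_le tth.
by rewrite /rate big_ord_recr leq_maxr.
Qed.

(** The upper limit is a limit almost everywhere; written as an upper limit it is
    measurable and defined everywhere. *)
Definition limit_abs (R : realType) (V : Defs.operator R) (u : Defs.family R) (x : plane R)
  : \bar R := limn_esup (fun j => `|V (truncate (rate V u j) u) x|)%E.

(** The two truncations differ by a tail of [u], to which Borel-Cantelli applies. *)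
Lemma truncate_close (R : realType) (V : Defs.operator R) u (s t : nat -> nat) :
  measurable_valued V -> sublinear V -> bounded_L2_L2 V ->
  is_martingale u -> convergent V u ->
  (forall j, rate V u j <= s j)%N -> (forall j, rate V u j <= t j)%N ->
  {ae leb2 R, forall x, exists J, forall j, (J <= j)%N ->
     (`|V (truncate (s j) u) x| <= `|V (truncate (t j) u) x| + (2 ^- j)%:E)%E}.
Proof.
move=> Vm [Va _] V2 mu cu hs ht.
pose th j n := box R (s j) n - box R (t j) n.
have A : {ae leb2 R, forall x, forall j, (`|V (truncate (s j) u) x| <=
    `|V (truncate (t j) u) x| + `|V (multiplier (th j) u) x|)%E}.
  apply/ae_foralln => j; rewrite /truncate (multiplierB (box R (s j)) (box R (t j))).
  by apply: Va; exact: is_martingale_multiplier.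
have B := @small_borel_cantelli _ (fun j => V (multiplier (th j) u))
  (fun j => measurable_multiplier (th j) Vm mu)
  (fun j => rate_small cu (tail_box_sub R (hs j) (ht j)) (finitely_supported_box_sub R _ _)).
apply: filterS2 A B => x A [J B]; exists J => j Jj.
by apply: le_trans (A j) _; rewrite leeD2l// ltW// B.
Qed.

Lemma cvg_half_pow (R : realType) : (fun j => 2 ^- j : R) @ \oo --> (0 : R).
Proof.
have -> : (fun j => 2 ^- j : R) = GRing.exp (2^-1 : R).
  by apply/funext => j; rewrite exprVn.
by apply: cvg_expr; rewrite ger0_norm// invf_lt1// ltr1n.
Qed.

(** Correcting [a] by [2 * 2 ^- j], the sum of the remaining steps, makes it
    monotone in either direction. *)
Lemma cvg_geometric_steps (R : realType) (a : nat -> R) J :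
  (forall j, (J <= j)%N -> `|a j.+1 - a j| <= 2 ^- j) -> cvgn a.
Proof.
move=> h; pose c n := a (n + J)%N - 2 * 2 ^- (n + J).
pose d n := a (n + J)%N + 2 * 2 ^- (n + J).
have hS n : 2 ^- (n + J).+1 = 2^-1 * 2 ^- (n + J) :> R by rewrite exprS invfM.
have st n : `|a (n + J).+1 - a (n + J)%N| <= 2 ^- (n + J) by apply: h; rewrite leq_addl.
have cn : nondecreasing_seq c.
  apply/nondecreasing_seqP => n; rewrite /c addSn hS; have := st n.
  rewrite ler_norml => /andP[h1 _]; lra.
have dn n : d n <= d 0%N.
  elim: n => // n; apply: le_trans; rewrite /d addSn hS; have := st n.
  rewrite ler_norml => /andP[_ h1]; lra.
have cc : cvgn c.
  apply: nondecreasing_is_cvgn => //; exists (d 0%N) => _ [n _ <-].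
  apply: le_trans (dn n); rewrite /c /d; have := half_pow_gt0 R (n + J); lra.
apply/cvg_ex; exists (limn c).
rewrite -(cvg_shiftn J) -[limn c]addr0.
have -> : (fun n => a (n + J)%N) = (fun n => c n + 2 * 2 ^- (n + J)).
  by apply/funext => n; rewrite /c subrK.
apply: cvgD => //; rewrite -[0](mulr0 2); apply: cvgM; first exact: cvg_cst.
by rewrite (cvg_shiftn J (fun j => 2 ^- j : R)); exact: cvg_half_pow.
Qed.

Lemma close_cvg (R : realType) (A B : nat -> \bar R) (l : R) J :
  (forall j, A j \is a fin_num) -> (forall j, B j \is a fin_num) ->
  (forall j, (J <= j)%N -> (A j <= B j + (2 ^- j)%:E)%E) ->
  (forall j, (J <= j)%N -> (B j <= A j + (2 ^- j)%:E)%E) ->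
  A @ \oo --> l%:E -> B @ \oo --> l%:E.
Proof.
move=> fA fB AB BA /fine_cvgP[_ Al].
apply/fine_cvgP; split; first exact: nearW.
have -> : fine \o B = (fun j => fine (A j) + (fine (B j) - fine (A j))).
  by apply/funext => j /=; rewrite addrC subrK.
rewrite -[l]addr0; apply: cvgD => //.
apply: (@squeeze_cvgr _ _ _ _ (fun j => - 2 ^- j) (fun j => 2 ^- j)).
- exists J => // j Jj; have := AB j Jj; have := BA j Jj.
  rewrite -(fineK (fA j)) -(fineK (fB j)) -!EFinD !lee_fin /= => h1 h2.
  by apply/andP; split; lra.
- by rewrite -oppr0; apply: cvgN; exact: cvg_half_pow.
- exact: cvg_half_pow.
Qed.

Lemma truncate_finite (R : realType) (V : Defs.operator R) u (s : nat -> nat) :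
  measurable_valued V -> bounded_L2_L2 V -> is_martingale u ->
  {ae leb2 R, forall x, forall j, (`|V (truncate (s j) u) x|)%E \is a fin_num}.
Proof.
move=> Vm V2 mu; apply/ae_foralln => j.
apply: filterS (in_L2_ae_finite Vm V2 (truncate_in_L2 (s j) mu)) => x.
by rewrite abse_fin_num.
Qed.

(** Along [rate V u] the consecutive differences are summable, hence the values
    converge; any faster sequence stays close to this one. *)
Lemma truncate_limit (R : realType) (V : Defs.operator R) u (s : nat -> nat) :
  measurable_valued V -> sublinear V -> bounded_L2_L2 V ->
  is_martingale u -> convergent V u -> (forall j, rate V u j <= s j)%N ->
  {ae leb2 R, forall x, limit_abs V u x \is a fin_num /\
     (fun j => `|V (truncate (s j) u) x|)%E @ \oo --> limit_abs V u x}.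
Proof.
move=> Vm Vs V2 mu cu hs; set r := rate V u.
have rr j : (r j <= r j)%N by [].
have rS := rate_succ V u.
have c1 := truncate_close Vm Vs V2 mu cu hs rr.
have c2 := truncate_close Vm Vs V2 mu cu rr hs.
have c3 := truncate_close Vm Vs V2 mu cu rr rS.
have c4 := truncate_close Vm Vs V2 mu cu rS rr.
have fr := truncate_finite r Vm V2 mu; have fs := truncate_finite s Vm V2 mu.
apply: filterS2 (filterI c1 c2) (filterI (filterI c3 c4) (filterI fr fs)).
move=> x [[J1 h1] [J2 h2]] [[[J3 h3] [J4 h4]] [far fas]].
pose J := maxn (maxn J1 J2) (maxn J3 J4).
pose a j := fine `|V (truncate (r j) u) x|%E.
have aE j : (`|V (truncate (r j) u) x| = (a j)%:E)%E by rewrite fineK.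
have /cvg_ex[l al] : cvgn a.
  apply: (@cvg_geometric_steps _ _ J) => j Jj.
  have := h3 j _; have := h4 j _; rewrite !aE -!EFinD !lee_fin => H4 H3.
  rewrite ler_norml; have {}H3 := H3 (leq_trans _ Jj); have {}H4 := H4 (leq_trans _ Jj).
  have {}H3 : a j <= a j.+1 + 2 ^- j by apply: H3; rewrite /J; lia.
  have {}H4 : a j.+1 <= a j + 2 ^- j by apply: H4; rewrite /J; lia.
  by apply/andP; split; lra.
have Al : (fun j => `|V (truncate (r j) u) x|)%E @ \oo --> l%:E.
  by apply/fine_cvgP; split=> //; exact: nearW.
have -> : limit_abs V u x = l%:E by rewrite /limit_abs; case: (cvg_limn_einf_sup Al).
split=> //; apply: (@close_cvg _ _ _ _ J) Al => // j Jj.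
  by apply: h2; apply: leq_trans Jj; rewrite /J; lia.
by apply: h1; apply: leq_trans Jj; rewrite /J; lia.
Qed.

Lemma sublinear_triangle (R : realType) (V : Defs.operator R) w u v :
  sublinear V -> is_martingale u -> is_martingale v -> w = fam_add u v ->
  {ae leb2 R, forall x, (`|V w x| <= `|V u x| + `|V v x|)%E}.
Proof. by move=> [Va _] mu mv ->; exact: Va. Qed.

(** On [L^2] the remainders also tend to 0, so that truncations chosen late enough
    converge to [V u] as well as to [limit_abs V u]. *)
Lemma limit_abs_L2 (R : realType) (V : Defs.operator R) u :
  measurable_valued V -> sublinear V -> bounded_L2_L2 V -> in_Lp 2 u ->
  {ae leb2 R, forall x, limit_abs V u x = `|V u x|%E}.
Proof.
move=> Vm Vs V2 uL; have [mu _] := uL; have [Va _] := Vs.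
have cu := in_L2_convergent Vm V2 uL.
have /choice[k hk] : forall j, exists k, forall th, tail k th ->
    small (2 ^- j) (V (multiplier th u)).
  by move=> j; exact: in_L2_tail (half_pow_gt0 R j).
pose t j := maxn (rate V u j) (k j).
have rt j : (rate V u j <= t j)%N by exact: leq_maxl.
have kt j : (k j <= t j)%N by exact: leq_maxr.
pose th j n := 1 - box R (t j) n; pose th' j n := box R (t j) n - 1.
have A : {ae leb2 R, forall x, forall j, (`|V u x| <=
    `|V (truncate (t j) u) x| + `|V (multiplier (th j) u) x|)%E}.
  apply/ae_foralln => j; apply: sublinear_triangle => //; try exact: is_martingale_multiplier.
  by rewrite -[LHS]multiplier1 (multiplierB (fun=> 1) (box R (t j))).
have A' : {ae leb2 R, forall x, forall j, (`|V (truncate (t j) u) x| <=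
    `|V u x| + `|V (multiplier (th' j) u) x|)%E}.
  apply/ae_foralln => j; apply: sublinear_triangle => //; try exact: is_martingale_multiplier.
  by rewrite /truncate (multiplierB (box R (t j)) (fun=> 1)) multiplier1.
have B := @small_borel_cantelli _ (fun j => V (multiplier (th j) u))
  (fun j => measurable_multiplier (th j) Vm mu) (fun j => hk j _ (tail_box R (kt j))).
have B' := @small_borel_cantelli _ (fun j => V (multiplier (th' j) u))
  (fun j => measurable_multiplier (th' j) Vm mu) (fun j => hk j _ (tail_box' R (kt j))).
have T := truncate_limit Vm Vs V2 mu cu rt.
have F := in_L2_ae_finite Vm V2 uL; have ft := truncate_finite t Vm V2 mu.
apply: filterS2 (filterI (filterI A A') (filterI B B')) (filterI T (filterI F ft)).
move=> x [[a a'] [[J b] [J' b']]] [[lf lc] [Vf fx]].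
have aVf : (`|V u x|)%E \is a fin_num by rewrite abse_fin_num.
apply: (@cvg_unique _ (@ereal_hausdorff R) _ _ _ _ lc).
rewrite -(fineK aVf).
apply: (@close_cvg _ (fun=> `|V u x|%E) _ _ (maxn J J')) => //.
- move=> j Jj; apply: le_trans (a j) _; rewrite leeD2l// ltW// b//.
  by apply: leq_trans Jj; exact: leq_maxl.
- move=> j Jj; apply: le_trans (a' j) _; rewrite leeD2l// ltW// b'//.
  by apply: leq_trans Jj; exact: leq_maxr.
- by rewrite fineK//; exact: cvg_cst.
Qed.

(** Outside the class on which the truncations converge the value [+oo] is
    compatible with sublinearity. *)
Definition extension (R : realType) (V : Defs.operator R) : Defs.operator R := fun u =>
  if `[< in_Lp 2 u >] then V u
  else if `[< convergent V u >] then limit_abs V u else (fun=> +oo%E).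

Lemma measurable_extension (R : realType) (V : Defs.operator R) :
  measurable_valued V -> measurable_valued (extension V).
Proof.
move=> Vm u mu; rewrite /extension; case: asboolP => _; first exact: Vm.
case: asboolP => _; last exact: measurable_cst.
apply: measurable_fun_limn_esup => j; apply: measurableT_comp => //.
exact: measurable_multiplier.
Qed.

Lemma extension_L2 (R : realType) (V : Defs.operator R) : extends_from_L2 V (extension V).
Proof. by move=> u uL; apply: nearW => x; rewrite /extension asboolT. Qed.

Lemma extension_limit (R : realType) (V : Defs.operator R) u (s : nat -> nat) :
  measurable_valued V -> sublinear V -> bounded_L2_L2 V ->
  is_martingale u -> convergent V u -> (forall j, rate V u j <= s j)%N ->
  {ae leb2 R, forall x, (`|extension V u x|)%E \is a fin_num /\
     (fun j => `|V (truncate (s j) u) x|)%E @ \oo --> `|extension V u x|%E}.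
Proof.
move=> Vm Vs V2 mu cu hs; have T := truncate_limit Vm Vs V2 mu cu hs.
rewrite /extension; case: asboolP => [uL|_].
  apply: filterS2 T (limit_abs_L2 Vm Vs V2 uL) => x [lf lc] e.
  by rewrite -e.
rewrite asboolT//; apply: filterS T => x [lf lc]; rewrite abse_fin_num; split=> //.
rewrite (_ : (fun j => _) = fun j => abse (abse (V (truncate (s j) u) x))).
  exact: cvg_abse lc.
by apply/funext => j; rewrite abse_id.
Qed.

Lemma extension_notin (R : realType) (V : Defs.operator R) u :
  measurable_valued V -> bounded_L2_L2 V ->
  ~ convergent V u -> extension V u = fun=> +oo%E.
Proof.
move=> Vm V2 cu; rewrite /extension asboolF ?asboolF// => uL.
exact: cu (in_L2_convergent Vm V2 uL).
Qed.

Lemma le_addye (R : realType) (a b : \bar R) : (a <= `|+oo| + `|b|)%E.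
Proof. by rewrite /= addye ?leey// -ltNye (lt_le_trans _ (abse_ge0 _)). Qed.

Lemma sublinear_extension (R : realType) (V : Defs.operator R) :
  measurable_valued V -> sublinear V -> bounded_L2_L2 V -> sublinear (extension V).
Proof.
move=> Vm Vs V2; have [Va Vh] := Vs; split=> [u v mu mv|c u mu].
  have [cu|ncu] := pselect (convergent V u); last first.
    have e := extension_notin Vm V2 ncu.
    by apply: nearW => x; rewrite [extension V u]e; exact: le_addye.
  have [cv|ncv] := pselect (convergent V v); last first.
    have e := extension_notin Vm V2 ncv.
    by apply: nearW => x; rewrite [extension V v]e addeC; exact: le_addye.
  have cuv := convergent_add Vm Vs mu mv cu cv.
  have muv := is_martingale_add mu mv.
  (* A common sequence for [u], [v] and their sum. *)
  pose s j := maxn (maxn (rate V u j) (rate V v j)) (rate V (fam_add u v) j).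
  have su j : (rate V u j <= s j)%N by rewrite /s; lia.
  have sv j : (rate V v j <= s j)%N by rewrite /s; lia.
  have suv j : (rate V (fam_add u v) j <= s j)%N by rewrite /s; lia.
  have A : {ae leb2 R, forall x, forall j, (`|V (truncate (s j) (fam_add u v)) x| <=
      `|V (truncate (s j) u) x| + `|V (truncate (s j) v) x|)%E}.
    apply/ae_foralln => j; apply: sublinear_triangle => //; try exact: is_martingale_multiplier.
    exact: multiplier_fam_add.
  have Lu := extension_limit Vm Vs V2 mu cu su; have Lv := extension_limit Vm Vs V2 mv cv sv.
  have Luv := extension_limit Vm Vs V2 muv cuv suv.
  apply: filterS2 (filterI A Luv) (filterI Lu Lv) => x [a [fuv luv]] [[fu lu] [fv lv]].
  have luv' : (fun j => `|V (truncate (s j) u) x| + `|V (truncate (s j) v) x|)%E @ \oo -->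
      (`|extension V u x| + `|extension V v x|)%E.
    by apply: cvgeD => //; exact: fin_num_adde_defl.
  rewrite -(cvg_lim _ luv)// -(cvg_lim _ luv')//.
  apply: lee_lim; [exact: cvgP luv|exact: cvgP luv'|].
  by apply: nearW => j; exact: a.
have [->|c0] := eqVneq c 0.
  have L0 : in_Lp 2 (fam_scale 0 u).
    apply: (energy_in_L2 (E := 0)) (is_martingale_scale _ mu) _ => n.
    rewrite /energy /grid_mean big1 ?mulr0// => i _; rewrite big1// => j _.
    by rewrite /fam_scale mul0r expr0n.
  apply: filterS (Vh 0 u mu) => x; rewrite /extension asboolT// => ->.
  by rewrite normr0 !mul0e.
have [cu|ncu] := pselect (convergent V u); last first.
  have ncu' : ~ convergent V (fam_scale c u).
    move=> ccu; apply: ncu.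
    have -> : u = fam_scale c^-1 (fam_scale c u).
      by apply/funext => n; apply/funext => y; rewrite /fam_scale mulKf.
    exact: convergent_scale (is_martingale_scale _ mu) ccu.
  have e := extension_notin Vm V2 ncu; have e' := extension_notin Vm V2 ncu'.
  apply: nearW => x; rewrite [extension V u]e [extension V (fam_scale c u)]e' /=.
  by rewrite gt0_muley// lte_fin normr_gt0.
have ccu := convergent_scale c Vm Vs mu cu; have mcu := is_martingale_scale c mu.
pose s j := maxn (rate V u j) (rate V (fam_scale c u) j).
have A : {ae leb2 R, forall x, forall j, (`|V (truncate (s j) (fam_scale c u)) x| =
    `|c|%:E * `|V (truncate (s j) u) x|)%E}.
  apply/ae_foralln => j; apply: filterS (Vh c _ (is_martingale_multiplier (box R (s j)) mu)) => x <-.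
  by rewrite /truncate multiplier_fam_scale.
have Lu := extension_limit Vm Vs V2 mu cu (fun j => leq_maxl _ _ : (_ <= s j)%N).
have Lcu := extension_limit Vm Vs V2 mcu ccu (fun j => leq_maxr _ _ : (_ <= s j)%N).
apply: filterS2 A (filterI Lu Lcu) => x a [[fu lu] [fcu lcu]].
apply: (@cvg_unique _ (@ereal_hausdorff R) _ _ _ _ lcu).
have -> : (fun j => `|V (truncate (s j) (fam_scale c u)) x|%E) =
    (fun j => `|c|%:E * `|V (truncate (s j) u) x|)%E by apply/funext => j; exact: a.
exact: cvgeZl.
Qed.

(** Powers with exponent at most 1 are Hoelder continuous, by subadditivity. *)
Lemma cvg_poweR_abs (R : realType) (p : R) (A : nat -> \bar R) (l : \bar R) :
  0 < p -> p <= 1 -> l \is a fin_num -> (forall j, 0 <= A j)%E -> A @ \oo --> l ->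
  (fun j => A j `^ p)%E @ \oo --> (l `^ p)%E.
Proof.
move=> p0 p1; case: l => [l| |]// _ A0 Al.
have l0 : 0 <= l by rewrite -lee_fin; apply: cvge_ge Al; exact: nearW.
have /fine_cvgP[Af fl] := Al.
apply/fine_cvgP; split; first by apply: filterS Af => j; exact: fin_num_poweR.
have -> : (fine \o (fun j => A j `^ p)%E) = (fun j => fine (A j) `^ p).
  by apply/funext => j /=; rewrite fine_poweR.
have a0 j : 0 <= fine (A j) by exact: fine_ge0.
have d : (fun j => `|fine (A j) - l| `^ p) @ \oo --> 0.
  apply: powR_cvg0_seq => //; rewrite -(normr0 R) -(subrr l).
  by apply: cvg_norm; apply: cvgB => //; exact: cvg_cst.
have K x y : 0 <= x -> 0 <= y -> x `^ p <= y `^ p + `|x - y| `^ p.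
  move=> x0 y0; apply: le_trans (powR_subadd p0 p1 y0 (normr_ge0 (x - y))).
  apply: ge0_ler_powR; rewrite ?nnegrE ?addr_ge0//; first exact: ltW.
  by have := ler_norm (x - y); lra.
apply: (@squeeze_cvgr _ _ _ _ (fun j => l `^ p - `|fine (A j) - l| `^ p)
   (fun j => l `^ p + `|fine (A j) - l| `^ p)).
- apply: nearW => j; rewrite K// andbT.
  by have := K l (fine (A j)) l0 (a0 j); rewrite distrC; lra.
- by rewrite -[X in _ --> X]subr0; apply: cvgB => //; exact: cvg_cst.
- by rewrite -[X in _ --> X]addr0; apply: cvgD => //; exact: cvg_cst.
Qed.

Lemma truncate_power_integral (R : realType) (V : Defs.operator R) (p C : R) u k :
  0 < p -> 0 <= C ->
  finite_estimate V p C ->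
  is_martingale u ->
  (power_integral p (V (truncate k u)) <= C%:E * power_integral p (square_function u))%E.
Proof.
move=> p0 C0 HC mu.
have b1 n : box R k n ^+ 2 <= 1 by rewrite /box; case: le2; rewrite ?expr1n ?expr0n.
have bk n : ~~ le2 n (k, k) -> box R k n = 0 by move=> /negbTE h; rewrite /box h.
have -> : power_integral p (square_function u) =
    (\int[leb2 R]_x (square_esum u x `^ (p / 2)))%E.
  by apply: eq_integral => x _; rewrite square_function_power.
apply: (truncate_bound p0 C0 HC mu b1 bk).
- by apply: (measurableT_comp (measurable_poweR _)); exact: measurable_square_esum.
- by move=> x; exact: poweR_ge0.
apply: nearW => x; rewrite -poweR_EFin; apply: lee_poweR.
- by rewrite divr_ge0// ltW.
- by rewrite lee_fin square_sum_ge0.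
apply: le_trans (square_esum_ge u x k); rewrite lee_fin square_sum_multiplier.
apply: ler_sum => i _; apply: ler_sum => j _.
by rewrite -[leRHS]mul1r ler_wpM2r ?sqr_ge0.
Qed.

(** Fatou's lemma along the truncations. *)
Lemma extension_power_integral (R : realType) (V : Defs.operator R) (p C : R) u :
  0 < p -> p <= 1 -> 0 <= C ->
  measurable_valued V -> sublinear V -> bounded_L2_L2 V ->
  finite_estimate V p C ->
  is_martingale u -> convergent V u ->
  (power_integral p (extension V u) <= C%:E * power_integral p (square_function u))%E.
Proof.
move=> p0 p1 C0 Vm Vs V2 HC mu cu.
pose f j (x : plane R) := (`|V (truncate (rate V u j) u) x| `^ p)%E.
have mf j : measurable_fun setT (f j).
  by apply: measurable_abse_poweR; exact: measurable_multiplier.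
have f0 j x : setT x -> (0 <= f j x)%E by move=> _; exact: poweR_ge0.
have L := extension_limit Vm Vs V2 mu cu (fun j => leqnn (rate V u j)).
have Lf : {ae leb2 R, forall x, limn_einf (f ^~ x) = (`|extension V u x| `^ p)%E}.
  apply: filterS L => x [ef el].
  have c : f ^~ x @ \oo --> (`|extension V u x| `^ p)%E.
    exact: (cvg_poweR_abs p0 p1 ef (fun j => abse_ge0 _) el).
  by case: (cvg_limn_einf_sup c).
have ml : measurable_fun setT (fun x => limn_einf (f ^~ x)).
  rewrite /limn_einf; apply: measurableT_comp => //.
  by apply: measurable_fun_limn_esup => j; exact: measurableT_comp.
have -> : power_integral p (extension V u) = (\int[leb2 R]_x limn_einf (f ^~ x))%E.
  apply: ae_eq_integral => //.
    by apply: measurable_abse_poweR; exact: measurable_extension.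
  by apply: filterS Lf => x e _.
apply: le_trans (fatou _ measurableT mf f0) _.
rewrite limn_einf_lim; apply: lime_le; first exact: is_cvg_einfs.
apply: nearW => n; apply: (@le_trans _ _ (\int[leb2 R]_x f n x)%E).
  by apply: ereal_inf_lbound; exists n => /=.
exact: truncate_power_integral.
Qed.

Theorem theorem4 (R : realType) (V : operator R)
    (V_meas : measurable_valued V) (V_sub : sublinear V)
    (V_L2 : bounded_L2_L2 V) (V_supp : support_condition V) :
  exists W : operator R,
    [/\ measurable_valued W, sublinear W, extends_from_L2 V W &
        forall p : R, 0 < p -> p <= 1 -> bounded_Hp_Lp p W].
Proof.
exists (extension V); split.
- exact: measurable_extension.
- exact: sublinear_extension.
- exact: extension_L2.
move=> p p0 p1; have [C C0 HC] := finite_bound p0 p1 V_meas V_sub V_L2 V_supp.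
exists (C `^ p^-1) => u uH; have [mu _] := uH.
have cu := in_Hp_convergent p0 p1 V_meas V_sub V_L2 V_supp uH.
have H := extension_power_integral p0 p1 C0 V_meas V_sub V_L2 HC mu cu.
have N f : ('N[leb2 R]_(p%:E)[f] = power_integral p f `^ p^-1)%E by rewrite unlock.
rewrite /norm_Hp !N -poweR_EFin -poweRM ?lee_fin ?power_integral_ge0//.
apply: lee_poweR; [by rewrite invr_ge0 ltW|exact: power_integral_ge0|exact: H].
Qed.
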